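(* Let $\lambda\in(0,N/2)$, let $f_\varepsilon^0$ and $\psi_\varepsilon$ satisfy (H1) and (H2) (stated in the context), and let $f_\varepsilon$ be the strong global-in-time solution of the scaled kinetic equation given in the context with initial datum $f_\varepsilon^0$. Then $$\liminf_{R\to0}\ \liminf_{\varepsilon\to0}\ \big|\rho_\varepsilon(t,\cdot)\otimes j_\varepsilon(t,\cdot)-j_\varepsilon(t,\cdot)\otimes\rho_\varepsilon(t,\cdot)\big|(\Omega_R)=0\qquad\text{for a.e. } t\in[0,T),$$ where $\Omega_R:=\{(x,y)\in\mathbb{R}^{2N}:|x-y|<R\}$ and $$\big|\rho_\varepsilon(t,\cdot)\otimes j_\varepsilon(t,\cdot)-j_\varepsilon(t,\cdot)\otimes\rho_\varepsilon(t,\cdot)\big|(\Omega_R)=\iint_{|x-y|<R}|\rho_\varepsilon(t,x)j_\varepsilon(t,y)-j_\varepsilon(t,x)\rho_\varepsilon(t,y)|\,dx\,dy.$$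
   Context: $N$ is the space dimension, $0<T<\infty$. Put $c_\lambda=2^{1/\lambda}-1$ and $\phi_\varepsilon(r)=(\varepsilon^2+c_\lambda r^2)^{-\lambda}$ for $\varepsilon>0$; convolutions with $\phi_\varepsilon$ are in $x$ with kernel $\phi_\varepsilon(|x|)$. $\mathcal{M}(\mathbb{R}^N)=C_0(\mathbb{R}^N)^*$ is the space of finite Radon measures. Kinetic equation: $f_\varepsilon=f_\varepsilon(t,x,v)\ge0$ is the strong global-in-time solution, with enough decay at infinity in $(x,v)$ for its velocity moments to be finite and integrations by parts to be legitimate, of $$\varepsilon\partial_tf_\varepsilon+\varepsilon v\cdot\nabla_xf_\varepsilon-\nabla_x\psi_\varepsilon\cdot\nabla_vf_\varepsilon=\operatorname{div}_v\big(f_\varepsilon v+\nabla_vf_\varepsilon+f_\varepsilon(\phi_\varepsilon*\rho_\varepsilon)v-f_\varepsilon(\phi_\varepsilon*j_\varepsilon)\big),\quad f_\varepsilon(0,\cdot,\cdot)=f_\varepsilon^0,$$ where $\rho_\varepsilon(t,x)=\int_{\mathbb{R}^N}f_\varepsilon\,dv$ and $j_\varepsilon(t,x)=\int_{\mathbb{R}^N}vf_\varepsilon\,dv$. (H1): $f_\varepsilon^0\ge0$, $f_\varepsilon^0\in C_c^\infty(\mathbb{R}^N\times\mathbb{R}^N)$, $\|f_\varepsilon^0\|_{L^1(\mathbb{R}^{2N})}\le M_0$, $\||v|^2f_\varepsilon^0\|_{L^1(\mathbb{R}^{2N})}\le E_0$ for all $\varepsilon>0$, with $M_0,E_0>0$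 independent of $\varepsilon$, and $\rho_\varepsilon^0:=\int f_\varepsilon^0\,dv\overset{*}{\rightharpoonup}\rho^0$ in $\mathcal{M}(\mathbb{R}^N)$ as $\varepsilon\to0$. (H2): $\psi_\varepsilon,\psi\in L^2(0,T;W^{1,\infty}(\mathbb{R}^N))$; $\nabla\psi_\varepsilon(t,\cdot),\nabla\psi(t,\cdot)\in C_0(\mathbb{R}^N,\mathbb{R}^N)$ for a.e. $t$; $\|\nabla\psi_\varepsilon\|_{L^2(0,T;L^\infty(\mathbb{R}^N,\mathbb{R}^N))}\le F_0$ for all $\varepsilon>0$ with $F_0>0$ independent of $\varepsilon$; $\nabla\psi_\varepsilon\to\nabla\psi$ in $L^1(0,T;C_0(\mathbb{R}^N))$. *)

(* Defs.v *)
From HB Require Import structures.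
From mathcomp Require Import all_boot all_order all_algebra.
From mathcomp Require Import all_classical all_reals all_analysis.
Import Order.TTheory GRing.Theory Num.Theory.
Import numFieldNormedType.Exports.

Set Implicit Arguments.
Unset Strict Implicit.
Unset Printing Implicit Defensive.

Local Open Scope classical_set_scope.
Local Open Scope ring_scope.

(** The library has neither a sigma-algebra nor a measure on ['rV[R]_n].
    The sigma-algebra below is generated by the coordinate maps, i.e. it is the Borel
    one; the measure is the n-fold product of [lebesgue_measure]. *)

Definition rV_display : measure_display.
Proof. exact: default_measure_display. Qed.

Section measurable_rV.
Context {R : realType} (n : nat).

Definition rV_coord (i : 'I_n) (v : 'rV[R]_n) : R := v 0 i.

Let rV_set0 : g_sigma_preimage rV_coord set0.
Proof. exact: sigma_algebra0. Qed.

Let rV_setC A : g_sigma_preimage rV_coord A -> g_sigma_preimage rV_coord (~` A).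
Proof. exact: sigma_algebraC. Qed.

Let rV_bigcup (F : _^nat) : (forall i, g_sigma_preimage rV_coord (F i)) ->
  g_sigma_preimage rV_coord (\bigcup_i (F i)).
Proof. exact: sigma_algebra_bigcup. Qed.

HB.instance Definition _ := @isMeasurable.Build rV_display
  'rV[R]_n (g_sigma_preimage rV_coord) rV_set0 rV_setC rV_bigcup.

Lemma measurable_rV_coord (i : 'I_n) : measurable_fun setT (rV_coord i).
Proof.
move=> _ Y mY; apply: sub_sigma_algebra; rewrite setTI.
rewrite (bigD1 i)//=; left; exists Y => //; by rewrite setTI.
Qed.

Lemma measurable_fun_rV d (T : measurableType d) (f : T -> 'rV[R]_n) :
  (forall i, measurable_fun setT (fun t => f t 0 i)) -> measurable_fun setT f.
Proof.
move=> mf.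
apply: (@measurability _ _ _ _ setT f
  (\big[setU/set0]_(i < n) preimage_set_system setT (rV_coord i) measurable)) => //.
move=> _ [C GC <-].
have [i [B mB <-]] : exists i, preimage_set_system setT (rV_coord i) measurable C.
  elim/big_ind: _ GC => [[]|P Q hP hQ [/hP//|/hQ//]|i _ hC]; by exists i.
rewrite !setTI -comp_preimage -[X in measurable X]setTI.
exact: mf.
Qed.

End measurable_rV.

(** The library's [SigmaFiniteMeasure] instance for [\x] is shadowed by its
    instance for subprobabilities, so sigma-finiteness is restated here. *)
Lemma sigma_finite_prod d1 d2 (T1 : measurableType d1) (T2 : measurableType d2)
    (R : realType) (m1 : {sigma_finite_measure set T1 -> \bar R})
    (m2 : {sigma_finite_measure set T2 -> \bar R}) :
  sigma_finite setT (m1 \x m2)%E.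
Proof.
have /sigma_finiteP[F [TF ndF Foo]] := sigma_finiteT m1.
have /sigma_finiteP[G [TG ndG Goo]] := sigma_finiteT m2.
exists (fun n => F n `*` G n).
  rewrite -setXTT TF TG predeqE => -[x y]; split.
    move=> [/= [n _ Fnx] [k _ Gky]]; exists (maxn n k) => //; split.
    - by move: x Fnx; exact/subsetPset/ndF/leq_maxl.
    - by move: y Gky; exact/subsetPset/ndG/leq_maxr.
  by move=> [n _ []/= ? ?]; split; exists n.
move=> k; have [? ?] := Foo k; have [? ?] := Goo k.
split; first exact: measurableX.
by rewrite product_measure1E// lte_mul_pinfty// ge0_fin_numE.
Qed.

Section consrV.
Context {R : realType} (n : nat).

Definition consrV (p : R * 'rV[R]_n) : 'rV[R]_n.+1 :=
  \row_i oapp (fun j => p.2 0 j) p.1 (unlift ord0 i).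

Definition unconsrV (v : 'rV[R]_n.+1) : R * 'rV[R]_n :=
  (v 0 ord0, \row_j v 0 (lift ord0 j)).

Lemma consrVK : cancel consrV unconsrV.
Proof.
move=> [a v]; rewrite /unconsrV /consrV mxE unlift_none /=; congr pair.
by apply/rowP => j; rewrite !mxE liftK.
Qed.

Lemma measurable_consrV : measurable_fun setT consrV.
Proof.
apply: measurable_fun_rV => i.
under eq_fun do rewrite mxE.
case: unliftP => [j _|_] /=; last exact: measurable_fst.
exact: (measurableT_comp (measurable_rV_coord j)).
Qed.

Lemma measurable_unconsrV : measurable_fun setT unconsrV.
Proof.
apply/measurable_fun_pairP; split; first exact: measurable_rV_coord.
apply: measurable_fun_rV => j; under eq_fun do rewrite /= mxE.
exact: measurable_rV_coord.
Qed.

Variable mu : {sigma_finite_measure set 'rV[R]_n -> \bar R}.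

Definition leb_cons : set 'rV[R]_n.+1 -> \bar R :=
  pushforward (@lebesgue_measure R \x mu)%E consrV.

Let leb_cons_measure : {measure set 'rV[R]_n.+1 -> \bar R} :=
  measure_function_pushforward__canonical__measure_function_Measure
    (@lebesgue_measure R \x mu)%E measurable_consrV.

HB.instance Definition _ := isMeasure.Build _ _ _ leb_cons
  (measure0 leb_cons_measure) (measure_ge0 leb_cons_measure)
  (@measure_semi_sigma_additive _ _ _ leb_cons_measure).

Let leb_cons_sigma_finite : sigma_finite setT leb_cons.
Proof.
have [F FT mF] : sigma_finite setT (@lebesgue_measure R \x mu)%E.
  exact: sigma_finite_prod.
exists (fun k => unconsrV @^-1` F k).
  by rewrite -preimage_bigcup -FT.
move=> k; split.
  by rewrite -[X in measurable X]setTI; apply: measurable_unconsrV => //; case: (mF k).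
rewrite /leb_cons /pushforward -comp_preimage.
by rewrite (_ : _ \o _ = id) ?preimage_id; [case: (mF k)|apply/funext => p /=; rewrite consrVK].
Qed.

HB.instance Definition _ :=
  Measure_isSigmaFinite.Build _ _ _ leb_cons leb_cons_sigma_finite.

End consrV.

Section lebrV0.
Context {R : realType}.
Definition leb0 : set 'rV[R]_0 -> \bar R := \d_(0 : 'rV[R]_0).
HB.instance Definition _ := Measure.on leb0.
Let leb0_sigma_finite : sigma_finite setT leb0.
Proof.
by exists (fun=> setT); [rewrite bigcup_const|move=> _; rewrite /leb0 diracT ltry].
Qed.
HB.instance Definition _ :=
  Measure_isSigmaFinite.Build _ _ _ leb0 leb0_sigma_finite.
End lebrV0.

Fixpoint leb {R : realType} (n : nat) :
    {sigma_finite_measure set 'rV[R]_n -> \bar R} :=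
  match n with
  | 0 => @leb0 R
  | n'.+1 => @leb_cons R n' (leb n')
  end.

Lemma measurable_box {R : realType} (n : nat) (A : 'I_n -> set R) :
  (forall i, measurable (A i)) ->
  measurable [set v : 'rV[R]_n | forall i, A i (v 0 i)].
Proof.
move=> mA.
rewrite (_ : [set _ | _] = \bigcap_(i in [set: 'I_n]) (rV_coord i @^-1` A i)).
  apply: fin_bigcap_measurable => // i _; rewrite -[X in measurable X]setTI.
  exact: (measurable_rV_coord i measurableT (mA i)).
by apply/seteqP; split => v /= H i; [move=> _|]; exact: H.
Qed.

Lemma leb_box {R : realType} (n : nat) (A : 'I_n -> set R) :
  (forall i, measurable (A i)) ->
  leb n [set v : 'rV[R]_n | forall i, A i (v 0 i)] =
    (\prod_(i < n) (@lebesgue_measure R) (A i))%E.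
Proof.
elim: n => [|n IHn] in A *; move=> mA.
  by rewrite big_ord0 /= /leb0 diracE mem_set// => -[].
rewrite big_ord_recl -(IHn (fun i => A (lift ord0 i)))//.
rewrite -product_measure1E; last 2 first.
- exact: mA.
- exact: (@measurable_box _ _ (fun i => A (lift ord0 i)) (fun i => mA (lift ord0 i))).
rewrite /= /leb_cons /pushforward; congr (product_measure1 _ _ _).
apply/seteqP; split => [[a v] /= H|[a v] [/= H0 H] i].
  split => /=; first by have := H ord0; rewrite mxE unlift_none.
  by move=> i; have := H (lift ord0 i); rewrite mxE liftK.
by rewrite mxE; case: unliftP => [j ->|->] //=.
Qed.

Section leb2.
Context {R : realType} (n : nat).

Definition leb2 : set ('rV[R]_n * 'rV[R]_n) -> \bar R :=
  (@leb R n \x @leb R n)%E.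

HB.instance Definition _ := Measure.on leb2.
HB.instance Definition _ := Measure_isSigmaFinite.Build _ _ _ leb2
  (sigma_finite_prod (@leb R n) (@leb R n)).

End leb2.

(** The norm carried by ['rV[R]_n] in the library is the sup norm (its topology
    is the usual one); [enorm] is the Euclidean norm. *)

Section calculus.
Context {R : realType} {n : nat}.
Implicit Types (x y : 'rV[R]_n) (u : 'rV[R]_n -> R) (G : 'rV[R]_n -> 'rV[R]_n).

Definition dot x y : R := \sum_(i < n) x 0 i * y 0 i.

Definition enorm x : R := Num.sqrt (dot x x).

Definition pd (i : 'I_n) u x : R := 'D_(delta_mx 0 i) u x.

Definition grad u x : 'rV[R]_n := \row_i pd i u x.

Definition dvg G x : R := \sum_(i < n) pd i (fun y => G y 0 i) x.

Definition has_grad u := forall i x, derivable u x (delta_mx 0 i).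

Definition C0 u := continuous u /\
  forall e : R, 0 < e -> exists K : R, forall x, K < enorm x -> `|u x| < e.

Definition C0vec G := continuous G /\
  forall e : R, 0 < e -> exists K : R, forall x, K < enorm x -> enorm (G x) < e.

End calculus.

Fixpoint Ck {R : realType} {V : normedModType R} (k : nat) (g : V -> R) : Prop :=
  match k with
  | 0 => continuous g
  | k'.+1 => continuous g /\
      forall h : V, (forall p, derivable g p h) /\ Ck k' (fun p => 'D_h g p)
  end.

Definition Ccinfty {R : realType} {V : normedModType R} (g : V -> R) : Prop :=
  (forall k, Ck k g) /\ exists2 K : set V, compact K & forall p, ~ K p -> g p = 0.

Section spaces.
Context {R : realType} {n : nat}.
Implicit Types (u : 'rV[R]_n -> R) (G : 'rV[R]_n -> 'rV[R]_n) (T : R).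
Local Notation mu := (@lebesgue_measure R).

Definition L1norm T (g : R -> \bar R) : \bar R := (\int[mu]_(t in `]0%R, T[) g t)%E.

Definition L2norm T (g : R -> \bar R) : \bar R :=
  ((\int[mu]_(t in `]0%R, T[) (g t ^+ 2)) `^ 2^-1)%E.

Definition Linfty_norm u : \bar R := 'N[@leb R n]_+oo [EFin \o u]%E.

Definition Linfty_vec_norm G : \bar R := Linfty_norm (fun x => enorm (G x)).

Definition C0_norm G : \bar R := ereal_sup [set (enorm (G x))%:E | x in [set: 'rV[R]_n]].

(** W^{1,oo}(R^n), each class being represented by its continuous
    representative: a bounded Lipschitz function.  Such a function is
    differentiable almost everywhere and [grad] is its weak gradient. *)
Definition W1infty u := exists K : R,
  (forall x, `|u x| <= K) /\ (forall x y, `|u x - u y| <= K * enorm (x - y)).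

Definition W1infty_norm u : \bar R := (Linfty_norm u + Linfty_vec_norm (grad u))%E.

(** Strong (Bochner) measurability of [psi : ]0,T[ -> W^{1,oo}]: a.e. limit, in
    the W^{1,oo} norm, of simple functions. *)
Definition W1infty_measurable T (psi : R -> 'rV[R]_n -> R) :=
  exists (m : nat -> nat) (A : nat -> nat -> set R) (g : nat -> nat -> 'rV[R]_n -> R),
    [/\ forall k l, measurable (A k l),
        forall k l, W1infty (g k l) &
        {ae mu, forall t, t \in `]0, T[ ->
          (fun k => W1infty_norm
             (fun x => psi t x - \sum_(l < m k) \1_(A k l) t * g k l x))
          @ \oo --> 0%E}].

Definition L2_W1infty T (psi : R -> 'rV[R]_n -> R) :=
  [/\ W1infty_measurable T psi,
      {ae mu, forall t, t \in `]0, T[ -> W1infty (psi t)} &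
      (L2norm T (fun t => W1infty_norm (psi t)) < +oo)%E].

(** For [psi t] in W^{1,oo}, a weak gradient in C_0 means that the continuous
    representative is everywhere differentiable, with gradient in C_0. *)
Definition grad_C0 T (psi : R -> 'rV[R]_n -> R) :=
  {ae mu, forall t, t \in `]0, T[ -> has_grad (psi t) /\ C0vec (grad (psi t))}.

(** Weak-* convergence in M(R^n) = C_0(R^n)^* of the measures [r eps dx] to the
    finite signed measure [nu], as eps -> 0+.  The integral against [nu] is
    taken along a Hahn-Jordan decomposition (whose choice is immaterial). *)
Definition weak_star_cvg (r : R -> 'rV[R]_n -> R)
    (nu : {charge set 'rV[R]_n -> \bar R}) :=
  forall (P N : set 'rV[R]_n) (PN : hahn_decomposition nu P N) theta, C0 theta ->
    (fun eps : R => (\int[@leb R n]_x (theta x * r eps x)%:E)%E) @ 0^'+ -->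
    (\int[jordan_pos PN]_x (theta x)%:E - \int[jordan_neg PN]_x (theta x)%:E)%E.

End spaces.

Section kinetic.
Context {R : realType} {N : nat}.
Local Notation V := 'rV[R]_N.
Local Notation mu := (@lebesgue_measure R).

Definition c_ (lambda : R) : R := 2 `^ lambda^-1 - 1.

Definition phi_ (lambda eps r : R) : R :=
  (eps ^+ 2 + c_ lambda * r ^+ 2) `^ (- lambda).

Definition convol (phi : R -> R) (g : V -> R) (x : V) : R :=
  (\int[@leb R N]_y (phi (enorm (x - y)) * g y))%R.

Definition convolv (phi : R -> R) (G : V -> V) (x : V) : V :=
  \row_i convol phi (fun y => G y 0 i) x.

Definition rho (g : V -> V -> R) (x : V) : R := (\int[@leb R N]_v g x v)%R.

Definition cur (g : V -> V -> R) (x : V) : V :=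
  \row_i (\int[@leb R N]_v (v 0 i * g x v))%R.

Definition kinetic_eq (lambda eps : R) (psi : R -> V -> R) (f : R -> V -> V -> R)
    (t : R) (x v : V) : Prop :=
  eps * derive1 (fun s => f s x v) t
  + eps * dot v (grad (fun y => f t y v) x)
  - dot (grad (psi t) x) (grad (f t x) v)
  = dvg (fun w => f t x w *: w + grad (f t x) w
                  + (f t x w * convol (phi_ lambda eps) (rho (f t)) x) *: w
                  - f t x w *: convolv (phi_ lambda eps) (cur (f t)) x) v.

Definition C1x_C2v (g : V -> V -> R) :=
  continuous (fun p : V * V => g p.1 p.2) /\
  forall i : 'I_N,
    [/\ forall v, has_grad (g^~ v),
        continuous (fun p : V * V => pd i (g^~ p.2) p.1),
        forall x, has_grad (g x),
        continuous (fun p : V * V => pd i (g p.1) p.2) &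
        forall j : 'I_N, (forall x, has_grad (pd i (g x))) /\
          continuous (fun p : V * V => pd j (pd i (g p.1)) p.2)].

(** Integrability in (x,v) against (1 + |v|)^3, square integrable in time.  The
    order 3 is the one met when the energy |v|^2 is transported by v. *)
Definition decaying (T : R) (g : R -> V -> V -> R) :=
  measurable_fun (`]0, T[ `*` setT)
    (fun p : measurableTypeR R * (V * V) => g p.1 p.2.1 p.2.2) /\
  (L2norm T (fun t => \int[@leb2 R N]_p ((1 + enorm p.2) ^+ 3 * `|g t p.1 p.2|)%:E)
     < +oo)%E.

(** Strong solution on [0,T[.  Since [grad psi] is only square integrable in
    time, a time derivative of [f] can only be expected at almost every time:
    [f] is absolutely continuous in time, which [sol_time] writes out as the
    fundamental theorem of calculus, and the equation holds for a.e. (t,x,v). *)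
Record strong_solution (T lambda eps : R) (psi : R -> V -> R)
    (f0 : V -> V -> R) (f : R -> V -> V -> R) : Prop := StrongSolution {
  sol_ge0 : forall t x v, t \in `[0, T[ -> 0 <= f t x v;
  sol_init : forall x v, f 0 x v = f0 x v;
  sol_space : forall t, t \in `]0, T[ -> C1x_C2v (f t);
  sol_time : forall x v t, t \in `[0, T[ ->
    [/\ {ae mu, forall s, s \in `]0, t[ -> derivable (fun r => f r x v) s 1},
        mu.-integrable `[0, t] (fun s => (derive1 (fun r => f r x v) s)%:E) &
        f t x v = f 0 x v + (\int[mu]_(s in `[0%R, t]) derive1 (fun r => f r x v) s)%R];
  sol_eq : {ae (mu \x @leb2 R N)%E, forall p : measurableTypeR R * (V * V),
    p.1 \in `]0, T[ -> kinetic_eq lambda eps psi f p.1 p.2.1 p.2.2};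
  sol_decay : decaying T f;
  sol_decay_x : forall i, decaying T (fun t x v => pd i (fun y => f t y v) x);
  sol_decay_v : forall i, decaying T (fun t x v => pd i (f t x) v);
  sol_decay_vv : forall i, decaying T (fun t x v => pd i (pd i (f t x)) v)
}.

Definition H1 (M0 E0 : R) (f0 : R -> V -> V -> R)
    (rho0 : {charge set V -> \bar R}) : Prop :=
  (forall eps : R, 0 < eps ->
    [/\ forall x v, 0 <= f0 eps x v,
        Ccinfty (fun p : V * V => f0 eps p.1 p.2),
        (\int[@leb2 R N]_p `|f0 eps p.1 p.2|%:E <= M0%:E)%E &
        (\int[@leb2 R N]_p `|enorm p.2 ^+ 2 * f0 eps p.1 p.2|%:E <= E0%:E)%E]) /\
  weak_star_cvg (fun eps => rho (f0 eps)) rho0.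

Definition H2 (T F0 : R) (psi_ : R -> R -> V -> R) (psi : R -> V -> R) : Prop :=
  [/\ forall eps : R, 0 < eps ->
        [/\ L2_W1infty T (psi_ eps), grad_C0 T (psi_ eps) &
            (L2norm T (fun t => Linfty_vec_norm (grad (psi_ eps t))) <= F0%:E)%E],
      L2_W1infty T psi, grad_C0 T psi &
      (fun eps => L1norm T (fun t =>
         C0_norm (fun x => grad (psi_ eps t) x - grad (psi t) x)))
      @ 0^'+ --> 0%E].

Definition Omega (r : R) : set (V * V) := [set p | enorm (p.1 - p.2) < r].

Definition commutator (g : V -> V -> R) (r : R) : \bar R :=
  (\int[@leb2 R N]_(p in Omega r)
     (enorm (rho g p.1 *: cur g p.2 - rho g p.2 *: cur g p.1))%:E)%E.

End kinetic.

(* Main.v *)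
Require Import Defs.
From HB Require Import structures.
From mathcomp Require Import all_boot all_order all_algebra.
From mathcomp Require Import all_classical all_reals all_analysis.
From mathcomp Require Import measurable_realfun ess_sup_inf ring lra.
Import Order.TTheory GRing.Theory Num.Theory.
Import numFieldNormedType.Exports.

Local Open Scope classical_set_scope.
Local Open Scope ring_scope.

Set Implicit Arguments.
Unset Strict Implicit.
Unset Printing Implicit Defensive.

(** The equation holds only for almost every (t,x,v), and its time derivative, though integrable in
    t for fixed (x,v), is given with neither joint measurability nor integrability in (x,v).
    Exchanging time and phase-space integrals is therefore the main obstacle. The derivative is
    replaced by a jointly measurable version, and its integrability against 1 and |v|^2 is read off
    the other terms of the equation. These are quadratic in [f], since the convolved moments
    multiply [f]; hence decay hypotheses that are square integrable in time. The norm of the force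
    is not shown to be measurable in time either, so its integral is treated as a lower integral. No
    energy bound at positive times is required: friction removes 2 |v|^2 f, Young's inequality
    spends half of it on the work of the force, and what remains has a favourable sign. In the final
    limits, the bound on the dissipation along a subsequence depends on t alone and is fixed before
    r, so r can be made small first and eps_k afterwards. *)

(** Testing the kinetic equation against 1 and |v|^2 gives conservation of mass and
    an energy balance with the nonnegative dissipation
      D_eps(t) = iint phi_eps(|x-y|) iint |v-w|^2 f(t,x,v) f(t,y,w) dv dw dx dy,
    whose integral over ]0, T[ is bounded uniformly in eps by Young's inequality for
    the work of the force.  Along eps_k = 1/(k+1), Fatou's lemma makes
    liminf_k D_{eps_k}(t) finite for a.e. t.  On the other hand, for eps <= r the
    kernel satisfies 1 <= ((1+c_lambda) r^2)^lambda phi_eps on [0, r], so that the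
    Cauchy-Schwarz inequality bounds the mass of the commutator on Omega_r by
      (delta M0^2 + ((1+c_lambda) r^2)^lambda D_eps(t) / delta) / 2   for all delta > 0,
    and the second term vanishes as r -> 0 along the eps_k with D_{eps_k}(t) bounded. *)

Local Notation L1 mu f := (mu.-integrable setT (EFin \o f)).

(** * Fubini's theorem for real-valued integrals *)

Section L1_lemmas.
Context d (T : measurableType d) (R : realType) (mu : {measure set T -> \bar R}).
Implicit Types f g : T -> R.

Lemma L1_measurable f : L1 mu f -> measurable_fun setT f.
Proof. by move=> /integrableP[/measurable_EFinP]. Qed.

Lemma le_L1 f g : measurable_fun setT g -> (forall x, `|g x| <= f x) ->
  L1 mu f -> L1 mu g.
Proof.
move=> mg gf; apply: le_integrable => //; first exact/measurable_EFinP.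
by move=> x _ /=; rewrite lee_fin (le_trans (gf x))// ler_norm.
Qed.

Lemma L1D f g : L1 mu f -> L1 mu g -> L1 mu (fun x => f x + g x).
Proof. by move=> hf hg; apply: (integrableD measurableT hf hg). Qed.

Lemma L1N f : L1 mu f -> L1 mu (fun x => - f x).
Proof. by move=> hf; apply: (integrableN hf). Qed.

Lemma L1B f g : L1 mu f -> L1 mu g -> L1 mu (fun x => f x - g x).
Proof. by move=> hf hg; apply: L1D => //; exact: L1N. Qed.

Lemma L1Z (k : R) f : L1 mu f -> L1 mu (fun x => k * f x).
Proof. by move=> hf; apply: (integrableZl measurableT _ hf). Qed.

Lemma L1_0 : L1 mu (fun=> 0).
Proof. exact: integrable0. Qed.

Lemma L1_sum I (s : seq I) (h : I -> T -> R) :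
  (forall i, L1 mu (h i)) -> L1 mu (fun x => \sum_(i <- s) h i x).
Proof.
move=> hh; elim: s => [|i s IHs].
  by under eq_fun do rewrite big_nil; exact: L1_0.
by under eq_fun do rewrite big_cons; exact: L1D.
Qed.

Lemma Rint_sum I (s : seq I) (h : I -> T -> R) : (forall i, L1 mu (h i)) ->
  \int[mu]_x (\sum_(i <- s) h i x) = \sum_(i <- s) \int[mu]_x h i x.
Proof.
move=> hh; elim: s => [|i s IHs].
  rewrite big_nil; transitivity (\int[mu]_x (cst 0 x : R)).
    by apply: eq_Rintegral => x _; rewrite big_nil.
  by rewrite Rintegral_cst// mul0r.
rewrite big_cons -IHs -RintegralD//; last exact: (L1_sum s).
by apply: eq_Rintegral => x _; rewrite big_cons.
Qed.

Lemma EFin_Rint f : L1 mu f -> (\int[mu]_x f x)%:E = (\int[mu]_x (f x)%:E)%E.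
Proof. by move=> hf; rewrite fineK//; exact: integrable_fin_num. Qed.

Lemma L1_abs_lty f : measurable_fun setT f ->
  (\int[mu]_x `|f x|%:E < +oo)%E -> L1 mu f.
Proof. by move=> mf h; apply/integrableP; split => //; exact/measurable_EFinP. Qed.

Lemma ae_eq_Rintegral f g : measurable_fun setT f -> measurable_fun setT g ->
  {ae mu, forall x, f x = g x} -> \int[mu]_x f x = \int[mu]_x g x.
Proof.
move=> mf mg fg; congr fine; apply: ae_eq_integral => //; try exact/measurable_EFinP.
by apply: filterS fg => x /= -> _.
Qed.

Lemma ae_eq_L1 f g : measurable_fun setT g ->
  {ae mu, forall x, f x = g x} -> L1 mu f -> L1 mu g.
Proof.
move=> mg fg hf; have mf := L1_measurable hf.
apply: L1_abs_lty => //.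
rewrite (_ : (\int[mu]_x _ = \int[mu]_x `|f x|%:E)%E).
  by case/integrableP : hf.
apply: ae_eq_integral => //; try (by apply/measurable_EFinP; exact: measurableT_comp).
by apply: filterS fg => x /= -> _.
Qed.

End L1_lemmas.

Section Rfubini.
Context d1 d2 (T1 : measurableType d1) (T2 : measurableType d2) (R : realType).
Variable m1 : {sigma_finite_measure set T1 -> \bar R}.
Variable m2 : {sigma_finite_measure set T2 -> \bar R}.
Implicit Type f : T1 * T2 -> R.
Local Notation m12 := (m1 \x m2)%E.

(** Tonelli's theorem gives measurability for nonnegative integrands, so [f] is split into its
    positive and negative parts. *)
Lemma measurable_eint2 (f : T1 * T2 -> \bar R) : measurable_fun setT f ->
  measurable_fun setT (fun x => \int[m2]_y f (x, y))%E.
Proof.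
move=> mf.
rewrite (_ : (fun x => _) = ((fun x => \int[m2]_y f^\+ (x, y)) \-
   (fun x => \int[m2]_y f^\- (x, y)))%E); last first.
  apply/funext => x; rewrite [LHS]integralE.
  under eq_integral do rewrite funepos_comp/=.
  by under [X in (_ - X)%E = _]eq_integral do rewrite funeneg_comp/=.
apply: emeasurable_funB; apply: measurable_fun_fubini_tonelli_F => //.
  exact: measurable_funepos.
exact: measurable_funeneg.
Qed.

Lemma measurable_Rint2 f : measurable_fun setT f ->
  measurable_fun setT (fun x => \int[m2]_y f (x, y)).
Proof.
move=> mf; apply: measurableT_comp; first exact: fine_measurable.
by apply: (measurable_eint2 (f := EFin \o f)); exact/measurable_EFinP.
Qed.

Hypothesis (f : T1 * T2 -> R) (If : L1 m12 f).

Lemma ae_L1_1 : {ae m1, forall x, L1 m2 (fun y => f (x, y))}.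
Proof. exact: (@ae_integrable1 _ _ _ _ _ _ _ _ If). Qed.

Lemma ae_L1_2 : {ae m2, forall y, L1 m1 (fun x => f (x, y))}.
Proof. exact: (@ae_integrable2 _ _ _ _ _ _ _ _ If). Qed.

(** Where a section is not integrable, [fine] turns an infinite integral into 0; such points form a
    null set. *)
Let aeF : {ae m1, forall x, (\int[m2]_y f (x, y))%:E = fubini_F m2 (EFin \o f) x}.
Proof. by apply: filterS ae_L1_1 => x /= h; rewrite EFin_Rint. Qed.

Let mF : measurable_fun setT (fun x => (\int[m2]_y f (x, y))%:E).
Proof.
by apply/measurable_EFinP; apply: measurable_Rint2; exact: L1_measurable If.
Qed.

Lemma L1_Rint2 : L1 m1 (fun x => \int[m2]_y f (x, y)).
Proof.
have /integrableP[mF' ltyF'] := integrable_fubini_F If.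
apply: L1_abs_lty; first exact/measurable_EFinP.
rewrite (_ : (\int[m1]_x _ = \int[m1]_x `|fubini_F m2 (EFin \o f) x|)%E) //.
apply: ae_eq_integral => //; [|exact: measurableT_comp|].
  by apply/measurable_EFinP/measurableT_comp => //; exact/measurable_EFinP.
by apply: filterS aeF => x /= <- _.
Qed.

Lemma Rint12 : \int[m12]_z f z = \int[m1]_x \int[m2]_y f (x, y).
Proof.
rewrite /Rintegral; congr fine.
rewrite -(integral12_prod_meas1 If); apply/esym/ae_eq_integral => //.
  exact: measurable_fubini_F If.
by apply: filterS aeF => x /= <- _.
Qed.

End Rfubini.

Section Rfubini_swap.
Context d1 d2 (T1 : measurableType d1) (T2 : measurableType d2) (R : realType).
Variable m1 : {sigma_finite_measure set T1 -> \bar R}.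
Variable m2 : {sigma_finite_measure set T2 -> \bar R}.

Lemma L1_swap (f : T1 * T2 -> R) : L1 (m1 \x m2)%E f ->
  L1 (m2 \x m1)%E (fun z => f (z.2, z.1)).
Proof.
move=> If; have mf := L1_measurable If.
have mfs : measurable_fun setT (fun z : T2 * T1 => f (z.2, z.1)).
  by apply: measurableT_comp => //; apply: measurable_fun_pair;
    [exact: measurable_snd|exact: measurable_fst].
apply/integrable12ltyP; first exact/measurable_EFinP.
by apply/(@integrable21ltyP _ _ _ _ _ m1 m2 (EFin \o f)) => //; exact/measurable_EFinP.
Qed.

Lemma Rint21 (f : T1 * T2 -> R) : L1 (m1 \x m2)%E f ->
  \int[(m1 \x m2)%E]_z f z = \int[m2]_y \int[m1]_x f (x, y).
Proof.
move=> If; rewrite -(Rint12 (L1_swap If)); congr fine.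
by rewrite -(integral21_prod_meas1 If) -(integral12_prod_meas1 (L1_swap If)).
Qed.

Lemma Rint_swap (f : T1 * T2 -> R) : L1 (m1 \x m2)%E f ->
  \int[(m1 \x m2)%E]_z f z = \int[(m2 \x m1)%E]_z f (z.2, z.1).
Proof. by move=> If; rewrite (Rint21 If) (Rint12 (L1_swap If)). Qed.

Lemma measurable_Rint1 (f : T1 * T2 -> R) : measurable_fun setT f ->
  measurable_fun setT (fun y => \int[m1]_x f (x, y)).
Proof.
move=> mf; apply: (@measurable_Rint2 _ _ _ _ _ m1 (fun z => f (z.2, z.1))).
by apply: measurableT_comp => //; apply: measurable_fun_pair;
  [exact: measurable_snd|exact: measurable_fst].
Qed.

Lemma L1_Rint1 (f : T1 * T2 -> R) : L1 (m1 \x m2)%E f ->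
  L1 m2 (fun y => \int[m1]_x f (x, y)).
Proof. by move=> If; exact: L1_Rint2 (L1_swap If). Qed.

End Rfubini_swap.

(** * Integrals of derivatives over the whole space *)

Section integration_by_parts_whole_space.
Context {R : realType}.
Local Notation mu := (@lebesgue_measure R).

(** By monotone convergence the integrals of [|f|] over the sets [F n] exhaust the full integral,
    and the complements carry the difference. *)
Lemma L1_tail d (T : measurableType d) (m : {measure set T -> \bar R})
    (f : T -> R) (F : (set T)^nat) (e : R) :
  L1 m f -> nondecreasing_seq F -> (forall i, measurable (F i)) ->
  \bigcup_i F i = setT -> 0 < e ->
  exists n, \int[m]_(x in ~` F n) `|f x| < e.
Proof.
move=> If ndF mF FT e0.
have If' : L1 m (fun x => `|f x|) by exact: integrable_norm.
have split n : \int[m]_x `|f x| =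
    \int[m]_(x in F n) `|f x| + \int[m]_(x in ~` F n) `|f x|.
  rewrite -Rintegral_setU ?setUv//; first exact: measurableC.
  by rewrite disj_set2E setICr.
have : (\int[m]_(x in F i) (`|f x|)%:E)%E @[i --> \oo] -->
    (\int[m]_(x in \bigcup_i F i) (`|f x|)%:E)%E.
  apply: ge0_nondecreasing_set_cvg_integral => //= n.
  by apply/measurable_funTS; case/integrableP : If'.
rewrite FT -EFin_Rint// => /fine_cvgP[_ /cvgrPdist_lt /(_ _ e0)][n _ /(_ n (leqnn n))] h.
exists n; move: h; rewrite /= (split n) addrAC subrr add0r ger0_norm//.
exact: Rintegral_ge0.
Qed.

(** Otherwise [|f|] would stay above [e] on a set of infinite measure and could not be
    integrable. *)
Lemma L1_small d (T : measurableType d) (m : {measure set T -> \bar R})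
    (f : T -> R) (D : set T) (e : R) :
  L1 m f -> measurable D -> m D = +oo%E -> 0 < e ->
  exists2 x, D x & `|f x| < e.
Proof.
move=> If mD mDoo e0; apply: contrapT => h.
have ef x : D x -> e <= `|f x|.
  by move=> Dx; rewrite leNgt; apply/negP => fe; apply: h; exists x.
have /integrableP[mf] := If; apply/negP; rewrite -leNgt.
apply: (@le_trans _ _ (\int[m]_(x in D) e%:E)%E).
  by rewrite integral_cst//= mDoo gt0_muley ?lte_fin.
apply: (@le_trans _ _ (\int[m]_(x in D) `|(f x)%:E|)%E).
  apply: ge0_le_integral => //.
  - by move=> x _; rewrite lee_fin ltW.
  - by apply: measurableT_comp => //; exact: measurable_funTS.
apply: ge0_subset_integral => //; exact: measurableT_comp.
Qed.

(* [u] need not vanish at infinity, but being integrable it is small somewhere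
   beyond any point, on both sides; no decay hypothesis is needed. *)
Lemma Rint_derive1_eq0 (u : R -> R) :
  (forall x, derivable u x 1) -> continuous (derive1 u) ->
  L1 mu u -> L1 mu (derive1 u) -> \int[mu]_x derive1 u x = 0.
Proof.
move=> du cdu Iu Idu; apply/eqP; apply: contrapT => /negP; rewrite -normr_gt0.
set I := \int[mu]_x derive1 u x => I0.
(* I is u b - u a plus the integral outside [a, b]. Each of these three numbers will be below |I|/4
   in absolute value, which gives |I| < 3|I|/4, a contradiction. *)
have e0 : 0 < `|I| / 4 by rewrite divr_gt0.
have cu : continuous u by move=> x; apply/differentiable_continuous/derivable1_diffP.
pose F (n : nat) : set R := `[- n%:R, n%:R]%classic.
have [n tail] : exists n, \int[mu]_(x in ~` F n) `|derive1 u x| < `|I| / 4.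
  apply: L1_tail => //.
  - move=> k l kl; apply/subsetPset => x; rewrite /F /= !in_itv/= => /andP[h1 h2].
    have kl' : k%:R <= l%:R :> R by rewrite ler_nat.
    by apply/andP; split; lra.
  - by move=> i; exact: measurable_itv.
  - apply/seteqP; split => // x _; exists (Num.truncn `|x|).+1 => //.
    rewrite /F /= in_itv/= -ler_norml; apply/ltW.
    by have /truncn_itv/andP[] : 0 <= `|x| by [].
have [b] : exists2 x : R, [set` `[n%:R, +oo[] x & `|u x| < `|I| / 4.
  apply: (L1_small (m := mu) Iu) => //.
  by apply: (etrans (lebesgue_measure_itv `[n%:R, +oo[)); rewrite /= ltry.
rewrite /= in_itv/= andbT => nb ub.
(* Taking [- n.+1] instead of [- n] forces a < b even when n = 0. *)
have [a] : exists2 x : R, [set` `]-oo, - n.+1%:R]] x & `|u x| < `|I| / 4.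
  apply: (L1_small (m := mu) Iu) => //.
  by apply: (etrans (lebesgue_measure_itv `]-oo, - n.+1%:R])); rewrite /= ltNyr.
rewrite /= in_itv/= => an ua.
have n0 : 0 <= n%:R :> R by [].
have ab : a < b by rewrite -natr1 in an; lra.
have : (\int[mu]_(x in `[a, b]) (derive1 u x)%:E = (u b)%:E - (u a)%:E)%E.
  apply: (continuous_FTC2 ab).
  - exact: continuous_subspaceT.
  - split; first (by move=> x _; exact: du);
      [exact/cvg_at_right_filter/cu|exact/cvg_at_left_filter/cu].
  - by move=> x _.
move=> /(congr1 fine) /= ftc.
have split : I = \int[mu]_(x in `[a, b]) derive1 u x +
                 \int[mu]_(x in ~` `[a, b]) derive1 u x.
  rewrite -Rintegral_setU ?setUv//; first exact: measurableC.
  by rewrite disj_set2E setICr.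
have : `|\int[mu]_(x in ~` `[a, b]) derive1 u x| < `|I| / 4.
  apply: le_lt_trans tail; apply: (le_trans (le_normr_Rintegral _ _)).
  - exact: measurableC.
  - by apply: integrableS Idu => //; exact: measurableC.
  have mF : measurable (~` F n) by apply: measurableC; exact: measurable_itv.
  have mab : measurable (~` [set` `[a, b]]) by apply: measurableC; exact: measurable_itv.
  have Idu' : L1 mu (fun x => `|derive1 u x|) by exact: integrable_norm.
  apply: fine_le.
  - by apply: integrable_fin_num => //; apply: integrableS Idu'.
  - by apply: integrable_fin_num => //; apply: integrableS Idu'.
  apply: ge0_subset_integral => //.
  - by apply: measurable_funTS; exact: measurable_int Idu'.
  - apply: subsetC => x; rewrite /F /= !in_itv/= => /andP[h1 h2].
    by rewrite -natr1 in an; apply/andP; split; lra.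
move: ub ua; rewrite /Rintegral in split *; rewrite ftc in split.
set J := fine _ in split *; rewrite split => ub ua hJ.
have := ler_normD (u b - u a) J; have := ler_normB (u b) (u a).
have := normr_ge0 (u b - u a + J); lra.
Qed.

End integration_by_parts_whole_space.

Section derive_along_affine.
Context {R : realType} {U V W : normedModType R}.
Variables (phi : U -> V) (x v : U) (y : V).
Hypothesis phiE : forall h : R, phi (h *: v + x) = h *: y + phi x.

(** Along the direction [v] the map [phi] is affine with slope [y], so both difference quotients are
    the same function of [h]. *)
Lemma derivable_affine (u : V -> W) : derivable (u \o phi) x v = derivable u (phi x) y.
Proof.
rewrite /derivable (_ : (fun h : R => _) =
  (fun h : R => h^-1 *: ((u \o shift (phi x)) (h *: y) - u (phi x))))//.
by apply/funext => h /=; rewrite phiE.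
Qed.

Lemma derive_affine (u : V -> W) : 'D_v (u \o phi) x = 'D_y u (phi x).
Proof.
rewrite /derive (_ : (fun h : R => _) =
  (fun h : R => h^-1 *: ((u \o shift (phi x)) (h *: y) - u (phi x))))//.
by apply/funext => h /=; rewrite phiE.
Qed.

End derive_along_affine.

Section integration_by_parts_rV.
Context {R : realType}.
Local Notation mu := (@lebesgue_measure R).

Lemma consrV_delta0 n (a h : R) (w : 'rV[R]_n) :
  consrV (h *: 1 + a, w) = h *: delta_mx 0 ord0 + consrV (a, w).
Proof.
apply/rowP => k; rewrite !mxE; case: unliftP => [j ->|->] /=.
  by rewrite mulr0 add0r.
by [].
Qed.

Lemma consrV_deltaS n (a h : R) (w : 'rV[R]_n) (i : 'I_n) :
  consrV (a, h *: delta_mx 0 i + w) = h *: delta_mx 0 (lift ord0 i) + consrV (a, w).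
Proof.
apply/rowP => k; rewrite !mxE; case: unliftP => [j ->|->] /=.
  by rewrite !mxE (inj_eq (@lift_inj _ ord0)).
by rewrite mulr0 add0r.
Qed.

Lemma L1_leb_cons n (g : 'rV[R]_n.+1 -> R) : L1 (@leb R n.+1) g ->
  L1 (mu \x @leb R n)%E (g \o @consrV R n).
Proof.
move=> Ig; have mg := L1_measurable Ig.
apply: L1_abs_lty; first by apply: (measurableT_comp mg); exact: measurable_consrV.
have /integrableP[_] := Ig; rewrite /= /leb_cons.
rewrite ge0_integral_pushforward//; first exact: measurable_consrV.
by apply/measurable_EFinP/measurableT_comp.
Qed.

Lemma Rint_leb_cons n (g : 'rV[R]_n.+1 -> R) : L1 (@leb R n.+1) g ->
  \int[@leb R n.+1]_z g z = \int[(mu \x @leb R n)%E]_z g (consrV z).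
Proof.
move=> Ig; have mg := L1_measurable Ig.
rewrite /Rintegral /= /leb_cons integral_pushforward//.
- exact: measurable_consrV.
- exact/measurable_EFinP.
- exact: L1_leb_cons Ig.
Qed.

(** Induction on the dimension, peeling off the first coordinate. If [i] is that coordinate, it is
    integrated first, by the one-dimensional lemma; otherwise it is frozen and the induction
    hypothesis applies. Continuity is asked only along lines parallel to the i-th axis, a condition
    inherited by slices. Slices are integrable only almost everywhere, which suffices under the
    outer integral. *)
Lemma Rint_pd_eq0 n (i : 'I_n) (u : 'rV[R]_n -> R) :
  (forall x, derivable u x (delta_mx 0 i)) ->
  (forall x, continuous (fun s : R => pd i u (s *: delta_mx 0 i + x))) ->
  L1 (@leb R n) u -> L1 (@leb R n) (pd i u) -> \int[@leb R n]_x pd i u x = 0.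
Proof.
elim: n => [|n IHn] in i u *; first by case: i.
move=> du cdu Iu Idu; rewrite Rint_leb_cons//.
have Iu' := L1_leb_cons Iu; have Idu' := L1_leb_cons Idu.
case: (unliftP ord0 i) => [j|] ij.
- rewrite (Rint12 Idu') /Rintegral -[RHS](_ : fine 0%E = 0)//; congr fine.
  transitivity (\int[mu]_x (cst 0 x : \bar R))%E; last exact: integral0.
  apply: ae_eq_integral => //.
    by apply/measurable_EFinP; apply: measurable_Rint2; exact: L1_measurable Idu'.
  apply: filterS2 (ae_L1_1 Iu') (ae_L1_1 Idu') => a I1 I2 _ /=; congr EFin.
  have e : forall w, pd j (fun w => u (consrV (a, w))) w = pd i u (consrV (a, w)).
    move=> w; rewrite /pd ij.
    exact: (derive_affine (phi := fun w => consrV (a, w)) (fun h => consrV_deltaS a h w j)).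
  rewrite -(IHn j (fun w => u (consrV (a, w)))).
  + by apply: eq_Rintegral => w _; rewrite e.
  + move=> w; have := du (consrV (a, w)); rewrite ij.
    by rewrite -(derivable_affine (phi := fun w => consrV (a, w)) (fun h => consrV_deltaS a h w j)).
  + move=> w; rewrite (_ : (fun s : R => _) =
      (fun s => pd i u (s *: delta_mx 0 i + consrV (a, w)))); first exact: cdu.
    by apply/funext => s; rewrite e consrV_deltaS ij.
  + exact: I1.
  + by apply: eq_integrable I2 => // w _ /=; rewrite e.
- rewrite (Rint21 Idu') /Rintegral -[RHS](_ : fine 0%E = 0)//; congr fine.
  transitivity (\int[@leb R n]_x (cst 0 x : \bar R))%E; last exact: integral0.
  apply: ae_eq_integral => //.
    by apply/measurable_EFinP; apply: measurable_Rint1; exact: L1_measurable Idu'.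
  apply: filterS2 (ae_L1_2 Iu') (ae_L1_2 Idu') => w I1 I2 _ /=; congr EFin.
  have e : forall a, derive1 (fun a => u (consrV (a, w))) a = pd i u (consrV (a, w)).
    move=> a; rewrite derive1E /pd ij.
    exact: (derive_affine (phi := fun a => consrV (a, w)) (fun h => consrV_delta0 a h w)).
  rewrite -[RHS](@Rint_derive1_eq0 _ (fun a => u (consrV (a, w)))).
  + by apply: eq_Rintegral => a _; rewrite e.
  + move=> a; have := du (consrV (a, w)); rewrite ij.
    by rewrite -(derivable_affine (phi := fun a => consrV (a, w)) (fun h => consrV_delta0 a h w)).
  + rewrite (_ : derive1 _ =
      (fun s => pd i u (s *: delta_mx 0 i + consrV (0, w)))); first exact: cdu.
    by apply/funext => s; rewrite e ij -consrV_delta0 addr0 scaler1.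
  + exact: I1.
  + by apply: eq_integrable I2 => // a _ /=; rewrite e.
Qed.

End integration_by_parts_rV.

(** * Phase space and the fluxes of the equation *)

Section lines.
Context {R : realType} {n : nat}.
Local Notation V := 'rV[R]_n.
Local Notation e_ i := (delta_mx 0 i : V).
Implicit Types (u du : V -> R) (i j : 'I_n).

(** The continuity that the fundamental theorem of calculus uses on each line. A partial derivative
    in the same direction already provides it, so joint continuity is called upon only for the
    highest derivative. *)
Definition line_continuous i u := forall v : V, continuous (fun s : R => u (s *: e_ i + v)).

Lemma is_derive_line i u (d : R) (v : V) (s : R) :
  is_derive (s *: e_ i + v) (e_ i) u d -> is_derive s 1 (fun h : R => u (h *: e_ i + v)) d.
Proof.
move=> [du <-].
have phiE (h : R) : (h *: (1 : R) + s) *: e_ i + v = h *: e_ i + (s *: e_ i + v).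
  by rewrite scalerDl addrA [h *: _]mulr1.
apply: DeriveDef.
  by rewrite (derivable_affine (phi := fun h : R => h *: e_ i + v) phiE u).
by rewrite (derive_affine (phi := fun h : R => h *: e_ i + v) phiE u).
Qed.

Lemma derive_line_continuous i u du :
  (forall v, is_derive v (e_ i) u (du v)) -> line_continuous i u.
Proof.
move=> hu v s; apply/differentiable_continuous/derivable1_diffP.
by have [] := is_derive_line (hu (s *: e_ i + v)).
Qed.

Lemma line_continuousD i u1 u2 : line_continuous i u1 -> line_continuous i u2 ->
  line_continuous i (fun v => u1 v + u2 v).
Proof. by move=> h1 h2 v s; apply: cvgD; [exact: h1|exact: h2]. Qed.

Lemma line_continuousM i u1 u2 : line_continuous i u1 -> line_continuous i u2 ->
  line_continuous i (fun v => u1 v * u2 v).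
Proof. by move=> h1 h2 v s; apply: cvgM; [exact: h1|exact: h2]. Qed.

Lemma line_continuous_cst i (c : R) : line_continuous i (fun=> c).
Proof. by move=> v s; exact: cvg_cst. Qed.

Lemma line_continuous_continuous i u : continuous u -> line_continuous i u.
Proof.
move=> cu v s; apply: (@continuous_comp _ _ _ (fun s : R => s *: e_ i + v) u); last exact: cu.
by apply: cvgD; [apply: cvgZr_tmp; exact: cvg_id|exact: cvg_cst].
Qed.

Lemma is_derive_coord i j (v : V) : is_derive v (e_ i) (fun w : V => w 0 j) (i == j)%:R.
Proof.
have h : (fun h : R => h^-1 *: (((fun w : V => w 0 j) \o shift v) (h *: e_ i) - v 0 j))
   @ 0^' --> ((i == j)%:R : R).
  apply: (@cvg_trans _ ((fun=> (i == j)%:R : R) @ 0^')); last exact: cvg_cst.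
  apply: near_eq_cvg; near=> h; rewrite /= !mxE addrK eqxx /= eq_sym /GRing.scale/= mulKf//.
  by near: h; exact: nbhs_dnbhs_neq.
apply: DeriveDef; first by apply/cvg_ex; exists (i == j)%:R.
exact: cvg_lim h.
Unshelve. all: by end_near. Qed.

Lemma is_derive_dot i (v : V) : is_derive v (e_ i) (fun w : V => dot w w) (2 * v 0 i).
Proof.
rewrite (_ : (fun w => _) = \sum_(j < n) ((fun w : V => w 0 j) * (fun w : V => w 0 j))); last first.
  by apply/funext => w; rewrite /dot fct_sumE.
apply: is_derive_eq.
  by apply: is_derive_sum => j; apply: is_deriveM; exact: is_derive_coord.
rewrite (bigD1 i)//= eqxx big1 ?addr0.
  by rewrite /GRing.scale/= mulr1 -mulr2n mulr_natl.
by move=> j ji; rewrite eq_sym (negbTE ji) !scaler0 addr0.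
Qed.

Lemma integral_derive_eq0 i u du : (forall v, is_derive v (e_ i) u (du v)) ->
  line_continuous i du -> L1 (@leb R n) u -> L1 (@leb R n) du ->
  \int[@leb R n]_v du v = 0.
Proof.
move=> hu cdu Iu Idu.
have duE : du = pd i u by apply/funext => v; rewrite /pd derive_val.
rewrite duE; apply: Rint_pd_eq0 => //; rewrite -?duE//.
Qed.

End lines.

Section phase_space.
Context {R : realType} {N : nat}.
Local Notation V := 'rV[R]_N.
Local Notation e_ i := (delta_mx 0 i : V).
Implicit Types (u du : V * V -> R) (i j : 'I_N).

Lemma ae_Rint0 d (T : measurableType d) (m : {measure set T -> \bar R}) (f : T -> R) :
  measurable_fun setT f -> {ae m, forall x, f x = 0} -> \int[m]_x f x = 0.
Proof.
move=> mf f0; rewrite (@ae_eq_Rintegral _ _ _ _ f (cst 0))//.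
by rewrite Rintegral_cst// mul0r.
Qed.

Lemma integral_derive_v_eq0 i u du :
  (forall x v, is_derive v (e_ i) (fun v => u (x, v)) (du (x, v))) ->
  (forall x, line_continuous i (fun v => du (x, v))) ->
  L1 (@leb2 R N) u -> L1 (@leb2 R N) du -> \int[@leb2 R N]_p du p = 0.
Proof.
move=> hu cdu Iu Idu; rewrite /leb2 (Rint12 Idu).
apply: ae_Rint0; first exact: L1_measurable (L1_Rint2 Idu).
apply: filterS2 (ae_L1_1 Iu) (ae_L1_1 Idu) => x I1 I2.
exact: (integral_derive_eq0 (hu x)).
Qed.

Lemma integral_derive_x_eq0 i u du :
  (forall x v, is_derive x (e_ i) (fun x => u (x, v)) (du (x, v))) ->
  (forall v, line_continuous i (fun x => du (x, v))) ->
  L1 (@leb2 R N) u -> L1 (@leb2 R N) du -> \int[@leb2 R N]_p du p = 0.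
Proof.
move=> hu cdu Iu Idu; rewrite /leb2 (Rint21 Idu).
apply: ae_Rint0; first exact: L1_measurable (L1_Rint1 Idu).
apply: filterS2 (ae_L1_2 Iu) (ae_L1_2 Idu) => v I1 I2.
exact: (integral_derive_eq0 (hu ^~ v)).
Qed.

End phase_space.

(** * Polynomial weights in velocity *)

Section weights.
Context {R : realType} {N : nat}.
Local Notation V := 'rV[R]_N.
Local Notation e_ i := (delta_mx 0 i : V).
Implicit Types (x y v : V) (i j : 'I_N).

Lemma dot_ge0 v : 0 <= dot v v.
Proof. by apply: sumr_ge0 => i _; rewrite -expr2 sqr_ge0. Qed.

Lemma enorm_ge0 v : 0 <= enorm v.
Proof. exact: sqrtr_ge0. Qed.

Lemma sqr_enorm v : enorm v ^+ 2 = dot v v.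
Proof. by rewrite sqr_sqrtr// dot_ge0. Qed.

Lemma coord_le_enorm v i : `|v 0 i| <= enorm v.
Proof.
rewrite -sqrtr_sqr; apply: ler_wsqrtr; rewrite /dot (bigD1 i)//= expr2 lerDl.
by apply: sumr_ge0 => j _; rewrite -expr2 sqr_ge0.
Qed.

Lemma measurable_dot d (T : measurableType d) (F G : T -> V) :
  (forall i, measurable_fun setT (fun t => F t 0 i)) ->
  (forall i, measurable_fun setT (fun t => G t 0 i)) ->
  measurable_fun setT (fun t => dot (F t) (G t)).
Proof.
move=> mF mG; apply: measurable_sum => i.
by apply: measurable_funM.
Qed.

Lemma measurable_enorm d (T : measurableType d) (F : T -> V) :
  (forall i, measurable_fun setT (fun t => F t 0 i)) ->
  measurable_fun setT (fun t => enorm (F t)).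
Proof.
move=> mF; rewrite (_ : (fun _ => _) = (fun t => dot (F t) (F t) `^ 2^-1)); last first.
  by apply/funext => t; rewrite powR12_sqrt// dot_ge0.
exact: (measurableT_comp (@measurable_powR R 2^-1) (measurable_dot mF mF)).
Qed.

Lemma measurable_coord1 i : measurable_fun setT (fun p : V * V => p.1 0 i).
Proof. exact: (measurableT_comp (measurable_rV_coord i) measurable_fst). Qed.

Lemma measurable_coord2 i : measurable_fun setT (fun p : V * V => p.2 0 i).
Proof. exact: (measurableT_comp (measurable_rV_coord i) measurable_snd). Qed.

(* The weight of [decaying], as a function on phase space. *)
Definition weight (p : V * V) : R := (1 + enorm p.2) ^+ 3.

Lemma weight_ge1 p : 1 <= weight p.
Proof. by rewrite /weight exprn_ege1// lerDl enorm_ge0. Qed.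

(** Measurability of [g] is a clause of its own because the integrability clause sees only [|g|]. *)
Definition wL1 (g : V * V -> R) := measurable_fun setT g /\
  L1 (@leb2 R N) (fun p => weight p * `|g p|).

Lemma wL1M (g h : V * V -> R) (K : R) : wL1 g -> measurable_fun setT h ->
  (forall p, `|h p| <= K * weight p) -> L1 (@leb2 R N) (fun p => h p * g p).
Proof.
move=> [mg Ig] mh hK; apply: (le_L1 _ _ (L1Z K Ig)) => [|p].
  exact: measurable_funM.
by rewrite normrM mulrA ler_wpM2r.
Qed.

Lemma wL1_L1 (g : V * V -> R) : wL1 g -> L1 (@leb2 R N) g.
Proof.
move=> hg; suff : L1 (@leb2 R N) (fun p => 1 * g p) by under eq_fun do rewrite mul1r.
apply: (@wL1M g (fun=> 1) 1) => // p.
by rewrite mul1r normr1 weight_ge1.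
Qed.

(* The multipliers 1 and |v|^2 that give the mass and energy balances. *)
Definition quad (a b : R) (v : V) : R := a + b * dot v v.

Lemma measurable_quad a b : measurable_fun setT (fun p : V * V => quad a b p.2).
Proof.
apply: measurable_funD; first exact: measurable_cst.
apply: measurable_funM; first exact: measurable_cst.
by apply: measurable_dot => i; exact: measurable_coord2.
Qed.

Lemma quad_bound a b v : `|quad a b v| <= (`|a| + `|b|) * (1 + enorm v) ^+ 2.
Proof.
rewrite (le_trans (ler_normD _ _))// mulrDl lerD// ?normrM.
  by rewrite ler_peMr// exprn_ege1// lerDl enorm_ge0.
rewrite ler_wpM2l// ger0_norm ?dot_ge0// -sqr_enorm ler_pXn2r ?nnegrE ?enorm_ge0 ?addr_ge0 ?enorm_ge0//.
by rewrite lerDr.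
Qed.

Lemma quad_bound3 a b v : `|quad a b v| <= (`|a| + `|b|) * (1 + enorm v) ^+ 3.
Proof.
rewrite (le_trans (quad_bound _ _ _))// ler_wpM2l ?addr_ge0//.
by rewrite [leRHS]exprS ler_peMl ?exprn_ge0 ?addr_ge0 ?enorm_ge0// lerDl enorm_ge0.
Qed.

Lemma quad_coord_bound a b v i :
  `|quad a b v * v 0 i| <= (`|a| + `|b|) * (1 + enorm v) ^+ 3.
Proof.
rewrite normrM [_ ^+ 3]exprSr mulrA ler_pM// ?quad_bound//.
by rewrite (le_trans (coord_le_enorm _ _))// lerDr.
Qed.

Lemma coord_bound v i : `|v 0 i| <= (1 + enorm v) ^+ 3.
Proof.
rewrite (le_trans (coord_le_enorm _ _))//.
have h := enorm_ge0 v; rewrite -[X in X <= _]mul1r exprS ler_pM ?lerDl//.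
by rewrite expr2 -[X in X <= _]mul1r ler_pM ?lerDl ?lerDr.
Qed.

Lemma coord2_bound v i j : `|v 0 i * v 0 j| <= (1 + enorm v) ^+ 3.
Proof.
have h := enorm_ge0 v.
rewrite normrM (le_trans (ler_pM _ _ (coord_le_enorm v i) (coord_le_enorm v j)))//.
rewrite -expr2 [leRHS]exprS -[leLHS]mul1r ler_pM ?sqr_ge0 ?lerDl//.
by rewrite ler_pXn2r ?nnegrE ?addr_ge0 ?lerDr.
Qed.

End weights.

Section derivatives_of_fluxes.
Context {R : realType} {N : nat}.
Local Notation V := 'rV[R]_N.
Local Notation e_ i := (delta_mx 0 i : V).

Lemma is_derive_quad i (a b : R) (v : V) :
  is_derive v (e_ i) (quad a b) (b * (2 * v 0 i)).
Proof. by have dd := is_derive_dot i v; apply: is_derive_eq; rewrite add0r. Qed.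

(** One flux for two uses. With [Q] constant and [c = 0] it expands the divergence in the equation.
    With [Q = quad a b] and [c = 2 * b] it is the primitive for testing the collision terms, where
    the correction c v_i F integrates the diffusion term by parts a second time. *)
Lemma is_derive_flux i (v : V) (Q F G : V -> R) (Bx ax c dQ dF dG : R) :
  is_derive v (e_ i) Q dQ -> is_derive v (e_ i) F dF -> is_derive v (e_ i) G dG ->
  is_derive v (e_ i)
    (fun w => Q w * (Bx * F w + ax * (w 0 i * F w) + G w) - c * (w 0 i * F w))
    (dQ * (Bx * F v + ax * (v 0 i * F v) + G v)
     + Q v * (Bx * dF + ax * (F v + v 0 i * dF) + dG) - c * (F v + v 0 i * dF)).
Proof.
move=> hQ hF hG; have dv := is_derive_coord i i v; rewrite eqxx in dv.
have hvF := is_deriveM dv hF.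
have h1 := is_deriveM hQ (is_deriveD (is_deriveD (is_deriveZ Bx hF) (is_deriveZ ax hvF)) hG).
have h2 := is_deriveB h1 (is_deriveZ c hvF).
apply: (@is_derive_eq _ _ _ _ _ _ _ _ h2).
rewrite [LHS](_ : _ = Q v * (Bx * dF + ax * (v 0 i * dF + F v * 1) + dG)
  + (Bx * F v + ax * (v 0 i * F v) + G v) * dQ - c * (v 0 i * dF + F v * 1))//.
ring.
Qed.

End derivatives_of_fluxes.

Section continuous_pairing.
Context {T1 T2 : topologicalType}.

Lemma continuous_pairl (x : T1) : continuous (fun y : T2 => (x, y)).
Proof. by move=> y; apply: (cvg_pair (cvg_cst x) (@cvg_id _ (nbhs y))). Qed.

Lemma continuous_pairr (y : T2) : continuous (fun x : T1 => (x, y)).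
Proof. by move=> x; apply: (cvg_pair (@cvg_id _ (nbhs x)) (cvg_cst y)). Qed.

End continuous_pairing.

(** * Integration by parts in (x,v) at a fixed time *)

Section fixed_time_identity.
Context {R : realType} {N : nat}.
Local Notation V := 'rV[R]_N.
Local Notation e_ i := (delta_mx 0 i : V).
Local Notation m2 := (@leb2 R N).
Variables (F : V -> V -> R) (a b eps K : R) (al : V -> R) (B : V -> V).
Hypothesis C12 : C1x_C2v F.
Hypothesis F_w : wL1 (fun p => F p.1 p.2).
Hypothesis Fx_w : forall i, wL1 (fun p => pd i (F^~ p.2) p.1).
Hypothesis Fv_w : forall i, wL1 (fun p => pd i (F p.1) p.2).
Hypothesis Fvv_w : forall i, wL1 (fun p => pd i (pd i (F p.1)) p.2).
Hypothesis mal : measurable_fun setT al.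
Hypothesis al_le : forall x, `|al x| <= K.
Hypothesis mB : forall i, measurable_fun setT (fun x => B x 0 i).
Hypothesis B_le : forall x i, `|B x 0 i| <= K.

Let W (p : V * V) := quad a b p.2.
Let K0 : 0 <= K. Proof. exact: le_trans (normr_ge0 _) (al_le 0). Qed.

(* In the application [al = 1 + phi * rho] and [B = grad psi - phi * j]. *)
Definition transport_part (i : 'I_N) (p : V * V) : R :=
  quad a b p.2 * p.2 0 i * pd i (F^~ p.2) p.1.

(** The i-th summand of the expanded velocity divergence and of the force term, times the
    multiplier; both contributions to the first derivative are merged into [B]. *)
Definition collision_part (i : 'I_N) (p : V * V) : R :=
  quad a b p.2 * (B p.1 0 i * pd i (F p.1) p.2 +
    al p.1 * (F p.1 p.2 + p.2 0 i * pd i (F p.1) p.2) + pd i (pd i (F p.1)) p.2).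

(** What survives of [collision_part] once all derivatives have been moved onto the multiplier, up
    to the factor -2b and the contribution of diffusion. *)
Definition drift_part (i : 'I_N) (p : V * V) : R :=
  al p.1 * (p.2 0 i * p.2 0 i) * F p.1 p.2 + B p.1 0 i * p.2 0 i * F p.1 p.2.

Let mal1 : measurable_fun setT (fun p : V * V => al p.1).
Proof. exact: measurableT_comp mal measurable_fst. Qed.

Let mB1 i : measurable_fun setT (fun p : V * V => B p.1 0 i).
Proof. exact: measurableT_comp (mB i) measurable_fst. Qed.

Let mW : measurable_fun setT W.
Proof. exact: measurable_quad. Qed.

Let mvi i : measurable_fun setT (fun p : V * V => p.2 0 i).
Proof. exact: measurable_coord2. Qed.

Lemma L1_transport_part i : L1 m2 (transport_part i).
Proof.
apply: (@wL1M _ _ _ (fun p => W p * p.2 0 i) (`|a| + `|b|) (Fx_w i)).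
  exact: measurable_funM.
by move=> p; exact: quad_coord_bound.
Qed.

(** The multiplier and v_i do not depend on x, so the integrand is an exact x_i-derivative. *)
Lemma integral_transport_part i : \int[m2]_p transport_part i p = 0.
Proof.
have [cF /(_ i)[gFx cFx _ _ _]] := C12.
apply: (@integral_derive_x_eq0 _ _ i (fun p => W p * p.2 0 i * F p.1 p.2)).
- move=> x v.
  have := derivableP (gFx v i x) => dF.
  rewrite (_ : (fun x => _) = (quad a b v * v 0 i) *: (F^~ v)); last exact/funext.
  exact: is_deriveZ.
- move=> v; apply: (line_continuousM (u1 := fun=> quad a b v * v 0 i)).
    exact: line_continuous_cst.
  apply: line_continuous_continuous => x.
  apply: (@continuous_comp _ _ _ (fun x : V => (x, v)) (fun p => pd i (F^~ p.2) p.1)).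
    exact: continuous_pairr.
  exact: cFx.
- apply: (@wL1M _ _ _ (fun p => W p * p.2 0 i) (`|a| + `|b|) F_w).
    exact: measurable_funM.
  by move=> p; exact: quad_coord_bound.
- exact: L1_transport_part.
Qed.

Let L1_WB i g : wL1 g -> L1 m2 (fun p => W p * B p.1 0 i * g p).
Proof.
move=> hg; apply: (@wL1M _ _ _ (fun p => W p * B p.1 0 i) ((`|a| + `|b|) * K)) => //.
  exact: measurable_funM.
by move=> p; rewrite normrM mulrAC ler_pM// quad_bound3.
Qed.

Let L1_Wal g : wL1 g -> L1 m2 (fun p => W p * al p.1 * g p).
Proof.
move=> hg; apply: (@wL1M _ _ _ (fun p => W p * al p.1) ((`|a| + `|b|) * K)) => //.
  exact: measurable_funM.
by move=> p; rewrite normrM mulrAC ler_pM// quad_bound3.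
Qed.

Let L1_Walv i g : wL1 g -> L1 m2 (fun p => W p * p.2 0 i * al p.1 * g p).
Proof.
move=> hg; apply: (@wL1M _ _ _ (fun p => W p * p.2 0 i * al p.1) ((`|a| + `|b|) * K)) => //.
  by do 2 apply: measurable_funM => //.
by move=> p; rewrite normrM mulrAC ler_pM// quad_coord_bound.
Qed.

Let L1_W g : wL1 g -> L1 m2 (fun p => W p * g p).
Proof.
move=> hg; apply: (@wL1M _ _ _ W (`|a| + `|b|)) => //.
by move=> p; exact: quad_bound3.
Qed.

Let L1_v (i : 'I_N) : L1 m2 (fun p : V * V => p.2 0 i * F p.1 p.2).
Proof.
apply: (@wL1M _ _ _ (fun p => p.2 0 i) 1 F_w) => // p.
by rewrite mul1r coord_bound.
Qed.

Lemma L1_collision_part i : L1 m2 (collision_part i).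
Proof.
have := L1D (L1D (L1_WB i (Fv_w i)) (L1D (L1_Wal F_w) (L1_Walv i (Fv_w i)))) (L1_W (Fvv_w i)).
apply: eq_integrable => // p _ /=; congr EFin; rewrite /collision_part /W; ring.
Qed.

Lemma L1_drift_part i : L1 m2 (drift_part i).
Proof.
apply: L1D.
- apply: (@wL1M _ _ _ (fun p => al p.1 * (p.2 0 i * p.2 0 i)) K F_w).
    by do 2 apply: measurable_funM => //.
  by move=> p; rewrite normrM ler_pM// coord2_bound.
- apply: (@wL1M _ _ _ (fun p => B p.1 0 i * p.2 0 i) K F_w).
    exact: measurable_funM.
  by move=> p; rewrite normrM ler_pM// coord_bound.
Qed.

(** The combination [du] is the exact v_i-derivative of [u], so its integral vanishes. The
    derivative 2 b v_i of the multiplier produces [drift_part], and the second integration by parts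
    in the diffusion term produces the total mass. *)
Lemma integral_collision_part i : \int[m2]_p collision_part i p =
  2 * b * (\int[m2]_p F p.1 p.2 - \int[m2]_p drift_part i p).
Proof.
have [cF /(_ i)[_ _ gFv cFv /(_ i)[gFvv cFvv]]] := C12.
pose u (p : V * V) := quad a b p.2 * (B p.1 0 i * F p.1 p.2 +
  al p.1 * (p.2 0 i * F p.1 p.2) + pd i (F p.1) p.2) - 2 * b * (p.2 0 i * F p.1 p.2).
pose du (p : V * V) := collision_part i p + 2 * b * drift_part i p - 2 * b * F p.1 p.2.
have Idu : L1 m2 du.
  apply: L1B; last exact/L1Z/wL1_L1.
  by apply: L1D; [exact: L1_collision_part|exact/L1Z/L1_drift_part].
have : \int[m2]_p du p = 0.
  apply: (@integral_derive_v_eq0 _ _ i u) => //.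
  - move=> x v.
    have dF := derivableP (gFv x i v).
    have ddF := derivableP (gFvv x i v).
    have h := @is_derive_flux R N i v (quad a b) (F x) (pd i (F x)) (B x 0 i) (al x)
      (2 * b) _ _ _ (is_derive_quad i a b v) dF ddF.
    apply: (@is_derive_eq _ _ _ _ _ _ _ _ h).
    rewrite /du /collision_part /drift_part /pd /=; ring.
  - move=> x.
    have lF : line_continuous i (F x).
      by apply: (@derive_line_continuous _ _ i _ (pd i (F x))) => v; exact: derivableP (gFv x i v).
    have lFv : line_continuous i (pd i (F x)).
      by apply: (@derive_line_continuous _ _ i _ (pd i (pd i (F x)))) => v; exact: derivableP (gFvv x i v).
    have lFvv : line_continuous i (pd i (pd i (F x))).
      apply: line_continuous_continuous => v.
      apply: (@continuous_comp _ _ _ (fun v : V => (x, v)) (fun p => pd i (pd i (F p.1)) p.2)).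
        exact: continuous_pairl.
      exact: cFvv.
    have lv : line_continuous i (fun v : V => v 0 i).
      by apply: (derive_line_continuous (du := fun=> (i == i)%:R)) => v; exact: is_derive_coord.
    have lq : line_continuous i (quad a b).
      apply: line_continuousD; first exact: line_continuous_cst.
      apply: line_continuousM; first exact: line_continuous_cst.
      by apply: (derive_line_continuous (du := fun v => 2 * v 0 i)) => v; exact: is_derive_dot.
    have lc := @line_continuous_cst R N i.
    rewrite (_ : (fun v => du (x, v)) = (fun v => quad a b v * (B x 0 i * pd i (F x) v +
       al x * (F x v + v 0 i * pd i (F x) v) + pd i (pd i (F x)) v) +
       2 * b * (al x * (v 0 i * v 0 i) * F x v + B x 0 i * v 0 i * F x v)
       + (- (2 * b)) * F x v)); last first.
      by apply/funext => v; rewrite /du /= mulNr.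
    pose lD := @line_continuousD R N i; pose lM := @line_continuousM R N i.
    exact: (lD _ _ (lD _ _ (lM _ _ lq (lD _ _ (lD _ _ (lM _ _ (lc _) lFv)
      (lM _ _ (lc _) (lD _ _ lF (lM _ _ lv lFv)))) lFvv))
      (lM _ _ (lc _) (lD _ _ (lM _ _ (lM _ _ (lc _) (lM _ _ lv lv)) lF)
      (lM _ _ (lM _ _ (lc _) lv) lF)))) (lM _ _ (lc _) lF)).
  - have := L1B (L1D (L1D (L1_WB i F_w) (L1_Walv i F_w)) (L1_W (Fv_w i)))
      (L1Z (2 * b) (L1_v i)).
    apply: eq_integrable => // p _ /=; congr EFin; rewrite /u /W; ring.
rewrite RintegralB//; [|idtac|exact/L1Z/wL1_L1]; last first.
  by apply: L1D; [exact: L1_collision_part|exact/L1Z/L1_drift_part].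
rewrite RintegralD//; [|exact: L1_collision_part|exact/L1Z/L1_drift_part].
rewrite !RintegralZl//; [|exact: wL1_L1|exact: L1_drift_part].
by move=> h; lra.
Qed.

End fixed_time_identity.

(** * Velocity moments and dissipation *)

Section ae_product.
Context d1 d2 (T1 : measurableType d1) (T2 : measurableType d2) (R : realType).
Variable m1 : {sigma_finite_measure set T1 -> \bar R}.
Variable m2 : {sigma_finite_measure set T2 -> \bar R}.

Lemma ae_fst (A : T1 -> Prop) : {ae m1, forall x, A x} ->
  {ae (m1 \x m2)%E, forall p : T1 * T2, A p.1}.
Proof.
move=> [X [mX X0 AX]]; exists (X `*` setT); split; first exact: measurableX.
  apply: (etrans (product_measure1E m1 m2 mX measurableT)).
  by transitivity (0 * m2 setT)%E; [congr (_ * _)%E; exact: X0|rewrite mul0e].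
by move=> [x y] /= nA; split => //; exact: AX.
Qed.

Lemma ae_snd (A : T2 -> Prop) : {ae m2, forall y, A y} ->
  {ae (m1 \x m2)%E, forall p : T1 * T2, A p.2}.
Proof.
move=> [X [mX X0 AX]]; exists (setT `*` X); split; first exact: measurableX.
  by rewrite product_measure1E// X0 mule0.
by move=> [x y] /= nA; split => //; exact: AX.
Qed.

(** The measures of the sections of a null set are nonnegative with zero integral, hence vanish
    almost everywhere. *)
Lemma ae_sections (A : T1 * T2 -> Prop) : {ae (m1 \x m2)%E, forall p, A p} ->
  {ae m1, forall x, {ae m2, forall y, A (x, y)}}.
Proof.
move=> [X [mX X0 AX]].
have : {ae m1, forall x, setT x -> m2 (xsection X x) = 0%E}.
  apply/ae_eq_integral_abs => //; first exact: measurable_fun_xsection.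
  rewrite -[RHS]X0; apply: eq_integral => x _.
  by rewrite gee0_abs// measure_ge0.
apply: filterS => x /(_ I) x0; exists (xsection X x); split => //.
  exact: measurable_xsection.
by move=> y /= nA; rewrite /xsection/= inE; exact: AX.
Qed.

Lemma L1_prod (f : T1 -> R) (g : T2 -> R) : L1 m1 f -> L1 m2 g ->
  L1 (m1 \x m2)%E (fun p => f p.1 * g p.2).
Proof.
move=> If Ig; have mf := L1_measurable If; have mg := L1_measurable Ig.
have mfg : measurable_fun setT (fun p : T1 * T2 => f p.1 * g p.2).
  apply: measurable_funM; first exact: (measurableT_comp mf measurable_fst).
  exact: (measurableT_comp mg measurable_snd).
apply/integrable12ltyP; first exact/measurable_EFinP.
rewrite (eq_integral (fun x => (`|f x|)%:E * (\int[m2]_y `|(g y)%:E|))%E).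
  rewrite ge0_integralZr//.
  - apply: lte_mul_pinfty => //; try by case/integrableP : If.
    + exact: integral_ge0.
    + rewrite ge0_fin_numE; first by case/integrableP : If.
      exact: integral_ge0.
    + by case/integrableP : Ig.
  - by apply/measurable_EFinP/measurableT_comp.
  - exact: integral_ge0.
move=> x _; rewrite -ge0_integralZl_EFin//.
- by apply: eq_integral => y _; rewrite /= normrM EFinM.
- by apply/measurable_EFinP/measurableT_comp.
Qed.

Lemma Rint_prod (f : T1 -> R) (g : T2 -> R) : L1 m1 f -> L1 m2 g ->
  \int[(m1 \x m2)%E]_p (f p.1 * g p.2) = (\int[m1]_x f x) * (\int[m2]_y g y).
Proof.
move=> If Ig; rewrite (Rint12 (L1_prod If Ig)) /= -RintegralZr//.
by apply: eq_Rintegral => x _; rewrite RintegralZl.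
Qed.

Lemma ae_le_Rint (f g : T1 -> R) : L1 m1 f -> L1 m1 g ->
  {ae m1, forall x, f x <= g x} -> \int[m1]_x f x <= \int[m1]_x g x.
Proof.
move=> If Ig fg; have Igf := L1B Ig If.
rewrite -subr_ge0 -RintegralB//.
(* The positive part of g - f agrees with g - f almost everywhere and is nonnegative everywhere. *)
rewrite (@ae_eq_Rintegral _ _ _ m1 _ (fun x => Num.max 0 (g x - f x))).
- by apply: Rintegral_ge0 => x _; rewrite le_max lexx.
- exact: L1_measurable Igf.
- by apply: measurable_maxr => //; exact: L1_measurable Igf.
- by apply: filterS fg => x h; rewrite max_r// subr_ge0.
Qed.

End ae_product.

Section euclidean.
Context {R : realType} {N : nat}.
Local Notation V := 'rV[R]_N.
Implicit Types (x y v w : V) (a b : R).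

Lemma dotC x y : dot x y = dot y x.
Proof. by apply: eq_bigr => i _; rewrite mulrC. Qed.

Lemma dotDl x y v : dot (x + y) v = dot x v + dot y v.
Proof. by rewrite -big_split; apply: eq_bigr => i _; rewrite mxE mulrDl. Qed.

Lemma dotZl a x y : dot (a *: x) y = a * dot x y.
Proof. by rewrite /dot mulr_sumr; apply: eq_bigr => i _; rewrite mxE mulrA. Qed.

Lemma dotNl x y : dot (- x) y = - dot x y.
Proof. by rewrite -scaleN1r dotZl mulN1r. Qed.

Lemma dotBl x y v : dot (x - y) v = dot x v - dot y v.
Proof. by rewrite dotDl dotNl. Qed.

Lemma dotBr x y v : dot v (x - y) = dot v x - dot v y.
Proof. by rewrite dotC dotBl !(dotC _ v). Qed.

Lemma dotZr a x y : dot x (a *: y) = a * dot x y.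
Proof. by rewrite dotC dotZl dotC. Qed.

Lemma enormN x : enorm (- x) = enorm x.
Proof. by rewrite /enorm dotNl dotC dotNl opprK. Qed.

Lemma enorm_distC x y : enorm (x - y) = enorm (y - x).
Proof. by rewrite -enormN opprB. Qed.

Lemma dot_le_sqr x y : 2 * `|dot x y| <= dot x x + dot y y.
Proof.
have h1 := dot_ge0 (x - y); have h2 := dot_ge0 (x + y).
rewrite dotBl !dotBr (dotC y x) in h1.
rewrite dotDl !(dotC _ (x + y)) !dotDl (dotC y x) in h2.
have [h|h] := leP 0 (dot x y); [rewrite ger0_norm|rewrite ltr0_norm]; lra.
Qed.

Lemma enorm_le_mean (x : V) (a b : R) : 0 <= a -> 0 <= b -> dot x x <= a * b ->
  2 * enorm x <= a + b.
Proof.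
move=> a0 b0 h; have h0 := enorm_ge0 x.
rewrite -(@ler_pXn2r _ 2) ?nnegrE ?addr_ge0 ?mulr_ge0//.
rewrite exprMn sqr_enorm; have := sqr_ge0 (a - b); rewrite !expr2; lra.
Qed.

(** Discriminant form of Cauchy-Schwarz. The polynomial is the integral of |s v - J|^2 F(x,v) in v,
    where [a] is the energy density, [c] the mass density and [b] is |J|^2; for [a > 0] its minimum
    is at s = b/a. *)
Lemma discr_le (a b c : R) : 0 <= a -> 0 <= b -> 0 <= c ->
  (forall s, 0 <= a * s ^+ 2 - 2 * b * s + b * c) -> b <= a * c.
Proof.
move=> a0 b0 c0 h; have [b_eq0|b_neq0] := eqVneq b 0; first by rewrite b_eq0 mulr_ge0.
have b_gt0 : 0 < b by rewrite lt_neqAle eq_sym b_neq0.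
have [a_eq0|a_neq0] := eqVneq a 0.
  (* The polynomial is now affine in s, and at this point it equals -b < 0. *)
  by have := h ((c + 1) / 2); rewrite a_eq0; lra.
have a_gt0 : 0 < a by rewrite lt_neqAle eq_sym a_neq0.
have := h (b / a).
rewrite (_ : a * (b / a) ^+ 2 - 2 * b * (b / a) + b * c = b / a * (a * c - b)); last by field.
by rewrite pmulr_rge0 ?divr_gt0// subr_ge0.
Qed.

End euclidean.

Section moments.
Context {R : realType} {N : nat}.
Local Notation V := 'rV[R]_N.
Local Notation m2 := (@leb2 R N).
Local Notation m := (@leb R N).
Variable F : V -> V -> R.
Hypothesis F_ge0 : forall x v, 0 <= F x v.
Hypothesis F_w : wL1 (fun p => F p.1 p.2).

Definition nrg (x : V) : R := \int[m]_v (dot v v * F x v).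

Let mF : measurable_fun setT (fun p : V * V => F p.1 p.2).
Proof. exact: F_w.1. Qed.

Lemma L1_density : L1 m2 (fun p => F p.1 p.2).
Proof. exact: wL1_L1. Qed.

Lemma dot_bound (v : V) : `|dot v v| <= (1 + enorm v) ^+ 3.
Proof. by have := quad_bound3 0 1 v; rewrite /quad add0r mul1r normr0 add0r normr1 mul1r. Qed.

Lemma L1_energy_density : L1 m2 (fun p => dot p.2 p.2 * F p.1 p.2).
Proof.
apply: (@wL1M _ _ _ (fun p : V * V => dot p.2 p.2) 1 F_w).
  by apply: measurable_dot => i; exact: measurable_coord2.
by move=> p; rewrite mul1r dot_bound.
Qed.

Lemma L1_momentum_density (i : 'I_N) : L1 m2 (fun p : V * V => p.2 0 i * F p.1 p.2).
Proof.
apply: (@wL1M _ _ _ (fun p : V * V => p.2 0 i) 1 F_w).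
  exact: measurable_coord2.
by move=> p; rewrite mul1r coord_bound.
Qed.

Lemma L1_rho : L1 m (rho F).
Proof. exact: (L1_Rint2 L1_density). Qed.

Lemma L1_nrg : L1 m nrg.
Proof. exact: (L1_Rint2 L1_energy_density). Qed.

Lemma cur_coord i : (fun x => cur F x 0 i) = (fun x => \int[m]_v (v 0 i * F x v)).
Proof. by apply/funext => x; rewrite mxE. Qed.

Lemma L1_cur i : L1 m (fun x => cur F x 0 i).
Proof. by rewrite cur_coord; exact: (L1_Rint2 (L1_momentum_density i)). Qed.

Lemma rho_ge0 x : 0 <= rho F x.
Proof. by apply: Rintegral_ge0 => v _. Qed.

Lemma nrg_ge0 x : 0 <= nrg x.
Proof. by apply: Rintegral_ge0 => v _; rewrite mulr_ge0 ?dot_ge0. Qed.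

Lemma Rint_rho : \int[m]_x rho F x = \int[m2]_p F p.1 p.2.
Proof. by rewrite /leb2 (Rint12 L1_density). Qed.

(** Cauchy-Schwarz for |j|^2 <= (energy density) * rho. Projecting v on the vector J = j(x) itself
    keeps the constant 1 in every dimension. The velocity moments are finite only for almost every
    x. *)
Lemma ae_dot_cur_le : {ae m, forall x, dot (cur F x) (cur F x) <= nrg x * rho F x}.
Proof.
have hi : {ae m, forall x, forall i : 'I_N, L1 m (fun v : V => v 0 i * F x v)}.
  by apply: filter_forall => i; exact: (ae_L1_1 (L1_momentum_density i)).
apply: filterS3 hi (ae_L1_1 L1_density) (ae_L1_1 L1_energy_density) => x /= Ii I0 I2.
set J := cur F x; apply: discr_le; rewrite ?nrg_ge0 ?rho_ge0 ?dot_ge0// => s.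
have Idot : L1 m (fun v : V => dot J v * F x v).
  have h := L1_sum (index_enum 'I_N) (fun i => L1Z (J 0 i) (Ii i)).
  apply: eq_integrable h => // v _ /=; congr EFin.
  by rewrite /dot mulr_suml; apply: eq_bigr => i _; rewrite mulrA.
have dotJ : \int[m]_v (dot J v * F x v) = dot J J.
  transitivity (\int[m]_v (\sum_(i < N) (J 0 i * (v 0 i * F x v)))).
    by apply: eq_Rintegral => v _; rewrite /dot mulr_suml; apply: eq_bigr => i _; rewrite mulrA.
  rewrite Rint_sum; last by move=> i; exact/L1Z/Ii.
  by apply: eq_bigr => i _; rewrite RintegralZl// {3}/J /cur mxE.
have -> : nrg x * s ^+ 2 - 2 * dot J J * s + dot J J * rho F x =
    \int[m]_v (dot (s *: v - J) (s *: v - J) * F x v).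
  transitivity (\int[m]_v (s ^+ 2 * (dot v v * F x v) - (2 * s) * (dot J v * F x v)
     + dot J J * F x v)).
    rewrite RintegralD//; [|by apply: L1B; exact: L1Z|exact: L1Z].
    rewrite RintegralB//; [|exact: L1Z|exact: L1Z].
    rewrite !RintegralZl// dotJ /nrg /rho; ring.
  apply: eq_Rintegral => v _.
  by rewrite dotBl !dotBr !dotZl !dotZr (dotC v J); ring.
by apply: Rintegral_ge0 => v _; rewrite mulr_ge0 ?dot_ge0.
Qed.

End moments.

Section interaction.
Context {R : realType} {N : nat}.
Local Notation V := 'rV[R]_N.
Local Notation m2 := (@leb2 R N).
Local Notation m := (@leb R N).
Variables (F : V -> V -> R) (phi : R -> R) (K : R).
Hypothesis F_ge0 : forall x v, 0 <= F x v.
Hypothesis F_w : wL1 (fun p => F p.1 p.2).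
Hypothesis mphi : measurable_fun setT phi.
Hypothesis phi_ge0 : forall r, 0 <= phi r.
Hypothesis phi_le : forall r, phi r <= K.

Let K0 : 0 <= K. Proof. exact: le_trans (phi_ge0 0) (phi_le 0). Qed.

(* Equal to the integral over (v,w) of |v - w|^2 F(x,v) F(y,w), expanded in
   moments so that only integrals over one copy of R^N occur. *)
Definition defect (p : V * V) : R :=
  rho F p.2 * nrg F p.1 + rho F p.1 * nrg F p.2 - 2 * dot (cur F p.1) (cur F p.2).

Definition dissipation : R := \int[m2]_p (phi (enorm (p.1 - p.2)) * defect p).

Let mker : measurable_fun setT (fun p : V * V => phi (enorm (p.1 - p.2))).
Proof.
apply: (measurableT_comp mphi); apply: measurable_enorm => i.
under eq_fun do rewrite !mxE.
by apply: measurable_funB; [exact: measurable_coord1|exact: measurable_coord2].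
Qed.

Lemma L1_ker (g : V * V -> R) : L1 m2 g ->
  L1 m2 (fun p => phi (enorm (p.1 - p.2)) * g p).
Proof.
move=> Ig; apply: (le_L1 _ _ (L1Z K (integrable_norm Ig))).
  by apply: measurable_funM => //; exact: L1_measurable Ig.
by move=> p; rewrite normrM ler_wpM2r// ger0_norm.
Qed.

Lemma L1_ker_prod (g h : V -> R) : L1 m g -> L1 m h ->
  L1 m2 (fun p => phi (enorm (p.1 - p.2)) * (h p.1 * g p.2)).
Proof. by move=> Ig Ih; apply: L1_ker; exact: (L1_prod Ih Ig). Qed.

Lemma measurable_convol (g : V -> R) : L1 m g -> measurable_fun setT (convol phi g).
Proof.
move=> Ig; apply: (@measurable_Rint2 _ _ _ _ _ m (fun p : V * V => phi (enorm (p.1 - p.2)) * g p.2)).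
by apply: measurable_funM => //; exact: measurableT_comp (L1_measurable Ig) measurable_snd.
Qed.

Let L1_ker1 (g : V -> R) x : L1 m g -> L1 m (fun y => phi (enorm (x - y)) * g y).
Proof.
move=> Ig; apply: (le_L1 _ _ (L1Z K (integrable_norm Ig))).
  apply: measurable_funM; last exact: L1_measurable Ig.
  by have := mker; move=> /(@measurable_fun_pair2 _ _ _ _ _ _ _ x).
by move=> y; rewrite normrM ler_wpM2r// ger0_norm.
Qed.

Lemma convol_bound (g : V -> R) x : L1 m g -> `|convol phi g x| <= K * \int[m]_y `|g y|.
Proof.
move=> Ig; rewrite (le_trans (le_normr_Rintegral _ _))//; first exact: L1_ker1.
have Ing := integrable_norm Ig.
rewrite -RintegralZl//; apply: le_Rintegral => //.
- exact: integrable_norm (L1_ker1 x Ig).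
- exact: L1Z.
- by move=> y _; rewrite normrM ler_wpM2r// ger0_norm.
Qed.

Lemma Rint_convol (g h : V -> R) : L1 m g -> L1 m h ->
  \int[m]_x (convol phi g x * h x) =
  \int[m2]_p (phi (enorm (p.1 - p.2)) * (h p.1 * g p.2)).
Proof.
move=> Ig Ih; rewrite /leb2 (Rint12 (L1_ker_prod Ig Ih)); apply: eq_Rintegral => x _ /=.
rewrite mulrC -RintegralZl//; last exact: L1_ker1.
by apply: eq_Rintegral => y _; ring.
Qed.

Lemma Rint_ker_swap (g h : V -> R) : L1 m g -> L1 m h ->
  \int[m2]_p (phi (enorm (p.1 - p.2)) * (h p.1 * g p.2)) =
  \int[m2]_p (phi (enorm (p.1 - p.2)) * (g p.1 * h p.2)).
Proof.
move=> Ig Ih; rewrite /leb2 (Rint_swap (L1_ker_prod Ig Ih)).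
by apply: eq_Rintegral => p _ /=; rewrite enorm_distC (mulrC (h _)).
Qed.

Let L1_cur2 : L1 m2 (fun p => dot (cur F p.1) (cur F p.2)).
Proof. by apply: L1_sum => i; exact: (L1_prod (L1_cur F_w i) (L1_cur F_w i)). Qed.

Lemma L1_defect : L1 m2 defect.
Proof.
apply: L1B; last exact: L1Z.
apply: L1D; last exact: (L1_prod (L1_rho F_w) (L1_nrg F_w)).
have := L1_prod (L1_nrg F_w) (L1_rho F_w).
by apply: eq_integrable => // p _ /=; rewrite mulrC.
Qed.

(** The kernel is symmetric in (x,y), so the two energy-density terms of the defect have equal
    integrals. The right-hand side is twice the sum of the nonlocal friction terms met in the energy
    balance. *)
Lemma dissipationE : dissipation =
  2 * (\int[m]_x (convol phi (rho F) x * nrg F x) -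
       \sum_(i < N) \int[m]_x (convolv phi (cur F) x 0 i * cur F x 0 i)).
Proof.
have Ir := L1_rho F_w; have Ie := L1_nrg F_w; have Ij := L1_cur F_w.
have Ier := L1_ker_prod Ir Ie; have Ire := L1_ker_prod Ie Ir.
have Ijj i := L1_ker_prod (Ij i) (Ij i).
rewrite (Rint_convol Ir Ie).
have e i : \int[m]_x (convolv phi (cur F) x 0 i * cur F x 0 i) =
    \int[m2]_p (phi (enorm (p.1 - p.2)) * (cur F p.1 0 i * cur F p.2 0 i)).
  rewrite -(Rint_convol (Ij i) (Ij i)).
  by apply: eq_Rintegral => x _; rewrite mxE.
rewrite (eq_bigr _ (fun i _ => e i)).
rewrite -Rint_sum//.
transitivity (\int[m2]_p (phi (enorm (p.1 - p.2)) * (nrg F p.1 * rho F p.2)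
  + phi (enorm (p.1 - p.2)) * (rho F p.1 * nrg F p.2)
  - 2 * \sum_(i < N) phi (enorm (p.1 - p.2)) * (cur F p.1 0 i * cur F p.2 0 i))).
  by apply: eq_Rintegral => p _; rewrite /defect -mulr_sumr /dot; ring.
rewrite RintegralB//; [|exact: L1D|exact/L1Z/L1_sum].
rewrite RintegralD// RintegralZl//; last exact: L1_sum.
by rewrite (Rint_ker_swap Ie Ir); ring.
Qed.

End interaction.

(** * The commutator bound and the balance at a fixed time *)

Section commutator_bound.
Context {R : realType} {N : nat}.
Local Notation V := 'rV[R]_N.
Local Notation m2 := (@leb2 R N).
Local Notation m := (@leb R N).
Variables (F : V -> V -> R) (phi : R -> R) (K : R).
Hypothesis F_ge0 : forall x v, 0 <= F x v.
Hypothesis F_w : wL1 (fun p => F p.1 p.2).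
Hypothesis mphi : measurable_fun setT phi.
Hypothesis phi_ge0 : forall r, 0 <= phi r.
Hypothesis phi_le : forall r, phi r <= K.

Lemma dot_eq0 (x y : V) : dot x x <= 0 -> dot x y = 0.
Proof.
move=> h; have x0 : enorm x = 0.
  by apply/eqP; rewrite /enorm sqrtr_eq0.
rewrite /dot big1// => i _; suff -> : x 0 i = 0 by rewrite mul0r.
by apply/eqP; rewrite -normr_le0 -x0 coord_le_enorm.
Qed.

(** Expanding the square and inserting the bounds on |j1|^2 and |j2|^2 gives r1 r2 q, whence q >= 0
    if both densities are positive. If one density vanishes, so does its current, and q is a sum of
    nonnegative terms. *)
Lemma defect_algebra (r1 r2 e1 e2 : R) (j1 j2 : V) :
  0 <= r1 -> 0 <= r2 -> 0 <= e1 -> 0 <= e2 ->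
  dot j1 j1 <= e1 * r1 -> dot j2 j2 <= e2 * r2 ->
  let q := r2 * e1 + r1 * e2 - 2 * dot j1 j2 in
  0 <= q /\ dot (r1 *: j2 - r2 *: j1) (r1 *: j2 - r2 *: j1) <= r1 * r2 * q.
Proof.
move=> r10 r20 e10 e20 h1 h2 q.
have le_q : dot (r1 *: j2 - r2 *: j1) (r1 *: j2 - r2 *: j1) <= r1 * r2 * q.
  rewrite dotBl !dotBr !dotZl !dotZr (dotC j2 j1) /q.
  have a1 : r1 * (r1 * dot j2 j2) <= r1 * (r1 * (e2 * r2)) by rewrite !ler_wpM2l.
  have a2 : r2 * (r2 * dot j1 j1) <= r2 * (r2 * (e1 * r1)) by rewrite !ler_wpM2l.
  lra.
split=> //; have [r1_eq0|r1_neq0] := eqVneq r1 0.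
  by rewrite /q dot_eq0 ?mulr0 ?subr0 ?addr_ge0 ?mulr_ge0// (le_trans h1)// r1_eq0 mulr0.
have [r2_eq0|r2_neq0] := eqVneq r2 0.
  by rewrite /q dotC dot_eq0 ?mulr0 ?subr0 ?addr_ge0 ?mulr_ge0// (le_trans h2)// r2_eq0 mulr0.
have rr : 0 < r1 * r2 by rewrite mulr_gt0// lt_neqAle eq_sym ?r1_neq0 ?r2_neq0.
by rewrite -(pmulr_rge0 _ rr) (le_trans _ le_q)// dot_ge0.
Qed.

Lemma ae_defect : {ae m2, forall p,
  0 <= defect F p /\
  dot (rho F p.1 *: cur F p.2 - rho F p.2 *: cur F p.1)
      (rho F p.1 *: cur F p.2 - rho F p.2 *: cur F p.1) <= rho F p.1 * rho F p.2 * defect F p}.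
Proof.
have h := ae_dot_cur_le F_ge0 F_w.
apply: filterS2 (ae_fst m h) (ae_snd m h) => p h1 h2.
apply: defect_algebra => //; [exact: rho_ge0|exact: rho_ge0|exact: nrg_ge0|exact: nrg_ge0].
Qed.

Lemma measurable_Omega (r : R) : measurable (@Omega R N r).
Proof.
rewrite (_ : Omega r = (fun p : V * V => enorm (p.1 - p.2)) @^-1` `]-oo, r[%classic); last first.
  by apply/seteqP; split => p /=; rewrite in_itv.
rewrite -[X in measurable X]setTI; apply: measurable_enorm => //.
move=> i; under eq_fun do rewrite !mxE.
by apply: measurable_funB; [exact: measurable_coord1|exact: measurable_coord2].
Qed.

(* Cauchy-Schwarz in (v,w) bounds |rho(x) j(y) - rho(y) j(x)|^2 by
   rho(x) rho(y) [defect F (x,y)], and the geometric mean is at most the weighted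
   arithmetic mean of rho(x) rho(y) and kappa phi(|x-y|) [defect F (x,y)]. *)
Lemma commutator_le (delta kappa r : R) : 0 < delta -> 0 <= kappa ->
  (forall r', 0 <= r' -> r' < r -> 1 <= kappa * phi r') ->
  (commutator F r <= ((delta * (\int[m2]_p F p.1 p.2) ^+ 2 +
     kappa / delta * dissipation F phi) / 2)%:E)%E.
Proof.
move=> delta0 kappa0 hphi.
have Ir := L1_rho F_w; have Ij := L1_cur F_w.
have Iq := L1_ker mphi phi_ge0 phi_le (L1_defect F_w).
have Irr := L1_prod Ir Ir.
pose h (p : V * V) := 2^-1 * (delta * (rho F p.1 * rho F p.2)
   + kappa / delta * (phi (enorm (p.1 - p.2)) * defect F p)).
have Ih : L1 m2 h by apply: L1Z; apply: L1D; exact: L1Z.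
have hE : \int[m2]_p h p = (delta * (\int[m2]_p F p.1 p.2) ^+ 2 +
     kappa / delta * dissipation F phi) / 2.
  rewrite /h RintegralZl//; last by apply: L1D; exact: L1Z.
  rewrite RintegralD//; [|exact: L1Z|exact: L1Z].
  by rewrite !RintegralZl// /leb2 (Rint_prod Ir Ir) Rint_rho// expr2 mulrC.
have h_ge0 : {ae m2, forall p, 0 <= h p}.
  apply: filterS ae_defect => p [q0 _]; rewrite /h mulr_ge0// addr_ge0//.
    by rewrite mulr_ge0 ?mulr_ge0 ?rho_ge0// ltW.
  by rewrite mulr_ge0 ?divr_ge0 ?mulr_ge0// ltW.
(* [h] is nonnegative only almost everywhere; passing to [|h|] allows the monotonicity of the
   integral in its domain. *)
rewrite -hE (@ae_eq_Rintegral _ _ _ m2 h (fun p => `|h p|)); last 3 first.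
- exact: L1_measurable Ih.
- exact: L1_measurable (integrable_norm Ih).
- by apply: filterS h_ge0 => p hp; rewrite ger0_norm.
rewrite EFin_Rint; last exact: integrable_norm.
have mabs : measurable_fun setT (fun p => `|h p|%:E).
  by case/integrableP : (integrable_norm Ih).
have mcom : measurable_fun setT (fun p : V * V =>
    (enorm (rho F p.1 *: cur F p.2 - rho F p.2 *: cur F p.1))%:E).
  apply/measurable_EFinP/measurable_enorm => i.
  rewrite (_ : (fun p : V * V => _) = (fun p : V * V =>
    rho F p.1 * cur F p.2 0 i - rho F p.2 * cur F p.1 0 i)); last first.
    by apply/funext => p; rewrite !mxE.
  apply: measurable_funB; apply: measurable_funM.
  - exact: (measurableT_comp (L1_measurable Ir) measurable_fst).
  - exact: (measurableT_comp (L1_measurable (Ij i)) measurable_snd).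
  - exact: (measurableT_comp (L1_measurable Ir) measurable_snd).
  - exact: (measurableT_comp (L1_measurable (Ij i)) measurable_fst).
apply: (@le_trans _ _ (\int[m2]_(p in Omega r) `|h p|%:E)%E); last first.
  by apply: ge0_subset_integral => //; exact: measurable_Omega.
apply: ae_ge0_le_integral => //.
- exact: measurable_Omega.
- by move=> p _; rewrite lee_fin enorm_ge0.
- exact: measurable_funTS.
- exact: measurable_funTS.
apply: filterS2 h_ge0 ae_defect => p hp [q0 hq] Op; rewrite lee_fin ger0_norm//.
have rr : 0 <= rho F p.1 * rho F p.2 by rewrite mulr_ge0 ?rho_ge0.
rewrite -(ler_pM2l (ltr0Sn R 1)) /h mulVKf//.
apply: enorm_le_mean.
- by rewrite mulr_ge0// ltW.
- by rewrite mulr_ge0 ?divr_ge0 ?mulr_ge0// ltW.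
apply: (le_trans hq).
rewrite [leRHS](_ : _ = rho F p.1 * rho F p.2 * defect F p * (kappa * phi (enorm (p.1 - p.2)))); last first.
  by field; rewrite gt_eqF.
by apply: ler_peMr; [rewrite mulr_ge0|exact: hphi (enorm_ge0 _) Op].
Qed.

End commutator_bound.

Lemma Rint_fst_mul d1 d2 (T1 : measurableType d1) (T2 : measurableType d2) (R : realType)
    (m1 : {sigma_finite_measure set T1 -> \bar R})
    (m2 : {sigma_finite_measure set T2 -> \bar R}) (g : T1 -> R) (h : T1 * T2 -> R) :
  measurable_fun setT g -> L1 (m1 \x m2)%E h -> L1 (m1 \x m2)%E (fun p => g p.1 * h p) ->
  \int[(m1 \x m2)%E]_p (g p.1 * h p) = \int[m1]_x (g x * \int[m2]_y h (x, y)).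
Proof.
move=> mg Ih Igh; rewrite (Rint12 Igh); apply: ae_eq_Rintegral.
- exact: L1_measurable (L1_Rint2 Igh).
- by apply: measurable_funM => //; exact: L1_measurable (L1_Rint2 Ih).
- by apply: filterS (ae_L1_1 Ih) => x Ix /=; rewrite RintegralZl.
Qed.

(** * Mass and energy balance at a fixed time *)

Section fixed_time_balance.
Context {R : realType} {N : nat}.
Local Notation V := 'rV[R]_N.
Local Notation m2 := (@leb2 R N).
Local Notation m := (@leb R N).
Variables (F : V -> V -> R) (phi : R -> R) (K eps Psi P_max : R).
Variables (P : V -> V) (G : V * V -> R).
Hypothesis eps_gt0 : 0 < eps.
Hypothesis F_ge0 : forall x v, 0 <= F x v.
Hypothesis C12 : C1x_C2v F.
Hypothesis F_w : wL1 (fun p => F p.1 p.2).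
Hypothesis Fx_w : forall i, wL1 (fun p => pd i (F^~ p.2) p.1).
Hypothesis Fv_w : forall i, wL1 (fun p => pd i (F p.1) p.2).
Hypothesis Fvv_w : forall i, wL1 (fun p => pd i (pd i (F p.1)) p.2).
Hypothesis mphi : measurable_fun setT phi.
Hypothesis phi_ge0 : forall r, 0 <= phi r.
Hypothesis phi_le : forall r, phi r <= K.
Hypothesis mP : forall i, measurable_fun setT (fun x => P x 0 i).
Hypothesis P_bounded : forall x i, `|P x 0 i| <= P_max.
Hypothesis P_le : {ae m, forall x, enorm (P x) <= Psi}.
Hypothesis mG : measurable_fun setT G.
Hypothesis G_eq : {ae m2, forall p,
  eps * G p + eps * dot p.2 (grad (F^~ p.2) p.1) - dot (P p.1) (grad (F p.1) p.2) =
  dvg (fun w => F p.1 w *: w + grad (F p.1) w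
                + (F p.1 w * convol phi (rho F) p.1) *: w
                - F p.1 w *: convolv phi (cur F) p.1) p.2}.

Let al (x : V) : R := 1 + convol phi (rho F) x.
Let C (x : V) : V := convolv phi (cur F) x.
Let B (x : V) : V := P x - C x.
Let K0 : 0 <= K. Proof. exact: le_trans (phi_ge0 0) (phi_le 0). Qed.

Lemma dvg_flux (c : R) (D : V) x v :
  dvg (fun w => F x w *: w + grad (F x) w + (F x w * c) *: w - F x w *: D) v =
  \sum_(i < N) ((1 + c) * (F x v + v 0 i * pd i (F x) v) + pd i (pd i (F x)) v
     - D 0 i * pd i (F x) v).
Proof.
apply: eq_bigr => i _.
have [_ /(_ i)[_ _ gFv _ /(_ i)[gFvv _]]] := C12.
have h := @is_derive_flux R N i v (cst 1) (F x) (pd i (F x)) (- D 0 i) (1 + c) 0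
  _ _ _ (is_derive_cst _ _ _) (derivableP (gFv x i v)) (derivableP (gFvv x i v)).
rewrite [LHS]/pd (_ : (fun y => _) = (fun w => cst 1 w * (- D 0 i * F x w +
  (1 + c) * (w 0 i * F x w) + pd i (F x) w) - 0 * (w 0 i * F x w))); last first.
  by apply/funext => w; rewrite !mxE /=; ring.
by rewrite derive_val /= -/(pd i (F x) v) -/(pd i (pd i (F x)) v); ring.
Qed.

Definition total_mass : R := \int[m2]_p F p.1 p.2.
Definition total_energy : R := \int[m2]_p (dot p.2 p.2 * F p.1 p.2).

Let Ir : L1 m (rho F) := L1_rho F_w.
Let Ij i : L1 m (fun x => cur F x 0 i) := L1_cur F_w i.

Let mal : measurable_fun setT al.
Proof. by apply: measurable_funD => //; exact: measurable_convol. Qed.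

Let mB i : measurable_fun setT (fun x => B x 0 i).
Proof.
under eq_fun do rewrite !mxE.
by apply: measurable_funB => //; exact: measurable_convol.
Qed.

Let convol_rho_bound x : `|convol phi (rho F) x| <= K * total_mass.
Proof.
rewrite (le_trans (convol_bound mphi phi_ge0 phi_le x Ir))// ler_wpM2l//.
rewrite (_ : \int[m]_y _ = \int[m]_y rho F y).
  by rewrite /total_mass -Rint_rho.
by apply: eq_Rintegral => y _; rewrite ger0_norm// rho_ge0.
Qed.

Let al_bound x : `|al x| <= 1 + K * total_mass.
Proof.
by rewrite (le_trans (ler_normD _ _))// normr1 lerD2l.
Qed.

Let Jmax : R := \sum_(i < N) \int[m]_y `|cur F y 0 i|.

Let C_bound x i : `|C x 0 i| <= K * Jmax.
Proof.
rewrite mxE (le_trans (convol_bound mphi phi_ge0 phi_le x (Ij i)))// ler_wpM2l//.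
rewrite /Jmax (bigD1 i)//= lerDl sumr_ge0// => j _.
by apply: Rintegral_ge0.
Qed.

Let Jmax_ge0 : 0 <= Jmax.
Proof. by apply: sumr_ge0 => i _; exact: Rintegral_ge0. Qed.

Let total_mass_ge0 : 0 <= total_mass.
Proof. by apply: Rintegral_ge0 => p _. Qed.

(** A single constant dominating both [al] and [B], as the fixed-time identities expect. *)
Let KB := (1 + K * total_mass) + (`|P_max| + K * Jmax).

Let al_KB x : `|al x| <= KB.
Proof. by rewrite (le_trans (al_bound x))// lerDl addr_ge0// mulr_ge0. Qed.

Let B_KB x i : `|B x 0 i| <= KB.
Proof.
rewrite mxE mxE (le_trans (ler_normB _ _))// /KB.
have h1 := C_bound x i; have h2 := P_bounded x i; have h3 := ler_norm P_max.
have h4 : 0 <= K * total_mass by rewrite mulr_ge0.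
lra.
Qed.

Let Gsum (a b : R) (p : V * V) : R := \sum_(i < N)
  (- transport_part F a b i p + eps^-1 * collision_part F a b al B i p).

(** The equation solved for the time derivative, after division by [eps]. *)
Let quadG (a b : R) : {ae m2, forall p, Gsum a b p = quad a b p.2 * G p}.
Proof.
apply: filterS G_eq => p; rewrite dvg_flux => h.
have -> : G p = - dot p.2 (grad (F^~ p.2) p.1) + eps^-1 * (
    dot (P p.1) (grad (F p.1) p.2) +  \sum_(i < N)
    ((1 + convol phi (rho F) p.1) * (F p.1 p.2 + p.2 0 i * pd i (F p.1) p.2) +
     pd i (pd i (F p.1)) p.2 - convolv phi (cur F) p.1 0 i * pd i (F p.1) p.2)).
  by rewrite -h; field; rewrite gt_eqF.
rewrite /Gsum /dot -big_split /= -sumrN !mulr_sumr -big_split /= mulr_sumr.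
apply: eq_bigr => i _; rewrite /transport_part /collision_part /al /B /C !mxE.
set c := convol _ _ _; set d := convol _ _ _. ring.
Qed.

Let L1_Gsum a b : L1 m2 (Gsum a b).
Proof.
apply: L1_sum => i; apply: L1D; first exact/L1N/L1_transport_part.
apply: L1Z; exact: (L1_collision_part a b F_w Fv_w Fvv_w mal al_KB mB B_KB).
Qed.

(** No decay of the time derivative is assumed: it is inherited from the other terms of the equation
    through [quadG]. *)
Lemma L1_quad_dt a b : L1 m2 (fun p => quad a b p.2 * G p).
Proof.
apply: (ae_eq_L1 _ (quadG a b)) (L1_Gsum a b).
by apply: measurable_funM => //; exact: measurable_quad.
Qed.

Definition work : R := \int[m2]_p (dot (P p.1) p.2 * F p.1 p.2).

Let L1_Pv (i : 'I_N) : L1 m2 (fun p : V * V => P p.1 0 i * p.2 0 i * F p.1 p.2).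
Proof.
apply: (@wL1M _ _ _ (fun p : V * V => P p.1 0 i * p.2 0 i) P_max F_w).
  by apply: measurable_funM; [exact: measurableT_comp (mP i) measurable_fst|exact: measurable_coord2].
by move=> p; rewrite normrM ler_pM// coord_bound.
Qed.

Let workE : work = \sum_(i < N) \int[m2]_p (P p.1 0 i * p.2 0 i * F p.1 p.2).
Proof.
rewrite -Rint_sum//; apply: eq_Rintegral => p _.
by rewrite /dot mulr_suml.
Qed.

Let measurable_C i : measurable_fun setT (fun x => C x 0 i).
Proof. by under eq_fun do rewrite mxE; exact: measurable_convol. Qed.

Let L1_cdot : L1 m2 (fun p => convol phi (rho F) p.1 * (dot p.2 p.2 * F p.1 p.2)).
Proof.
apply: (le_L1 _ _ (L1Z (K * total_mass) (L1_energy_density F_w))).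
  apply: measurable_funM; last exact: L1_measurable (L1_energy_density F_w).
  exact: (measurableT_comp (measurable_convol mphi Ir) measurable_fst).
move=> p; rewrite normrM [X in _ * X]ger0_norm ?mulr_ge0 ?dot_ge0//.
rewrite ler_wpM2r ?mulr_ge0 ?dot_ge0//; exact: convol_rho_bound.
Qed.

Let L1_Cv (i : 'I_N) : L1 m2 (fun p : V * V => C p.1 0 i * (p.2 0 i * F p.1 p.2)).
Proof.
have I1 := L1_momentum_density F_w i.
apply: (le_L1 _ _ (L1Z (K * Jmax) (integrable_norm I1))).
  apply: measurable_funM; last exact: L1_measurable I1.
  exact: measurableT_comp (measurable_C i) measurable_fst.
by move=> p; rewrite normrM ler_wpM2r.
Qed.

(** For [b = 0] this is conservation of mass, for [a = 0] and [b = 1] the balance of energy. The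
    terms coming from [convol] and [convolv] recombine into half of the dissipation by
    [dissipationE]; the force leaves its work. *)
Lemma balance a b : eps * \int[m2]_p (quad a b p.2 * G p) =
  2 * b * (N%:R * total_mass - total_energy - dissipation F phi / 2 - work).
Proof.
have Id i := L1_drift_part F_w mal al_KB mB B_KB i.
have Icol i := L1_collision_part a b F_w Fv_w Fvv_w mal al_KB mB B_KB i.
have Itr i := L1_transport_part a b Fx_w i.
rewrite -(ae_eq_Rintegral _ _ (quadG a b)); last 2 first.
- exact: L1_measurable (L1_Gsum a b).
- exact: L1_measurable (L1_quad_dt a b).
rewrite /Gsum Rint_sum; last first.
  by move=> i; apply: L1D; [exact: L1N|exact: L1Z].
rewrite mulr_sumr (eq_bigr (fun i : 'I_N => 2 * b * (total_mass -
    \int[m2]_p drift_part F al B i p))); last first.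
  move=> i _; rewrite RintegralD//; [|exact: L1N|exact: L1Z].
  rewrite RintegralZl//.
  rewrite (integral_collision_part a b C12 F_w Fv_w Fvv_w mal al_KB mB B_KB i).
  rewrite (_ : \int[m2]_x (- transport_part F a b i x) = 0).
    by rewrite add0r mulrA divff ?gt_eqF// mul1r.
  transitivity (\int[m2]_p (- 1 * transport_part F a b i p)).
    by apply: eq_Rintegral => p _; rewrite mulN1r.
  by rewrite RintegralZl// (integral_transport_part a b C12 F_w Fx_w) mulr0.
rewrite -mulr_sumr; congr (_ * _).
rewrite sumrB sumr_const card_ord -[total_mass *+ N]mulr_natl -!addrA; congr (_ + _).
rewrite -!opprD; congr (- _).
have Ic := L1_cdot; have ICv := L1_Cv.
rewrite -Rint_sum//.
transitivity (\int[m2]_p (dot p.2 p.2 * F p.1 p.2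
   + (convol phi (rho F) p.1 * (dot p.2 p.2 * F p.1 p.2)
   - \sum_(i < N) C p.1 0 i * (p.2 0 i * F p.1 p.2))
   + \sum_(i < N) P p.1 0 i * p.2 0 i * F p.1 p.2)).
  apply: eq_Rintegral => p _; rewrite /dot !mulr_suml mulr_sumr -sumrN -!big_split /=.
  by apply: eq_bigr => i _; rewrite /drift_part /al /B !mxE; ring.
have IE := L1_energy_density F_w.
rewrite RintegralD//; [|by apply: L1D => //; apply: L1B => //; exact: L1_sum|exact: L1_sum].
rewrite RintegralD//; last by apply: L1B => //; exact: L1_sum.
rewrite RintegralB//; last exact: L1_sum.
rewrite (Rint_sum _ L1_Pv) -workE (Rint_sum _ ICv).
have -> : dissipation F phi / 2 =
    \int[m2]_p (convol phi (rho F) p.1 * (dot p.2 p.2 * F p.1 p.2)) -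
    \sum_(i < N) \int[m2]_p (C p.1 0 i * (p.2 0 i * F p.1 p.2)).
  rewrite (dissipationE F_w mphi phi_ge0 phi_le) mulrC mulrA mulVf// mul1r; congr (_ - _).
    rewrite [RHS](Rint_fst_mul _ IE Ic)//; exact: measurable_convol.
  apply: eq_bigr => i _.
  apply/esym; apply: (etrans (Rint_fst_mul (measurable_C i) (L1_momentum_density F_w i) (ICv i))).
  by apply: eq_Rintegral => x _; rewrite [cur F x 0 i]mxE.
rewrite /total_energy; ring.
Qed.

(** Young's inequality with energy coefficient 1, so that the friction term 2 [total_energy] of the
    balance absorbs it. *)
Lemma work_le : 2 * `|work| <= total_energy + Psi ^+ 2 * total_mass.
Proof.
have Iw : L1 m2 (fun p => dot (P p.1) p.2 * F p.1 p.2).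
  have := L1_sum (index_enum 'I_N) L1_Pv.
  by apply: eq_integrable => // p _ /=; rewrite /dot mulr_suml.
have h := le_normr_Rintegral measurableT Iw.
rewrite (le_trans (ler_wpM2l _ h))//.
have IE := L1_energy_density F_w; have I0 := L1_density F_w.
rewrite /total_energy /total_mass -!RintegralZl//; last exact: integrable_norm.
rewrite -RintegralD//; last exact: L1Z.
apply: ae_le_Rint.
- by apply: L1Z; exact: integrable_norm.
- by apply: L1D => //; exact: L1Z.
apply: filterS (ae_fst _ P_le) => p hp.
rewrite normrM (ger0_norm (F_ge0 _ _)) mulrA -mulrDl ler_wpM2r//.
rewrite (le_trans (dot_le_sqr _ _))// addrC lerD2l -sqr_enorm.
by rewrite ler_pXn2r ?nnegrE ?enorm_ge0// (le_trans (enorm_ge0 _) hp).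
Qed.

(** [|F|] is repeated in every summand so that each direction, and the sum of all current
    components, is controlled; the leading [|F|] controls the mass in every dimension, 0
    included. *)
Definition phase_size_at (p : V * V) : R := `|F p.1 p.2| + \sum_(i < N)
  (`|F p.1 p.2| + `|pd i (F^~ p.2) p.1| + `|pd i (F p.1) p.2| + `|pd i (pd i (F p.1)) p.2|).

Definition phase_size : R := \int[m2]_p (weight p * phase_size_at p).

Lemma L1_phase_size : L1 m2 (fun p => weight p * phase_size_at p).
Proof.
have [_ I0] := F_w.
have h := L1D I0 (L1_sum (index_enum 'I_N)
  (fun i => L1D (L1D (L1D I0 (Fx_w i).2) (Fv_w i).2) (Fvv_w i).2)).
apply: eq_integrable h => // p _ /=; congr EFin.
by rewrite /phase_size_at mulrDr mulr_sumr; congr (_ + _); apply: eq_bigr => i _; rewrite !mulrDr.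
Qed.

Let weight_ge0 (p : V * V) : 0 <= weight p.
Proof. exact: le_trans ler01 (weight_ge1 p). Qed.

Let phase_size_ge0 : 0 <= phase_size.
Proof.
by apply: Rintegral_ge0 => p _; rewrite mulr_ge0// addr_ge0// sumr_ge0// => i _.
Qed.

Let size_part_le i p :
  `|F p.1 p.2| + `|pd i (F^~ p.2) p.1| + `|pd i (F p.1) p.2| + `|pd i (pd i (F p.1)) p.2|
  <= phase_size_at p.
Proof.
by rewrite /phase_size_at (bigD1 i)//= addrCA lerDl addr_ge0// sumr_ge0// => j _.
Qed.

Let total_mass_le : total_mass <= phase_size.
Proof.
apply: le_Rintegral => //; [exact: L1_density|exact: L1_phase_size|].
move=> p _; rewrite -[leLHS]mul1r ler_pM// ?weight_ge1//.
by rewrite (le_trans (ler_norm _))// /phase_size_at lerDl sumr_ge0// => i _.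
Qed.

Let Jmax_le : Jmax <= phase_size.
Proof.
have I0 i := integrable_norm (L1_momentum_density F_w i).
have step i : \int[m]_y `|cur F y 0 i| <= \int[m2]_p `|p.2 0 i * F p.1 p.2|.
  rewrite /leb2 (Rint12 (I0 i)); apply: ae_le_Rint.
  - exact: integrable_norm (Ij i).
  - exact: L1_Rint2 (I0 i).
  - apply: filterS (ae_L1_1 (L1_momentum_density F_w i)) => x Ix.
    by rewrite mxE; exact: le_normr_Rintegral.
apply: (le_trans (ler_sum _ (fun i _ => step i))); rewrite -Rint_sum//.
apply: le_Rintegral => //; [exact: L1_sum|exact: L1_phase_size|].
move=> p _; rewrite /phase_size_at mulrDr -[leLHS]add0r lerD//; first by apply: mulr_ge0.
rewrite mulr_sumr ler_sum// => i _; rewrite normrM ler_pM//; first exact: coord_bound.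
by rewrite -!addrA lerDl !addr_ge0.
Qed.

(** The coefficients [al] and [B] contain moments of [F] and multiply [F], so the bound is quadratic
    in [phase_size]; integrating it in time uses the square integrability of the decay hypotheses.
    The constant depends on [eps], which is harmless because only finiteness is drawn from it. *)
Lemma quad_dt_bound a b : 0 <= Psi -> \int[m2]_p `|quad a b p.2 * G p| <=
  N%:R * ((`|a| + `|b|) * (1 + eps^-1)) *
  (Psi ^+ 2 + 1 + (2 + 2 * K) * phase_size ^+ 2).
Proof.
(* [X] dominates both |al| and |B|, with the sup bound on the force replaced by its almost
   everywhere bound [Psi]. *)
move=> Psi0; pose c0 : R := `|a| + `|b|; rewrite -/c0; set X := Psi + 1 + K * Jmax + K * total_mass.
have c00 : 0 <= c0 by rewrite addr_ge0.
have eV : 0 < eps^-1 by rewrite invr_gt0.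
have X1 : 1 <= X.
  by have := mulr_ge0 K0 Jmax_ge0; have := mulr_ge0 K0 total_mass_ge0; rewrite /X; lra.
apply: (@le_trans _ _ (\int[m2]_p (N%:R * (c0 * (1 + eps^-1)) * X *
  (weight p * phase_size_at p)))).
  apply: ae_le_Rint; [exact: integrable_norm (L1_quad_dt a b)|exact/L1Z/L1_phase_size|].
  apply: filterS2 (ae_fst _ P_le) (quadG a b) => p hP <-.
  apply: (@le_trans _ _ (\sum_(i < N) c0 * (1 + eps^-1) * X * (weight p * phase_size_at p))); last first.
    by rewrite sumr_const card_ord -[leLHS]mulr_natl !mulrA.
  apply: (le_trans (ler_norm_sum _ _ _)); apply: ler_sum => i _.
  rewrite (le_trans (ler_normD _ _))// normrN (normrM eps^-1) (gtr0_norm eV).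
  have hs := size_part_le i p.
  have w1 := weight_ge0 p.
  have hW : `|quad a b p.2| <= c0 * weight p by exact: quad_bound3.
  have hWv : `|quad a b p.2 * p.2 0 i| <= c0 * weight p by exact: quad_coord_bound.
  set f := `|F p.1 p.2| in hs; set dx := `|pd i (F^~ p.2) p.1| in hs.
  set d := `|pd i (F p.1) p.2| in hs; set dd := `|pd i (pd i (F p.1)) p.2| in hs.
  have [f0 dx0 d0 dd0] : [/\ 0 <= f, 0 <= dx, 0 <= d & 0 <= dd] by split; exact: normr_ge0.
  set sz := phase_size_at p in hs *; have KM0 : 0 <= K * total_mass by rewrite mulr_ge0.
  have KJ0 : 0 <= K * Jmax by rewrite mulr_ge0.
  have X0 : 0 <= X by lra.
  have cw0 : 0 <= c0 * weight p by rewrite mulr_ge0.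
  have hT : `|transport_part F a b i p| <= c0 * weight p * (X * sz).
    rewrite normrM ler_pM// -/dx (@le_trans _ _ sz)//; first lra.
    by rewrite ler_peMl//; lra.
  have hC : `|collision_part F a b al B i p| <= c0 * weight p * (X * sz).
    have hB : `|B p.1 0 i| <= Psi + K * Jmax.
      rewrite mxE mxE (le_trans (ler_normB _ _))// lerD// ?C_bound//.
      by rewrite (le_trans (coord_le_enorm _ _)).
    have hal := al_bound p.1.
    rewrite (_ : collision_part _ _ _ _ _ _ _ = quad a b p.2 * (B p.1 0 i * pd i (F p.1) p.2)
      + quad a b p.2 * (al p.1 * F p.1 p.2) + quad a b p.2 * p.2 0 i * (al p.1 * pd i (F p.1) p.2)
      + quad a b p.2 * pd i (pd i (F p.1)) p.2); last by rewrite /collision_part; ring.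
    apply: (@le_trans _ _ (c0 * weight p * ((Psi + K * Jmax) * d) + c0 * weight p * ((1 + K * total_mass) * f)
      + c0 * weight p * ((1 + K * total_mass) * d) + c0 * weight p * dd)).
      rewrite (le_trans (ler_normD _ _))// lerD//; last by rewrite normrM ler_pM.
      rewrite (le_trans (ler_normD _ _))// lerD//; last first.
        by rewrite normrM ler_pM// normrM ler_pM.
      rewrite (le_trans (ler_normD _ _))// lerD//;
        by rewrite normrM ler_pM// normrM ler_pM.
    rewrite -!mulrDr ler_wpM2l//.
    have e1 : (1 + K * total_mass) * f <= X * f by rewrite ler_wpM2r// /X; lra.
    have e2 : 1 * dd <= X * dd by rewrite ler_wpM2r.
    have e3 := ler_wpM2l X0 hs; have e4 : 0 <= X * dx by rewrite mulr_ge0.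
    have e5 : X * d = (Psi + 1 + K * Jmax + K * total_mass) * d by [].
    lra.
  have hC' := ler_wpM2l (ltW eV) hC; lra.
rewrite RintegralZl//; last exact: L1_phase_size.
rewrite -/phase_size -!mulrA ler_wpM2l// ler_wpM2l// ler_wpM2l//; first by rewrite addr_ge0// ltW.
set A := phase_size.
have h1 : K * Jmax <= K * A by rewrite ler_wpM2l.
have h2 : K * total_mass <= K * A by rewrite ler_wpM2l.
have h3 : X * A <= (Psi + 1 + K * A + K * A) * A.
  by rewrite ler_wpM2r// /X; lra.
have h4 := sqr_ge0 (Psi - A); have h5 := sqr_ge0 (1 - A).
have h6 := sqr_ge0 Psi; have h7 := sqr_ge0 A.
rewrite !expr2 in h4 h5 h6 h7 *; lra.
Qed.

End fixed_time_balance.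

(** * Measurability of the time derivative *)

Section time_derivative.
Context {R : realType} {d : measure_display} {X : measurableType d}.
Variables (nu : {sigma_finite_measure set X -> \bar R}) (T : R) (f : R -> X -> R).
Local Notation mu := (@lebesgue_measure R).
Local Notation RX := (measurableTypeR R * X)%type.
Hypothesis mf : measurable_fun (`]0, T[ `*` setT) (fun q : RX => f q.1 q.2).
Hypothesis f_AC : forall x t, t \in `[0, T[ ->
  [/\ {ae mu, forall s, s \in `]0, t[ -> derivable (fun r => f r x) s 1},
      mu.-integrable `[0, t] (fun s => (derive1 (fun r => f r x) s)%:E) &
      f t x = f 0 x + (\int[mu]_(s in `[0%R, t]) derive1 (fun r => f r x) s)%R].

Let D : set RX := `]0, T[ `*` setT.

Let mD : measurable D.
Proof. by apply: measurableX => //; exact: measurable_itv. Qed.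

(** Measurability of [f] is known only for times in ]0, T[; the extension by 0 is measurable
    everywhere and its translates in time are too. *)
Definition cutoff (q : RX) : R := if (0 < q.1) && (q.1 < T) then f q.1 q.2 else 0.

Lemma measurable_cutoff : measurable_fun setT cutoff.
Proof.
have /(measurable_restrictT _ mD) := mf; congr measurable_fun.
apply/funext => q; rewrite patchE /cutoff; case: ifPn => [|h].
  by rewrite inE => -[/=]; rewrite in_itv/= => ->.
case: ifPn => // qT; exfalso; move/negP: h; apply; by rewrite inE; split.
Qed.

Definition quotient (h : R) (q : RX) : R := h^-1 * (cutoff (h + q.1, q.2) - cutoff q).

Lemma measurable_quotient h : measurable_fun setT (quotient h).
Proof.
apply: measurable_funM => //; apply: measurable_funB; last exact: measurable_cutoff.
apply: (measurableT_comp measurable_cutoff); apply: measurable_fun_pair; last exact: measurable_snd.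
by apply: measurable_funD => //; exact: measurable_fst.
Qed.

Lemma continuous_in_time x t : t \in `]0, T[ -> {for t, continuous (f ^~ x)}.
Proof.
(* The derivative is integrable on [0, b] only for b < T, so a time strictly between t and T is
   chosen. *)
rewrite in_itv/= => /andP[t0 tT]; pose b := (t + T) / 2.
have bT : b \in `[0, T[ by rewrite in_itv/= /b; apply/andP; split; lra.
have b0 : 0 < b by rewrite /b; lra.
have [_ id _] := f_AC x bT.
have /(continuous_within_itvP _ b0)[c _ _] := parameterized_integral_continuous (ltW b0) id.
have tb : t \in `]0, b[ by rewrite in_itv/= t0 /b; lra.
have ct : {for t, continuous (fun t : R => f 0 x + \int[mu]_(s in `[0, t]) derive1 (f ^~ x) s : R)}.
  by apply: cvgD; [exact: cvg_cst|exact: c].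
move: ct; rewrite /prop_for /continuous_at.
have <- : f t x = f 0 x + \int[mu]_(s in `[0, t]) derive1 (f ^~ x) s.
  by have [] := @f_AC x t _; rewrite // in_itv/= tT ltW.
apply: cvg_trans; apply: near_eq_cvg; near=> s.
have sb : s \in `]0, b[ by near: s; exact: near_in_itvoo.
have [] := @f_AC x s _; last by move=> _ _ <-.
move: sb; rewrite !in_itv/= => /andP[s0 sb]; rewrite ltW//=.
by rewrite (lt_trans sb)// /b; lra.
Unshelve. all: by end_near. Qed.

(** Used to carry measurability in (x,v) down to the initial time, which is outside ]0, T[. *)
Lemma continuous_at0 x (u : R^nat) : 0 < T -> (forall n, 0 < u n) -> u n @[n --> \oo] --> (0 : R) ->
  f (u n) x @[n --> \oo] --> f 0 x.
Proof.
move=> T0 u0 ucvg; pose b := T / 2.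
have bT : b \in `[0, T[ by rewrite in_itv/= /b; apply/andP; split; lra.
have b0 : 0 < b by rewrite /b; lra.
have [_ id _] := f_AC x bT.
have /(continuous_within_itvP _ b0)[_ c _] := parameterized_integral_continuous (ltW b0) id.
have f0 : f 0 x = f 0 x + \int[mu]_(s in `[0, 0]) derive1 (f ^~ x) s.
  by rewrite set_itv1 Rintegral_set1 addr0.
rewrite [X in _ --> X]f0.
have h : f 0 x + \int[mu]_(s in `[0, t]) derive1 (f ^~ x) s @[t --> 0^'+] -->
    f 0 x + \int[mu]_(s in `[0, 0]) derive1 (f ^~ x) s.
  by apply: cvgD; [exact: cvg_cst|exact: c].
have hu : (f 0 x + \int[mu]_(s in `[0, u n]) derive1 (f ^~ x) s) @[n --> \oo] -->
    f 0 x + \int[mu]_(s in `[0, 0]) derive1 (f ^~ x) s.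
  have /cvg_at_rightP := h; apply; split => //.
move: hu; apply: cvg_trans; apply: near_eq_cvg.
have /cvgrPdist_lt /(_ _ T0) := ucvg; apply: filterS => n.
rewrite sub0r normrN gtr0_norm// => uT.
by have [] := @f_AC x (u n) _; [rewrite in_itv/= uT ltW|move=> _ _ <-].
Qed.

Let near_cutoff x t : t \in `]0, T[ ->
  \forall s \near t, cutoff (s, x) = f s x.
Proof.
by move=> /near_in_itvoo; apply: filterS => s; rewrite in_itv/= /cutoff /= => ->.
Qed.

Lemma quotient_near x t : t \in `]0, T[ ->
  \forall h \near (0 : R)^', quotient h (t, x) = h^-1 *: (((f ^~ x) \o shift t) (h *: (1 : R)) - f t x).
Proof.
move=> tT.
have : \forall h \near (0 : R), cutoff (h + t, x) = f (h + t) x.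
  have : (h + t) @[h --> (0 : R)] --> 0 + t by apply: cvgD; [exact: cvg_id|exact: cvg_cst].
  by rewrite add0r => /(_ _ (near_cutoff x tT)).
move=> hh; apply: (@cvg_within _ (nbhs 0)); move: hh; apply: filterS => h /= hh.
rewrite /quotient /= hh /cutoff /=; move: tT; rewrite in_itv/= => ->.
by rewrite [h%:A]mulr1.
Qed.

Lemma derivable_quotientP x t : t \in `]0, T[ ->
  derivable (f ^~ x) t 1 <-> cvg (quotient h (t, x) @[h --> 0^']).
Proof.
move=> tT; rewrite /derivable; split => /cvg_ex[l hl]; apply/cvg_ex; exists l; move: hl; apply: cvg_trans;
  apply: near_eq_cvg; near=> h; [|symmetry]; near: h; have := quotient_near x tT; apply: filterS => h -> //.
Unshelve. all: by end_near. Qed.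

Lemma derive1_quotient x t : t \in `]0, T[ -> derivable (f ^~ x) t 1 ->
  quotient h (t, x) @[h --> 0^'] --> derive1 (f ^~ x) t.
Proof.
move=> tT df; rewrite derive1E.
have : h^-1 *: (((f ^~ x) \o shift t) (h *: (1 : R)) - f t x) @[h --> 0^'] --> 'D_1 (f ^~ x) t by exact: df.
apply: cvg_trans; apply: near_eq_cvg; have := quotient_near x tT; apply: filterS => h -> //.
Qed.

(** The conditions on [h] are premises: for a fixed rational [h] the set is either the whole space
    or a sublevel set of a measurable function. *)
Let near_quotient (k m : nat) (h0 h : rat) : set RX :=
  [set q | h != 0 -> `|ratr h| < m.+1%:R^-1 :> R ->
           `|quotient (ratr h) q - quotient (ratr h0) q| <= k.+1%:R^-1].

(* The (t, x) at which the difference quotients with rational increments are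
   Cauchy: since [f] is continuous in time these are the points of
   differentiability, and only countable operations are involved. *)
Let regular : set RX := D `&`
  \bigcap_k \bigcup_h0 \bigcup_m ~` \bigcup_h ~` near_quotient k m h0 h.

Let measurable_regular : measurable regular.
Proof.
apply: measurableI => //; apply: bigcapT_measurable => k.
apply: bigcupT_measurable_rat => h0; apply: bigcupT_measurable => m.
apply: measurableC; apply: bigcupT_measurable_rat => h; apply: measurableC.
case: (boolP ((h != 0) && (`|ratr h| < m.+1%:R^-1 :> R))) => [/andP[hn0 hm]|hn].
  rewrite (_ : near_quotient k m h0 h =
    (fun q => `|quotient (ratr h) q - quotient (ratr h0) q|) @^-1` `]-oo, k.+1%:R^-1]%classic); last first.
    by apply/seteqP; split => q /=; rewrite in_itv/=; [apply|move=> ? _ _].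
  rewrite -[X in measurable X]setTI.
  have : measurable_fun setT (fun q => `|quotient (ratr h) q - quotient (ratr h0) q|).
    apply: measurableT_comp => //.
    by apply: measurable_funB; exact: measurable_quotient.
  by apply => //; exact: measurable_itv.
rewrite (_ : near_quotient k m h0 h = setT); first exact: measurableT.
by apply/seteqP; split => // q _ /= hn0 hm; move: hn; rewrite hn0 hm.
Qed.

Let regularP (t : R) x : regular (t, x) <->
  (t \in `]0, T[) /\ forall k : nat, exists h0 : rat, exists m : nat, forall h : rat, near_quotient k m h0 h (t, x).
Proof.
split=> [[[/= tT _] H]|[tT H]]; split => //.
  move=> k; have [h0 _ [m _ hm]] := H k I; exists h0, m => h.
  by apply: contrapT => nh; apply: hm; exists h.
by move=> k _; have [h0 [m hm]] := H k; exists h0 => //; exists m => // -[h _]; apply; exact: hm.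
Qed.

Let derivable_regular (t : R) x : t \in `]0, T[ -> derivable (f ^~ x) t 1 -> regular (t, x).
Proof.
move=> tT df; apply/regularP; split => // k.
have /cvgrPdist_le /(_ (k.+1%:R^-1 / 2)) := derive1_quotient tT df.
have k0 : 0 < k.+1%:R^-1 / 2 :> R by rewrite divr_gt0.
move=> /(_ k0) [e /= e0 he].
have [m me] : exists m : nat, m.+1%:R^-1 < e :> R.
  by have [m _ hm] := near_infty_natSinv_lt (PosNum e0); exists m; exact: (hm m (leqnn m)).
have hq (h : rat) : h != 0 -> `|ratr h| < m.+1%:R^-1 :> R ->
   `|derive1 (f ^~ x) t - quotient (ratr h) (t, x)| <= k.+1%:R^-1 / 2.
  move=> hn0 hm; apply: he; first by rewrite /= sub0r normrN (lt_trans hm).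
  by rewrite /= fmorph_eq0.
(* A nonzero rational increment strictly below 1/(m+1). *)
pose h0 : rat := m.+2%:R^-1; have h0E : ratr h0 = m.+2%:R^-1 :> R by rewrite fmorphV /= ratr_nat.
exists h0, m => h hn0 hm; have h1 := hq _ hn0 hm.
have h2 : `|derive1 (f ^~ x) t - quotient (ratr h0) (t, x)| <= k.+1%:R^-1 / 2.
  apply: hq; first by rewrite invr_eq0 pnatr_eq0.
  by rewrite h0E ger0_norm// ltf_pV2 ?posrE// ltr_nat.
rewrite (_ : _ - _ = (derive1 (f ^~ x) t - quotient (ratr h0) (t, x)) - (derive1 (f ^~ x) t - quotient (ratr h) (t, x))); last by ring.
by rewrite (le_trans (ler_normB _ _))// (le_trans (lerD h2 h1))// -splitr.
Qed.

(** The Cauchy condition must pass from rational to real increments. The quotient is continuous in h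
    away from 0, so a strict violation at a real h persists on a neighbourhood of h, which contains
    a rational. *)
Let regular_derivable (t : R) x : regular (t, x) -> derivable (f ^~ x) t 1.
Proof.
move=> /regularP[tT H]; apply/(derivable_quotientP x tT).
apply/cauchy_cvgP; apply: cauchy_exP => e e0.
have [k ke] : exists k : nat, k.+1%:R^-1 < e :> R.
  by have [k _ hk] := near_infty_natSinv_lt (PosNum e0); exists k; exact: (hk k (leqnn k)).
have [h0 [m hm]] := H k; exists (quotient (ratr h0) (t, x)).
have m0 : 0 < m.+1%:R^-1 :> R by rewrite invr_gt0.
have tT' : t \in `]0, T[ by [].
rewrite in_itv/= in tT; case/andP: tT => t0 tT.
suff : \forall h \near (0 : R)^', ball (quotient (ratr h0) (t, x)) e (quotient h (t, x)) by [].
near=> h; rewrite /ball /= ltNge; apply/negP => far.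
have hn0 : h != 0 by near: h; exact: nbhs_dnbhs_neq.
have hm' : `|h| < m.+1%:R^-1 by near: h; exact: dnbhs0_lt.
have ht : h + t \in `]0, T[.
  have /andP[h1 h2] : (`|h| < t) && (`|h| < T - t).
    by apply/andP; split; near: h; apply: dnbhs0_lt; rewrite ?subr_gt0.
  move: h1 h2; rewrite !ltr_norml in_itv/= => /andP[? ?] /andP[? ?].
  by apply/andP; split; lra.
have cq : (fun h => quotient h (t, x)) s @[s --> h] --> quotient h (t, x).
  rewrite /quotient; apply: cvgM; first exact: cvgV.
  apply: cvgB; last exact: cvg_cst.
  have -> : cutoff (h + t, x) = f (h + t) x.
    by rewrite /cutoff /=; move: ht; rewrite in_itv/= => ->.
  have cf : {for (h + t), continuous (f ^~ x)} by apply: continuous_in_time.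
  have ch : s + t @[s --> h] --> h + t by apply: cvgD; [exact: cvg_id|exact: cvg_cst].
  have : f (s + t) x @[s --> h] --> f (h + t) x by apply: (cvg_comp _ _ ch cf).
  apply: cvg_trans; apply: near_eq_cvg.
  change (\forall s \near h, f (s + t) x = cutoff (s + t, x)).
  have hc : \forall s \near h, cutoff (s + t, x) = f (s + t) x := ch _ (near_cutoff x ht).
  by apply: filterS hc => s ->.
have : \forall s \near h, [/\ s != 0, `|s| < m.+1%:R^-1 &
   k.+1%:R^-1 < `|quotient s (t, x) - quotient (ratr h0) (t, x)|].
  near=> s; split.
  - by near: s; apply: (@open_nbhs_nbhs _ h); split => //; exact: open_neq.
  - near: s; have : `|s| @[s --> h] --> `|h| by apply: cvg_norm; exact: cvg_id.
    by move=> /cvgr_lt; apply.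
  - near: s.
    have : `|quotient s (t, x) - quotient (ratr h0) (t, x)| @[s --> h] -->
       `|quotient h (t, x) - quotient (ratr h0) (t, x)|.
      by apply: cvg_norm; apply: cvgB => //; exact: cvg_cst.
    by move=> /cvgr_gt; apply; rewrite (lt_le_trans ke)// distrC.
move=> [r /= r0 hr].
have [q _ [qh [a qa]]] : exists2 q : R, True & [set` `]h - r, h + r[] q /\ exists s : rat, q = ratr s.
  have := @dense_rat R (`]h - r, h + r[%classic); case.
  - by exists h => /=; rewrite in_itv/=; apply/andP; split; lra.
  - exact: interval_open.
  - by move=> q [/= hq [s _ sq]]; exists q => //; split => //; exists s.
move: qh; rewrite /= in_itv/= => /andP[hq1 hq2]; rewrite {q}qa in hq1 hq2.
have [|a0 am af] := hr (ratr a).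
  by rewrite /ball /= ltr_norml; apply/andP; split; lra.
rewrite fmorph_eq0 in a0.
by move: af; rewrite ltNge (hm a a0 am).
Unshelve. all: by end_near. Qed.

(** Absolute continuity is available on compact subintervals of [0, T[; the open interval is
    exhausted by the times T - 1/(n+1). *)
Let ae_derivable x : {ae mu, forall t, t \in `]0, T[ -> derivable (f ^~ x) t 1}.
Proof.
have h (n : nat) : {ae mu, forall t, t \in `]0, T - n.+1%:R^-1[ -> derivable (f ^~ x) t 1}.
  have [T0|T0] := ltP 0 (T - n.+1%:R^-1).
    have [] // := @f_AC x (T - n.+1%:R^-1) _.
    by rewrite in_itv/= ltW//= ltrBlDr ltrDl invr_gt0.
  by apply: aeW => t; rewrite in_itv/= => /andP[t0 tT]; move: (lt_trans t0 tT); rewrite ltNge T0.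
have := ae_foralln h; apply: filterS => t ht.
rewrite in_itv/= => /andP[t0 tT].
have tT' : 0 < T - t by rewrite subr_gt0.
have [n _ hn] := near_infty_natSinv_lt (PosNum tT').
by apply: (ht n); rewrite in_itv/= t0 ltrBrDr addrC -ltrBrDr; exact: hn (leqnn n).
Qed.

(* A jointly measurable version of [derive1], which itself is arbitrary where
   [f] is not differentiable. *)
Definition time_derivative (q : RX) : R :=
  fine (limn_esup (fun n => (quotient n.+1%:R^-1 q)%:E)).

Lemma measurable_time_derivative : measurable_fun setT time_derivative.
Proof.
apply: measurableT_comp; first exact: fine_measurable.
apply: (@measurable_fun_limn_esup _ _ _ _ (fun n q => (quotient n.+1%:R^-1 q)%:E)) => n.
by apply: measurableT_comp; [exact: EFin_measurable|exact: measurable_quotient].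
Qed.

Lemma derivable_time_derivative (t : R) x : t \in `]0, T[ -> derivable (f ^~ x) t 1 ->
  derive1 (f ^~ x) t = time_derivative (t, x).
Proof.
move=> tT df; rewrite /time_derivative.
have h : quotient n.+1%:R^-1 (t, x) @[n --> \oo] --> derive1 (f ^~ x) t.
  have /cvgr_dnbhsP := derive1_quotient tT df; apply.
  split; first by move=> n; rewrite gt_eqF// invr_gt0.
  exact: cvg_harmonic.
have h' : (quotient n.+1%:R^-1 (t, x))%:E @[n --> \oo] --> (derive1 (f ^~ x) t)%:E.
  by apply: cvg_EFin => //; exact: nearW.
by rewrite (cvg_limn_einf_sup h').
Qed.

Lemma ae_time_derivative x :
  {ae mu, forall t : R, t \in `]0, T[ -> derive1 (f ^~ x) t = time_derivative (t, x)}.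
Proof.
apply: (negligibleS _ (ae_derivable x)) => t /=; apply: contra_not => h tT.
by apply: derivable_time_derivative => //; exact: h.
Qed.

(** For each x the exceptional times are null. To conclude in the product, the exceptional set has
    to be measurable; this is what [regular] achieves, and Tonelli's theorem then applies to its
    complement in [D]. *)
Lemma ae_prod_time_derivative : {ae (mu \x nu)%E, forall q : RX, q.1 \in `]0, T[ ->
  derive1 (f ^~ q.2) q.1 = time_derivative q}.
Proof.
pose A : set RX := D `\` regular.
have mA : measurable A by exact: measurableD.
exists A; split => //.
  have := indic_fubini_tonelli mu nu mA.
  rewrite (_ : fubini_F nu _ = nu \o xsection A); last exact: indic_fubini_tonelli_FE.
  rewrite (_ : fubini_G mu _ = mu \o ysection A); last exact: indic_fubini_tonelli_GE.
  move=> e.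
  apply: (etrans e); apply: integral0_eq => x _ /=.
  apply/negligibleP; first exact: measurable_ysection.
  apply: negligibleS (ae_derivable x) => t; rewrite /ysection /= inE => -[[/= tT _] nr] h.
  by apply: nr; apply: derivable_regular => //; exact: h.
move=> [t x] /= ne; split.
  by split => //; apply: contrapT => nt; apply: ne.
move=> /regular_derivable df; apply: ne => tT.
exact: derivable_time_derivative.
Qed.

End time_derivative.

(** * Measurability, lower integrals and the kernel *)

Section continuous_measurable_rV.
Context {R : realType} {n : nat}.
Local Notation V := 'rV[R]_n.

Let box (c : 'rV[rat]_n * nat) : set V :=
  [set v | forall i, `]ratr (c.1 0 i) - c.2.+1%:R^-1, ratr (c.1 0 i) + c.2.+1%:R^-1[%classic (v 0 i)].

Let measurable_rat_box c : measurable (box c).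
Proof.
apply: (@measurable_box R n (fun i =>
  `]ratr (c.1 0 i) - c.2.+1%:R^-1, ratr (c.1 0 i) + c.2.+1%:R^-1[%classic)).
by move=> i; exact: measurable_itv.
Qed.

(** An open set is the union of the rational boxes that it contains, and boxes are measurable for
    the sigma-algebra generated by the coordinates. *)
Lemma open_measurable_rV (U : set V) : open U -> measurable U.
Proof.
move=> oU; rewrite (_ : U = \bigcup_c (if `[< box c `<=` U >] then box c else set0)).
  apply: countable_bigcupT_measurable; first exact: countableP.
  by move=> c; case: asboolP => _; [exact: measurable_rat_box|exact: measurable0].
apply/seteqP; split => [v Uv|v [c _]]; last by case: asboolP => // + h; exact.
move: oU; rewrite openE => /(_ _ Uv); rewrite /interior => /nbhs_ballP[e /= e0 he].
have e20 : 0 < e / 2 by rewrite divr_gt0.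
have [k _ hk] := near_infty_natSinv_lt (PosNum e20).
have {hk} ke := hk k (leqnn k); rewrite /= in ke.
have k0 : 0 < k.+1%:R^-1 :> R by rewrite invr_gt0.
have /choice[q hq] : forall i : 'I_n, exists q : rat,
    `]v 0 i - k.+1%:R^-1, v 0 i + k.+1%:R^-1[%classic (ratr q).
  move=> i; have := @dense_rat R (`]v 0 i - k.+1%:R^-1, v 0 i + k.+1%:R^-1[%classic); case.
  - by exists (v 0 i) => /=; rewrite in_itv/= ltrBlDr ltrDl k0.
  - exact: interval_open.
  - by move=> y [/= hy [s _ sy]]; exists s; rewrite sy.
exists (\row_i q i, k) => //; case: asboolP => [_ i /=|[]].
  have := hq i; rewrite /= !in_itv/= mxE => /andP[]; move: (k.+1%:R^-1) => y h1 h2.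
  by apply/andP; split; lra.
move=> w hw; apply: he; split => // a i; rewrite ord1.
have := hw i; have := hq i; rewrite /= !in_itv/= mxE => /andP[h1 h2] /andP[h3 h4].
move: ke h1 h2 h3 h4; move: (k.+1%:R^-1) => y ke h1 h2 h3 h4.
by rewrite /ball /= ltr_norml; apply/andP; split; lra.
Qed.

Lemma continuous_measurable_rV (f : V -> R) : continuous f -> measurable_fun setT f.
Proof.
move=> cf; apply: (measurability _ (RGenOpens.measurableE R)) => //.
move=> _ [_ [a [b ->]] <-]; rewrite setTI; apply: open_measurable_rV.
by apply: open_comp => [x _|]; [exact: cf|exact: interval_open].
Qed.

End continuous_measurable_rV.

(** * Lower integrals of possibly non-measurable functions *)

Section lower_integral.
Context d (T : measurableType d) (R : realType) (mu : {measure set T -> \bar R}).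
Local Open Scope ereal_scope.

(* [v] need not be measurable: its integral is the supremum over the simple
   functions below it. *)
Lemma ae_le_lower_integral (D : set T) (w v : T -> \bar R) :
  measurable D -> measurable_fun D w -> (forall x, D x -> 0 <= w x) ->
  (forall x, D x -> 0 <= v x) -> {ae mu, forall x, D x -> w x <= v x} ->
  \int[mu]_(x in D) w x <= \int[mu]_(x in D) v x.
Proof.
move=> mD mw w0 v0 [X [mX X0 wvX]].
rewrite (ge0_negligible_integral mX mD mw w0 X0).
rewrite ge0_integralE; last by move=> x [Dx _]; exact: w0.
rewrite ge0_integralE//; apply: ereal_sup_le => _ [h /= hw <-]; exists h => //= x.
apply: (le_trans (hw x)); rewrite !patchE.
case: ifPn => [|_]; last by case: ifPn => //; rewrite inE => /v0.
rewrite inE => -[Dx nXx]; rewrite mem_set//.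
by apply: contrapT => nle; apply: nXx; apply: wvX => /= /(_ Dx).
Qed.

(** Additivity may fail for the sum v + u, as [v] need not be measurable. The measurable function
    max(0, k - u) is below [v] wherever [u] is finite, so the previous lemma applies to it, and [u]
    is added back on the measurable side. *)
Lemma ae_le_lower_integralD (D : set T) (k u v : T -> \bar R) :
  measurable D -> measurable_fun D k -> measurable_fun D u ->
  (forall x, D x -> 0 <= k x) -> (forall x, D x -> 0 <= u x) ->
  (forall x, D x -> 0 <= v x) -> {ae mu, forall x, D x -> k x <= v x + u x} ->
  \int[mu]_(x in D) u x < +oo ->
  \int[mu]_(x in D) k x <= \int[mu]_(x in D) v x + \int[mu]_(x in D) u x.
Proof.
move=> mD mk mu_ k0 u0 v0 kvu uoo.
pose w x := maxe 0 (k x - u x).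
have mw : measurable_fun D w.
  by apply: measurable_maxe => //; exact: emeasurable_funB.
have w0 x : 0 <= w x by rewrite le_max lexx.
have ufin : {ae mu, forall x, D x -> u x \is a fin_num}.
  apply: integrable_ae => //; apply/integrableP; split => //.
  by under eq_integral => x /[!inE] Dx do rewrite gee0_abs ?u0//.
apply: (@le_trans _ _ (\int[mu]_(x in D) (w x + u x))).
  apply: ae_ge0_le_integral => //.
  - by move=> x Dx; rewrite adde_ge0// u0.
  - exact: emeasurable_funD.
  - apply: filterS ufin => x hu Dx; rewrite /w -(subeK (k x) (hu Dx)).
    by rewrite leeD2r// subeK ?hu// le_max lexx orbT.
rewrite ge0_integralD//; apply: leeD2r; apply: ae_le_lower_integral => //.
apply: filterS2 ufin kvu => x hu hk Dx; rewrite /w ge_max v0//=.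
by rewrite leeBlDr ?hu// hk.
Qed.

End lower_integral.

Section time_norms.
Context {R : realType}.
Local Notation mu := (@lebesgue_measure R).
Variables (T : R) (g : R -> \bar R).
Hypothesis g_ge0 : forall t, (0 <= g t)%E.

Lemma L2norm_le (F0 : R) : 0 <= F0 -> (L2norm T g <= F0%:E)%E ->
  (\int[mu]_(t in `]0%R, T[) (g t ^+ 2) <= (F0 ^+ 2)%:E)%E.
Proof.
rewrite /L2norm => F00; set I := (\int[mu]_(t in _) _)%E.
have I0 : (0 <= I)%E by apply: integral_ge0 => t _; rewrite expe_ge0.
case: I I0 => [r|//|//]; last by rewrite poweRyr ?invr_neq0// leye_eq.
rewrite lee_fin => r0; rewrite poweR_EFin powR12_sqrt// !lee_fin => h.
by rewrite -(sqr_sqrtr r0) ler_pXn2r ?nnegrE ?sqrtr_ge0.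
Qed.

Lemma L2norm_lty : (L2norm T g < +oo)%E ->
  (\int[mu]_(t in `]0%R, T[) (g t ^+ 2) < +oo)%E.
Proof.
rewrite /L2norm; set I := (\int[mu]_(t in _) _)%E.
have I0 : (0 <= I)%E by apply: integral_ge0 => t _; rewrite expe_ge0.
by case: I I0 => [r|//|//] _; rewrite ?ltry// poweRyr ?invr_neq0.
Qed.

End time_norms.

Section kernel.
Context {R : realType}.
Variables (lambda eps : R).
Hypotheses (lambda_gt0 : 0 < lambda) (eps_gt0 : 0 < eps).
Local Notation phi := (phi_ lambda eps).

Lemma c_gt0 : 0 < c_ lambda.
Proof.
have : 1 `^ lambda^-1 < 2 `^ lambda^-1 :> R.
  by rewrite gt0_ltr_powR ?invr_gt0 ?nnegrE ?ltr1n.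
by rewrite powR1 /c_ subr_gt0.
Qed.

Lemma phi_arg_gt0 r : 0 < eps ^+ 2 + c_ lambda * r ^+ 2.
Proof. by rewrite ltr_pwDl ?exprn_gt0// mulr_ge0 ?sqr_ge0// ltW// c_gt0. Qed.

Lemma phi_ge0 r : 0 <= phi r.
Proof. exact: powR_ge0. Qed.

Lemma phiE r : phi r = ((eps ^+ 2 + c_ lambda * r ^+ 2) `^ lambda)^-1.
Proof. by rewrite /phi_ powRN. Qed.

Lemma phi_le r : phi r <= ((eps ^+ 2) `^ lambda)^-1.
Proof.
rewrite phiE lef_pV2 ?posrE ?powR_gt0 ?phi_arg_gt0 ?exprn_gt0//.
rewrite ge0_ler_powR ?nnegrE ?(ltW lambda_gt0) ?(ltW (phi_arg_gt0 r)) ?sqr_ge0//.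
by rewrite lerDl mulr_ge0 ?sqr_ge0// ltW// c_gt0.
Qed.

Lemma measurable_phi : measurable_fun setT phi.
Proof.
apply: (measurableT_comp (@measurable_powR R (- lambda))).
by apply: measurable_funD => //; apply: measurable_funM.
Qed.

Lemma phi_near (r r' : R) : eps <= r -> 0 <= r' -> r' < r ->
  1 <= ((1 + c_ lambda) * r ^+ 2) `^ lambda * phi r'.
Proof.
move=> er r'0 r'r; have r0 : 0 < r by exact: lt_le_trans er.
have c0 := c_gt0.
rewrite phiE -ler_pdivrMr ?invr_gt0 ?powR_gt0 ?phi_arg_gt0// invrK mul1r.
rewrite ge0_ler_powR ?nnegrE ?(ltW lambda_gt0) ?(ltW (phi_arg_gt0 r'))//.
  by rewrite mulr_ge0 ?sqr_ge0// addr_ge0// ltW.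
rewrite [leRHS]mulrDl [in leRHS]mul1r lerD ?ler_wpM2l ?(ltW c0)//.
  by apply: lerXn2r => //; rewrite nnegrE ltW.
by apply: lerXn2r; rewrite ?nnegrE// ltW.
Qed.

End kernel.

Section parametric_dissipation.
Context {R : realType} {N : nat} {d : measure_display} {S : measurableType d}.
Local Notation V := 'rV[R]_N.
Local Notation m := (@leb R N).
Variables (Fc : S * (V * V) -> R) (phi : R -> R).
Hypothesis mFc : measurable_fun setT Fc.
Hypothesis mphi : measurable_fun setT phi.

Let measurable_assoc (w : V -> R) : measurable_fun setT w ->
  measurable_fun setT (fun q : (S * V) * V => w q.2 * Fc (q.1.1, (q.1.2, q.2))).
Proof.
move=> mw; apply: measurable_funM; first exact: (measurableT_comp mw measurable_snd).
apply: (measurableT_comp mFc); apply: measurable_fun_pair.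
  exact: (measurableT_comp measurable_fst measurable_fst).
apply: measurable_fun_pair; last exact: measurable_snd.
exact: (measurableT_comp measurable_snd measurable_fst).
Qed.

Let moment (w : V -> R) (q : S * V) : R := \int[m]_v (w v * Fc (q.1, (q.2, v))).

Let measurable_moment (w : V -> R) : measurable_fun setT w -> measurable_fun setT (moment w).
Proof. by move=> /measurable_assoc h; exact: (@measurable_Rint2 _ _ _ _ _ m _ h). Qed.

Let measurable_at1 (g : S * V -> R) : measurable_fun setT g ->
  measurable_fun setT (fun q : S * (V * V) => g (q.1, q.2.1)).
Proof.
move=> mg; apply: (measurableT_comp mg); apply: measurable_fun_pair; first exact: measurable_fst.
exact: (measurableT_comp measurable_fst measurable_snd).
Qed.

Let measurable_at2 (g : S * V -> R) : measurable_fun setT g ->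
  measurable_fun setT (fun q : S * (V * V) => g (q.1, q.2.2)).
Proof.
move=> mg; apply: (measurableT_comp mg); apply: measurable_fun_pair; first exact: measurable_fst.
exact: (measurableT_comp measurable_snd measurable_snd).
Qed.

(** Written in moments, the dissipation is an iterated parametric integral of measurable functions,
    with the time as parameter. *)
Lemma measurable_dissipation :
  measurable_fun setT (fun t => dissipation (fun x v => Fc (t, (x, v))) phi).
Proof.
have m1 : measurable_fun setT (moment (cst 1)) by exact: measurable_moment.
have me : measurable_fun setT (moment (fun v => dot v v)).
  by apply: measurable_moment; apply: measurable_dot => i; exact: measurable_rV_coord.
have mj i : measurable_fun setT (moment (rV_coord i)).
  by apply: measurable_moment; exact: measurable_rV_coord.
have rhoE t : rho (fun x v => Fc (t, (x, v))) = fun x => moment (cst 1) (t, x).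
  by apply/funext => x; apply: eq_Rintegral => v _; rewrite mul1r.
apply: (@measurable_Rint2 _ _ _ _ _ (@leb2 R N) (fun q : S * (V * V) =>
  phi (enorm (q.2.1 - q.2.2)) * defect (fun x v => Fc (q.1, (x, v))) q.2)).
apply: measurable_funM.
  apply: (measurableT_comp mphi); apply: measurable_enorm => i.
  under eq_fun do rewrite !mxE.
  apply: measurable_funB.
    exact: (measurableT_comp (measurable_coord1 i) measurable_snd).
  exact: (measurableT_comp (measurable_coord2 i) measurable_snd).
rewrite (_ : (fun q : S * (V * V) => _) = (fun q : S * (V * V) =>
   moment (cst 1) (q.1, q.2.2) * moment (fun v => dot v v) (q.1, q.2.1) +
   moment (cst 1) (q.1, q.2.1) * moment (fun v => dot v v) (q.1, q.2.2) -
   2 * \sum_(i < N) moment (rV_coord i) (q.1, q.2.1) * moment (rV_coord i) (q.1, q.2.2))); last first.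
  apply/funext => q; rewrite /defect !rhoE; congr (_ - 2 * _).
  by apply: eq_bigr => i _; rewrite /cur !mxE.
apply: measurable_funB; first (apply: measurable_funD; apply: measurable_funM).
- exact: (measurable_at2 m1).
- exact: (measurable_at1 me).
- exact: (measurable_at1 m1).
- exact: (measurable_at2 me).
apply: measurable_funM => //; apply: measurable_sum => i; apply: measurable_funM.
- exact: (measurable_at1 (mj i)).
- exact: (measurable_at2 (mj i)).
Qed.

End parametric_dissipation.

Section gradient_of_lipschitz.
Context {R : realType} {N : nat}.
Local Notation V := 'rV[R]_N.

Lemma enorm_delta (i : 'I_N) (h : R) : enorm (h *: delta_mx 0 i : V) = `|h|.
Proof.
rewrite -sqrtr_sqr /enorm; congr Num.sqrt; rewrite /dot (bigD1 i)//= big1 ?addr0.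
  by rewrite !mxE !eqxx mulr1 expr2.
by move=> j ji; rewrite !mxE (negbTE ji) andbF mulr0 mul0r.
Qed.

Lemma pd_lipschitz (u : V -> R) (K : R) i x : derivable u x (delta_mx 0 i) ->
  (forall x y, `|u x - u y| <= K * enorm (x - y)) -> `|pd i u x| <= K.
Proof.
move=> du lip.
have : `|h^-1 *: ((u \o shift x) (h *: delta_mx 0 i) - u x)| @[h --> (0 : R)^'] --> `|pd i u x|.
  by apply: cvg_norm; exact: du.
move=> hc; have := cvg_lim (@norm_hausdorff _ R) hc; move=> <-.
apply: limr_le; first by apply/cvg_ex; exists `|pd i u x|.
near=> h; have h0 : h != 0 by near: h; exact: nbhs_dnbhs_neq.
rewrite normrZ normrV ?unitfE//= ler_pdivrMl ?normr_gt0//.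
by rewrite (le_trans (lip _ _))// addrK enorm_delta mulrC.
Unshelve. all: by end_near. Qed.

Lemma enorm_le_coord (x : V) (K : R) : (forall i, `|x 0 i| <= K) ->
  enorm x <= Num.sqrt (N%:R * K ^+ 2).
Proof.
move=> hx; apply: ler_wsqrtr; rewrite /dot.
apply: (@le_trans _ _ (\sum_(i < N) K ^+ 2)).
  apply: ler_sum => i _; rewrite -expr2 -[leLHS]real_normK ?num_real//.
  by rewrite ler_pXn2r ?nnegrE// (le_trans _ (hx i)).
by rewrite sumr_const card_ord -[leLHS]mulr_natl.
Qed.

End gradient_of_lipschitz.

(** * The energy estimate *)

Section decay.
Context {R : realType} {N : nat}.
Local Notation V := 'rV[R]_N.
Local Notation m2 := (@leb2 R N).
Local Notation mu := (@lebesgue_measure R).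
Local Notation RX := (measurableTypeR R * (V * V))%type.
Variables (T : R) (g : R -> V -> V -> R).
Hypothesis g_decay : decaying T g.

Let gc : RX -> R := cutoff T (fun t (p : V * V) => g t p.1 p.2).

Let gcE (t : R) p : t \in `]0, T[ -> gc (t, p) = g t p.1 p.2.
Proof. by rewrite in_itv/= /gc /cutoff /= => ->. Qed.

Lemma measurable_cutoff_decay : measurable_fun setT gc.
Proof. by apply: measurable_cutoff; exact: g_decay.1. Qed.

Lemma decaying_measurable (t : R) : t \in `]0, T[ ->
  measurable_fun setT (fun p : V * V => g t p.1 p.2).
Proof.
move=> tT; rewrite (_ : (fun p => _) = (fun p => gc (t, p))).
  by have := measurable_cutoff_decay; move=> /(@measurable_fun_pair2 _ _ _ _ _ _ _ t).
by apply/funext => p; rewrite gcE.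
Qed.

Let sizeE (t : R) : \bar R := (\int[m2]_p (weight p * `|gc (t, p)|)%:E)%E.

Let msizeE : measurable_fun setT sizeE.
Proof.
apply: (@measurable_eint2 _ _ _ _ _ m2 (fun q : RX => (weight q.2 * `|gc q|)%:E)).
apply/measurable_EFinP; apply: measurable_funM.
  apply: measurable_funX; apply: measurable_funD => //; apply: measurable_enorm => i.
  exact: (measurableT_comp (measurable_coord2 i) measurable_snd).
by apply: measurableT_comp => //; exact: measurable_cutoff_decay.
Qed.

(* The square is kept in [\bar R]: the size may be infinite on a null set of times. *)
Definition sqr_size (t : R) : \bar R := (sizeE t ^+ 2)%E.

Let weight_ge0 (p : V * V) : 0 <= weight p.
Proof. exact: le_trans ler01 (weight_ge1 p). Qed.

Let sizeE_ge0 t : (0 <= sizeE t)%E.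
Proof. by apply: integral_ge0 => p _; rewrite lee_fin mulr_ge0. Qed.

Lemma sqr_size_ge0 t : (0 <= sqr_size t)%E.
Proof. exact: expe_ge0. Qed.

Lemma measurable_sqr_size : measurable_fun setT sqr_size.
Proof.
rewrite (_ : sqr_size = (sizeE \* sizeE)%E); first exact: emeasurable_funM.
by apply/funext => t; rewrite /sqr_size expe2.
Qed.

Lemma integral_sqr_size_lty : (\int[mu]_(t in `]0%R, T[) sqr_size t < +oo)%E.
Proof.
have h0 t : (0 <= \int[m2]_p ((1 + enorm p.2) ^+ 3 * `|g t p.1 p.2|)%:E)%E.
  by apply: integral_ge0 => p _; rewrite lee_fin mulr_ge0// exprn_ge0// addr_ge0// enorm_ge0.
apply: le_lt_trans (L2norm_lty h0 g_decay.2); rewrite le_eqVlt; apply/orP; left.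
apply/eqP; apply: eq_integral => t; rewrite inE /= => tT; rewrite /sqr_size; congr (_ ^+ 2)%E.
by apply: eq_integral => p _; rewrite gcE.
Qed.

(** A function with finite square integral is finite almost everywhere; at such times the extended
    square is that of a real integral. *)
Lemma ae_wL1 : {ae mu, forall t, t \in `]0, T[ ->
  wL1 (fun p : V * V => g t p.1 p.2) /\
  sqr_size t = ((\int[m2]_p (weight p * `|g t p.1 p.2|)) ^+ 2)%:E}.
Proof.
have : mu.-integrable `]0, T[ sqr_size.
  apply/integrableP; split; first exact: measurable_funTS measurable_sqr_size.
  under eq_integral do rewrite gee0_abs ?sqr_size_ge0//.
  exact: integral_sqr_size_lty.
move=> /integrable_ae -/(_ (measurable_itv _)); apply: filterS => t ht tT.
have {}ht := ht tT.
have szE : sizeE t = (\int[m2]_p (weight p * `|g t p.1 p.2|)%:E)%E.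
  by apply: eq_integral => p _; rewrite gcE.
have szfin : sizeE t \is a fin_num.
  move: ht; rewrite /sqr_size; case: (sizeE t) (sizeE_ge0 t) => [r|_|] //.
have I1 : L1 m2 (fun p : V * V => weight p * `|g t p.1 p.2|).
  apply: L1_abs_lty.
    apply: measurable_funM; last by apply: measurableT_comp => //; exact: decaying_measurable.
    apply: measurable_funX; apply: measurable_funD => //; apply: measurable_enorm => i.
    exact: measurable_coord2.
  move: szfin; rewrite ge0_fin_numE// szE; apply: le_lt_trans.
  rewrite le_eqVlt; apply/orP; left; apply/eqP; apply: eq_integral => p _.
  by rewrite ger0_norm// mulr_ge0.
split; first by split => //; exact: decaying_measurable.
by rewrite /sqr_size szE -EFin_Rint// EFin_expe.
Qed.

End decay.

Section ae_lebesgue.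
Context {R : realType}.
Local Notation mu := (@lebesgue_measure R).
Implicit Types A B C D : R -> Prop.

Lemma ae_lebS A B : (forall t, A t -> B t) ->
  {ae mu, forall t, A t} -> {ae mu, forall t, B t}.
Proof. by move=> h; apply: negligibleS => t; apply: contra_not => /h. Qed.

Lemma ae_lebI A B : {ae mu, forall t, A t} -> {ae mu, forall t, B t} ->
  {ae mu, forall t, A t /\ B t}.
Proof.
move=> hA hB; apply: (negligibleS _ (negligibleU hA hB)) => t /= nAB.
by apply: contrapT => /not_orP[/contrapT At /contrapT Bt]; apply: nAB.
Qed.

Lemma ae_lebS2 A B C : (forall t, A t -> B t -> C t) ->
  {ae mu, forall t, A t} -> {ae mu, forall t, B t} -> {ae mu, forall t, C t}.
Proof. by move=> h hA hB; apply: ae_lebS (ae_lebI hA hB) => t []; exact: h. Qed.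

Lemma ae_leb_ord (n : nat) (A : 'I_n -> R -> Prop) :
  (forall i, {ae mu, forall t, A i t}) -> {ae mu, forall t, forall i, A i t}.
Proof.
move=> hA.
have h k : {ae mu, forall t, forall kn : (k < n)%N, A (Ordinal kn) t}.
  case: (pselect (k < n)%N) => kn; last by apply: aeW => t kn'; case: (kn kn').
  by apply: ae_lebS (hA (Ordinal kn)) => t h kn'; rewrite (bool_irrelevance kn' kn).
by apply: ae_lebS (ae_foralln h) => t ht [i hi]; exact: ht.
Qed.

End ae_lebesgue.

Lemma sqr_sum_le {R : realType} (I : finType) (c : I -> R) :
  (\sum_i c i) ^+ 2 <= #|I|%:R * \sum_i c i ^+ 2.
Proof.
have step i j : c i * c j <= 2^-1 * (c i ^+ 2 + c j ^+ 2).
  by have := sqr_ge0 (c i - c j); rewrite !expr2; lra.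
rewrite expr2 mulr_suml.
apply: (@le_trans _ _ (\sum_i \sum_j 2^-1 * (c i ^+ 2 + c j ^+ 2))).
  by apply: ler_sum => i _; rewrite mulr_sumr; apply: ler_sum => j _.
rewrite (eq_bigr (fun i => 2^-1 * (#|I|%:R * c i ^+ 2) + 2^-1 * \sum_j c j ^+ 2)); last first.
  move=> i _; rewrite -mulr_sumr big_split /= sumr_const mulrDr.
  by rewrite -[c i ^+ 2 *+ _]mulr_natl.
rewrite big_split /= -!mulr_sumr sumr_const -[_ *+ #|_|]mulr_natl.
set X := \sum_i _; set n : R := _%:R; lra.
Qed.

Section finite_time_integral.
Context {R : realType}.
Local Notation mu := (@lebesgue_measure R).
Variable T : R.
Implicit Types u v : R -> \bar R.

Definition time_integrable u := [/\ measurable_fun setT u, forall t, (0 <= u t)%E &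
  (\int[mu]_(t in `]0%R, T[) u t < +oo)%E].

Lemma time_integrableD u v : time_integrable u -> time_integrable v ->
  time_integrable (fun t => u t + v t)%E.
Proof.
move=> [mu_ u0 ul] [mv v0 vl]; split; first exact: emeasurable_funD.
- by move=> t; rewrite adde_ge0.
- rewrite ge0_integralD//; [exact: lte_add_pinfty|exact: measurable_funTS|exact: measurable_funTS].
Qed.

Lemma time_integrable_sum n (u : 'I_n -> R -> \bar R) : (forall i, time_integrable (u i)) ->
  time_integrable (fun t => \sum_i u i t)%E.
Proof.
move=> h; elim: n => [|n IH] in u h *.
  split; first by under eq_fun do rewrite big_ord0; exact: measurable_cst.
  - by move=> t; rewrite big_ord0.
  - by under eq_integral do rewrite big_ord0; rewrite integral0.
under eq_fun do rewrite big_ord_recr /=.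
by apply: time_integrableD => //; exact: IH.
Qed.

Lemma time_integrable_sqr_size N (g : R -> 'rV[R]_N -> 'rV[R]_N -> R) : decaying T g ->
  time_integrable (sqr_size T g).
Proof.
by move=> hg; split; [exact: measurable_sqr_size|move=> t; exact: sqr_size_ge0|
  exact: integral_sqr_size_lty].
Qed.

End finite_time_integral.

Lemma Rint_0 d (T : measurableType d) (R : realType) (m : {measure set T -> \bar R}) :
  \int[m]_x (0 : R) = 0.
Proof. by rewrite /Rintegral integral0. Qed.

(** The solution is controlled before [T] only; the bound reaches [T] because the integral is
    continuous in its upper end. *)
Lemma Rintegral_ge_itvoo {R : realType} (T c : R) (B : R -> R) :
  0 < T -> (@lebesgue_measure R).-integrable `]0, T[ (EFin \o B) ->
  (forall tau, tau \in `]0, T[ -> c <= \int[@lebesgue_measure R]_(s in `]0, tau[) B s) ->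
  c <= \int[@lebesgue_measure R]_(s in `]0, T[) B s.
Proof.
move=> T0 iB hc; pose B' := B \_ `]0, T[.
have iB' : (@lebesgue_measure R).-integrable setT (EFin \o B').
  rewrite /B' -restrict_EFin; apply: (iffLR (integrable_mkcond _ _) iB).
  exact: measurable_itv.
have eqB x : 0 < x -> x <= T ->
    \int[@lebesgue_measure R]_(s in `[0, x]) B' s = \int[@lebesgue_measure R]_(s in `]0, x[) B s.
  move=> x0 xT; rewrite -Rintegral_itv_obnd_cbnd; last exact: integrableS iB'.
  rewrite -Rintegral_itv_bndo_bndc; last exact: integrableS iB'.
  apply: eq_Rintegral => s; rewrite inE /= in_itv/= => /andP[s0 sx].
  by rewrite /B' patchE mem_set//= in_itv/= s0 (lt_le_trans sx).
have iBT : (@lebesgue_measure R).-integrable `[0, T] (EFin \o B') by exact: integrableS iB'.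
have h := parameterized_integral_cvg_at_left T0 iBT.
rewrite -(eqB T T0 (lexx _)).
have {}h : \int[@lebesgue_measure R]_(s in `[0, x]) B' s @[x --> T^'-] -->
  \int[@lebesgue_measure R]_(s in `[0, T]) B' s := h.
rewrite -(cvg_lim (@Rhausdorff R) h); apply: limr_ge; first by apply/cvg_ex; eexists; exact: h.
near=> x; have x0 : 0 < x by near: x; exact: nbhs_left_gt.
have xT : x < T by near: x; exact: nbhs_left_lt.
by rewrite eqB ?(ltW xT)// hc// in_itv/= x0.
Unshelve. all: by end_near. Qed.

Lemma dissipation_ge0 {R : realType} {N : nat} (F : 'rV[R]_N -> 'rV[R]_N -> R) (phi : R -> R) (K : R) :
  (forall x v, 0 <= F x v) -> wL1 (fun p : 'rV[R]_N * 'rV[R]_N => F p.1 p.2) ->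
  measurable_fun setT phi -> (forall r, 0 <= phi r) -> (forall r, phi r <= K) ->
  0 <= dissipation F phi.
Proof.
move=> F_ge0 F_w mphi phi_ge0 phi_le; rewrite -(Rint_0 (@leb2 R N)); apply: ae_le_Rint.
- exact: L1_0.
- exact: (L1_ker mphi phi_ge0 phi_le (L1_defect F_w)).
- by apply: filterS (ae_defect F_ge0 F_w) => p [q0 _]; rewrite mulr_ge0.
Qed.

(** * Time integration of the energy balance *)

Section integrated_balance.
Context {R : realType}.
Local Notation mu := (@lebesgue_measure R).

(** Here [b] is the time derivative of the energy, whose integral is at least -E0 since the energy
    stays nonnegative. As [b] changes sign, its negative part is moved to the other side, so that
    only nonnegative functions meet the possibly non-measurable [v]. Integrability of [D] is
    obtained along the way. *)
Lemma integral_le_of_balance (T eps M0 E0 F0 c : R) (D b : R -> R) (v : R -> \bar R) :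
  0 < T -> 0 < eps -> 0 < M0 -> 0 <= c ->
  measurable_fun setT D -> measurable_fun setT b ->
  mu.-integrable `]0, T[ (EFin \o b) -> - E0 <= \int[mu]_(s in `]0, T[) b s ->
  (forall t, 0 <= v t)%E -> (\int[mu]_(t in `]0%R, T[) v t <= (F0 ^+ 2)%:E)%E ->
  {ae mu, forall t, t \in `]0, T[ -> 0 <= D t /\
    ((D t + eps * b t)%:E <= M0%:E * v t + (c * M0)%:E)%E} ->
  (\int[mu]_(t in `]0%R, T[) `|D t|%:E <= (M0 * F0 ^+ 2 + c * M0 * T + eps * E0)%:E)%E.
Proof.
move=> T0 eps0 M00 c0 mD mb ib hb v0 vle aeD.
pose bp s : R := Num.max (b s) 0; pose bm s : R := Num.max (- b s) 0.
have mbp : measurable_fun setT bp by exact: measurable_maxr.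
have mbm : measurable_fun setT bm by apply: measurable_maxr => //; exact: measurableT_comp.
have ibp : mu.-integrable `]0, T[ (EFin \o bp).
  apply: (le_integrable _ _ _ ib) => //; first by apply/measurable_EFinP; exact: measurable_funTS.
  by move=> s _ /=; rewrite lee_fin /bp; case: (leP (b s) 0) => h; rewrite ?normr0.
have ibm : mu.-integrable `]0, T[ (EFin \o bm).
  apply: (le_integrable _ _ _ ib) => //; first by apply/measurable_EFinP; exact: measurable_funTS.
  by move=> s _ /=; rewrite lee_fin /bm; case: (leP (- b s) 0) => h; rewrite ?normr0 ?normrN.
pose d s : R := `|D s|.
have md : measurable_fun setT d by exact: measurableT_comp.
(* Dividing by [M0] gives [v] the coefficient 1 that the lower-integral comparison expects. *)
pose k s : R := M0^-1 * (d s + eps * bp s); pose u s : R := c + M0^-1 * eps * bm s.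
have mk : measurable_fun setT k.
  by apply: measurable_funM => //; apply: measurable_funD => //; exact: measurable_funM.
have M0V : 0 <= M0^-1 by rewrite invr_ge0 ltW.
have bp0 s : 0 <= bp s by rewrite le_max lexx orbT.
have bm0 s : 0 <= bm s by rewrite le_max lexx orbT.
have k0 s : 0 <= k s by rewrite /k mulr_ge0// addr_ge0 ?normr_ge0// mulr_ge0// ltW.
have u0 s : 0 <= u s by rewrite /u addr_ge0// mulr_ge0// mulr_ge0// ltW.
have bE s : b s = bp s - bm s.
  by rewrite /bp /bm; case: (leP (b s) 0) => h; case: (leP (- b s) 0) => h'; lra.
have muT : mu `]0%R, T[%classic = T%:E by rewrite lebesgue_measure_itv /= lte_fin T0 sube0.
have intc (r : R) : (\int[mu]_(x in `]0%R, T[) r%:E)%E = (r * T)%:E.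
  by rewrite EFinM -muT integral_cst.
have ic : mu.-integrable `]0, T[ (EFin \o (fun=> c)).
  apply/integrableP; split; first exact/measurable_EFinP/measurable_cst.
  by rewrite intc ltry.
have ibm' : mu.-integrable `]0, T[ (EFin \o (fun s => M0^-1 * eps * bm s)).
  by apply: (integrableZl _ _ ibm).
have iu : mu.-integrable `]0, T[ (EFin \o u) by apply: (integrableD _ ic ibm').
have uE : (\int[mu]_(s in `]0%R, T[) (u s)%:E)%E =
    (c * T + M0^-1 * eps * \int[mu]_(s in `]0, T[) bm s)%:E.
  rewrite -[LHS](fineK (integrable_fin_num _ iu))//; congr EFin.
  rewrite -/(Rintegral mu _ u) RintegralD// RintegralZl//; congr (_ + _).
  by rewrite /Rintegral intc.
have kle : (\int[mu]_(s in `]0%R, T[) (k s)%:E <=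
    (F0 ^+ 2)%:E + \int[mu]_(s in `]0%R, T[) (u s)%:E)%E.
  apply: (@le_trans _ _ (\int[mu]_(t in `]0%R, T[) v t +
     \int[mu]_(s in `]0%R, T[) (u s)%:E)%E); last by rewrite leeD2r.
  apply: ae_le_lower_integralD => //.
  - by apply/measurable_EFinP/measurable_funTS.
  - by case/integrableP : iu.
  - by move=> s _; rewrite lee_fin.
  - by move=> s _; rewrite lee_fin.
  - apply: ae_lebS aeD => s hs /=; rewrite in_itv/= => sT.
    have [|D0 h] := hs; first by rewrite in_itv.
    move: (v0 s) h; case: (v s) => [r _|_ _|//]; last by rewrite addye// leey.
    rewrite -EFinM -!EFinD !lee_fin /k /u bE => h; rewrite mulrC ler_pdivrMr//.
    rewrite (_ : _ * M0 = M0 * r + c * M0 + eps * bm s); last by field; rewrite gt_eqF.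
    by rewrite /d ger0_norm//; lra.
  - by rewrite uE ltry.
have ik : mu.-integrable `]0, T[ (EFin \o k).
  apply/integrableP; split; first by apply/measurable_EFinP/measurable_funTS.
  under eq_integral do rewrite /= ger0_norm//.
  by rewrite (le_lt_trans kle)// uE -EFinD ltry.
have id : mu.-integrable `]0, T[ (EFin \o d).
  have iMk : mu.-integrable `]0, T[ (EFin \o (fun s => M0 * k s)).
    by apply: (integrableZl _ _ ik).
  apply: (le_integrable _ _ _ iMk) => //; first by apply/measurable_EFinP; exact: measurable_funTS.
  move=> s _ /=; rewrite lee_fin normr_id mulrA mulfV ?gt_eqF// mul1r.
  have e0 : 0 <= eps * bp s by rewrite mulr_ge0// ltW.
  by rewrite (ger0_norm (addr_ge0 (normr_ge0 _) e0)) lerDl.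
have kE : (\int[mu]_(s in `]0%R, T[) (k s)%:E)%E = (M0^-1 * (\int[mu]_(s in `]0, T[) d s +
    eps * \int[mu]_(s in `]0, T[) bp s))%:E.
  rewrite -[LHS](fineK (integrable_fin_num _ ik))//; congr EFin.
  have iebp : mu.-integrable `]0, T[ (EFin \o (fun s => eps * bp s)).
    by apply: (integrableZl _ _ ibp).
  rewrite -/(Rintegral mu _ k) RintegralZl//; last by apply: (integrableD _ id iebp).
  by rewrite RintegralD// RintegralZl.
have bIE : \int[mu]_(s in `]0, T[) b s =
    \int[mu]_(s in `]0, T[) bp s - \int[mu]_(s in `]0, T[) bm s.
  by rewrite -RintegralB//; apply: eq_Rintegral => s _; rewrite bE.
have -> : (\int[mu]_(t in `]0%R, T[) `|D t|%:E)%E = (\int[mu]_(s in `]0, T[) d s)%:E.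
  by rewrite /Rintegral fineK//; exact: integrable_fin_num id.
move: kle; rewrite kE uE -EFinD !lee_fin -(ler_pM2l M00) mulrA mulfV ?gt_eqF// mul1r.
rewrite !mulrDr !mulrA mulfV ?gt_eqF// mul1r => kle.
have hb2 : eps * (- E0) <= eps * (\int[mu]_(s in `]0, T[) bp s - \int[mu]_(s in `]0, T[) bm s).
  by rewrite -bIE ler_wpM2l// ltW.
pose x := \int[mu]_(s in `]0, T[) d s.
pose y := \int[mu]_(s in `]0, T[) bp s; pose z := \int[mu]_(s in `]0, T[) bm s.
have h1 : x + eps * y <= M0 * F0 * F0 + (M0 * c * T + eps * z) := kle.
have h2 : eps * (- E0) <= eps * (y - z) := hb2.
suff : x <= M0 * F0 * F0 + c * M0 * T + eps * E0 by [].
by move: x y z h1 h2 {kle hb2 uE kE bIE} => x y z h1 h2; lra.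
Qed.

End integrated_balance.

Section phase_size_split.
Context {R : realType} {N : nat}.
Local Notation V := 'rV[R]_N.
Local Notation m2 := (@leb2 R N).
Variable F : V -> V -> R.
Hypothesis F_w : wL1 (fun p : V * V => F p.1 p.2).
Hypothesis Fx_w : forall i, wL1 (fun p : V * V => pd i (F^~ p.2) p.1).
Hypothesis Fv_w : forall i, wL1 (fun p : V * V => pd i (F p.1) p.2).
Hypothesis Fvv_w : forall i, wL1 (fun p : V * V => pd i (pd i (F p.1)) p.2).

Lemma phase_sizeE : phase_size F = \int[m2]_p (weight p * `|F p.1 p.2|) + \sum_(i < N)
  (\int[m2]_p (weight p * `|F p.1 p.2|) + \int[m2]_p (weight p * `|pd i (F^~ p.2) p.1|) +
   \int[m2]_p (weight p * `|pd i (F p.1) p.2|) +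
   \int[m2]_p (weight p * `|pd i (pd i (F p.1)) p.2|)).
Proof.
have I0 := F_w.2; have I1 i := (Fx_w i).2; have I2 i := (Fv_w i).2; have I3 i := (Fvv_w i).2.
have I01 i := L1D I0 (I1 i); have I012 i := L1D (I01 i) (I2 i).
have I0123 i := L1D (I012 i) (I3 i).
rewrite /phase_size; under eq_Rintegral do rewrite /phase_size_at mulrDr mulr_sumr.
under eq_Rintegral do under eq_bigr do rewrite !mulrDr.
rewrite RintegralD//; last exact: L1_sum.
rewrite Rint_sum//; congr (_ + _); apply: eq_bigr => i _.
by rewrite !RintegralD.
Qed.

End phase_size_split.

(** (x + A)^2 <= 2 x^2 + 2 A^2, and Cauchy-Schwarz over n summands of four terms each gives A^2 <= 4
    n B, hence 8 n. *)
Lemma sqr_sum4_le {R : realType} (n : nat) (x : R) (y z u : 'I_n -> R) :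
  (x + \sum_i (x + y i + z i + u i)) ^+ 2 <=
  (2 + 8 * n%:R) * (x ^+ 2 + \sum_i (x ^+ 2 + y i ^+ 2 + z i ^+ 2 + u i ^+ 2)).
Proof.
set A := \sum_i _; set B := \sum_i (_ ^+ 2 + _ + _ + _).
have B0 : 0 <= B by apply: sumr_ge0 => i _; rewrite !addr_ge0 ?sqr_ge0.
have hA : A ^+ 2 <= n%:R * (4 * B).
  rewrite (le_trans (sqr_sum_le _))// card_ord ler_wpM2l// mulr_sumr ler_sum// => i _.
  have h1 := sqr_ge0 (x - y i); have h2 := sqr_ge0 (x - z i); have h3 := sqr_ge0 (x - u i).
  have h4 := sqr_ge0 (y i - z i); have h5 := sqr_ge0 (y i - u i).
  have h6 := sqr_ge0 (z i - u i).
  rewrite !expr2 in h1 h2 h3 h4 h5 h6 *; lra.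
have h := sqr_ge0 (x - A); have n0 : 0 <= n%:R * x ^+ 2 by rewrite mulr_ge0// sqr_ge0.
have nB : 0 <= n%:R * B by rewrite mulr_ge0.
rewrite !expr2 in hA h n0 *; nra.
Qed.

Section energy_estimate.
Context {R : realType} {N : nat}.
Local Notation V := 'rV[R]_N.
Local Notation m2 := (@leb2 R N).
Local Notation m := (@leb R N).
Local Notation mu := (@lebesgue_measure R).
Local Notation RX := (measurableTypeR R * (V * V))%type.
Variables (T lambda eps M0 E0 F0 : R) (psi : R -> V -> R) (f0 : V -> V -> R) (f : R -> V -> V -> R).
Hypotheses (T_gt0 : 0 < T) (lambda_gt0 : 0 < lambda) (eps_gt0 : 0 < eps).
Hypotheses (M0_gt0 : 0 < M0) (F0_gt0 : 0 < F0).
Hypothesis sol : strong_solution T lambda eps psi f0 f.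
Hypothesis f0_ge0 : forall x v, 0 <= f0 x v.
Hypothesis f0_mass : (\int[m2]_p `|f0 p.1 p.2|%:E <= M0%:E)%E.
Hypothesis f0_energy : (\int[m2]_p `|enorm p.2 ^+ 2 * f0 p.1 p.2|%:E <= E0%:E)%E.
Hypothesis psi_W : L2_W1infty T psi.
Hypothesis psi_C0 : grad_C0 T psi.
Hypothesis psi_F0 : (L2norm T (fun t => Linfty_vec_norm (grad (psi t))) <= F0%:E)%E.

Let phi := phi_ lambda eps.
Let K : R := ((eps ^+ 2) `^ lambda)^-1.
Let mphi : measurable_fun setT phi := measurable_phi lambda eps.
Let phi0 r : 0 <= phi r := phi_ge0 lambda eps r.
Let phiK r : phi r <= K := phi_le lambda_gt0 eps_gt0 r.

Let ft (t : R) (p : V * V) : R := f t p.1 p.2.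
Let fc : RX -> R := cutoff T ft.
Let g : RX -> R := time_derivative T ft.

Let mft : measurable_fun (`]0, T[ `*` setT) (fun q : RX => ft q.1 q.2).
Proof. exact: (sol_decay sol).1. Qed.

Let f_AC (p : V * V) t (tT : t \in `[0, T[) := sol_time sol p.1 p.2 tT.

Let mfc : measurable_fun setT fc.
Proof. exact: measurable_cutoff. Qed.

Let mg : measurable_fun setT g.
Proof. exact: measurable_time_derivative. Qed.

Let fcE (t : R) : t \in `]0, T[ -> (fun x v => fc (t, (x, v))) = f t.
Proof.
by rewrite in_itv/= => tT; apply/funext => x; apply/funext => v; rewrite /fc /cutoff /= tT.
Qed.

(* [f] is cut off outside of ]0, T[, where it is not assumed measurable. *)
Definition dissipation_at (t : R) : R := dissipation (fun x v => fc (t, (x, v))) phi.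

Let m_diss : measurable_fun setT dissipation_at.
Proof. exact: (measurable_dissipation mfc mphi). Qed.

Let Psi (t : R) : R := fine (Linfty_vec_norm (grad (psi t))).

(** Two bounds on the force: the Lipschitz constant holds at every x and serves integrability, while
    the essential supremum [Psi t] enters the estimates. *)
Let ae_field : {ae mu, forall t, t \in `]0, T[ ->
  [/\ forall i, measurable_fun setT (fun x => grad (psi t) x 0 i),
      exists Pm, forall x i, `|grad (psi t) x 0 i| <= Pm,
      {ae m, forall x, enorm (grad (psi t) x) <= Psi t},
      0 <= Psi t &
      (Linfty_vec_norm (grad (psi t)) ^+ 2 = (Psi t ^+ 2)%:E)%E]}.
Proof.
have [_ hW _] := psi_W.
apply: (ae_lebS2 _ hW psi_C0) => t {}hW hC tT.
have [Kw [_ lip]] := hW tT; have [hgrad [cgrad _]] := hC tT.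
have Pm x i : `|grad (psi t) x 0 i| <= Kw.
  by rewrite mxE; apply: pd_lipschitz => //; exact: hgrad.
have L0 : (0 <= Linfty_vec_norm (grad (psi t)))%E by exact: Lnorm_ge0.
have Lfin : Linfty_vec_norm (grad (psi t)) \is a fin_num.
  rewrite ge0_fin_numE// /Linfty_vec_norm /Linfty_norm unlock.
  case: ifPn => // _; apply: (@le_lt_trans _ _ (Num.sqrt (N%:R * Kw ^+ 2))%:E); last exact: ltry.
  apply/ess_supP; apply: aeW => x /=.
  by rewrite lee_fin ger0_norm ?enorm_ge0// enorm_le_coord.
split.
- move=> i; apply: continuous_measurable_rV => x.
  apply: (@continuous_comp _ _ _ (grad (psi t)) (fun v : V => v 0 i)); first exact: cgrad.
  exact: coord_continuous.
- by exists Kw.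
(* The norm is an essential supremum only if the space has positive measure; otherwise it is 0 by
   convention and the claim is vacuous. *)
- have [m0|m0] := ltP 0%E (m setT).
    have := @ess_sup_ge _ _ _ m (fun x => (enorm (grad (psi t) x))%:E).
    apply: filterS => x hx; rewrite -lee_fin /Psi fineK//.
    rewrite /Linfty_vec_norm /Linfty_norm unlock m0.
    rewrite (_ : abse \o _ = (fun x => (enorm (grad (psi t) x))%:E))//.
    by apply/funext => y /=; rewrite ger0_norm// enorm_ge0.
  by apply: measure0_ae; apply/eqP; rewrite eq_le m0 measure_ge0.
- by rewrite /Psi fine_ge0.
- by rewrite /Psi -{1}(fineK Lfin).
Qed.

Let fx i (t : R) x v : R := pd i (fun y => f t y v) x.
Let fv i (t : R) x v : R := pd i (f t x) v.
Let fvv i (t : R) x v : R := pd i (pd i (f t x)) v.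

Let UU (t : R) : \bar R := (sqr_size T f t + \sum_(i < N)
  (sqr_size T f t + sqr_size T (fx i) t + sqr_size T (fv i) t + sqr_size T (fvv i) t))%E.

Let UU_int : time_integrable T UU.
Proof.
have h0 := time_integrable_sqr_size (sol_decay sol).
have h1 i : time_integrable T (sqr_size T (fx i)).
  exact: time_integrable_sqr_size (sol_decay_x sol i).
have h2 i : time_integrable T (sqr_size T (fv i)).
  exact: time_integrable_sqr_size (sol_decay_v sol i).
have h3 i : time_integrable T (sqr_size T (fvv i)).
  exact: time_integrable_sqr_size (sol_decay_vv sol i).
apply: time_integrableD => //; apply: time_integrable_sum => i.
apply: time_integrableD (h3 i); apply: time_integrableD (h2 i); exact: time_integrableD h0 (h1 i).
Qed.

(** The space-time equation with the measurable version [g] of the time derivative, sliced at almost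
    every time. *)
Let ae_equation : {ae mu, forall t, {ae m2, forall p, t \in `]0, T[ ->
  eps * g (t, p) + eps * dot p.2 (grad (fun y => f t y p.2) p.1)
  - dot (grad (psi t) p.1) (grad (f t p.1) p.2)
  = dvg (fun w => f t p.1 w *: w + grad (f t p.1) w
                  + (f t p.1 w * convol phi (rho (f t)) p.1) *: w
                  - f t p.1 w *: convolv phi (cur (f t)) p.1) p.2}}.
Proof.
have h1 := ae_prod_time_derivative m2 mft f_AC.
have h2 := sol_eq sol.
have h : {ae (mu \x m2)%E, forall q : RX, q.1 \in `]0, T[ ->
  eps * g q + eps * dot q.2.2 (grad (fun y => f q.1 y q.2.2) q.2.1)
  - dot (grad (psi q.1) q.2.1) (grad (f q.1 q.2.1) q.2.2)
  = dvg (fun w => f q.1 q.2.1 w *: w + grad (f q.1 q.2.1) w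
                  + (f q.1 q.2.1 w * convol phi (rho (f q.1)) q.2.1) *: w
                  - f q.1 q.2.1 w *: convolv phi (cur (f q.1)) q.2.1) q.2.2}.
  apply: filterS2 h1 h2 => q e1 e2 qT; rewrite -(e2 qT); congr (_ * _ + _ - _).
  exact: esym (e1 qT).
exact: (ae_sections h).
Qed.

(** The summand 1 makes the constant positive, so that it can be divided out. *)
Let cst_bound (a b : R) : R := N%:R * ((`|a| + `|b|) * (1 + eps^-1)) + 1.

Let ae_fixed_time : {ae mu, forall t, t \in `]0, T[ ->
  [/\ wL1 (fun p : V * V => f t p.1 p.2),
      forall a b, L1 m2 (fun p => quad a b p.2 * g (t, p)),
      exists2 w, (forall a b, eps * \int[m2]_p (quad a b p.2 * g (t, p)) =
        2 * b * (N%:R * total_mass (f t) - total_energy (f t) - dissipation (f t) phi / 2 - w)) &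
        2 * `|w| <= total_energy (f t) + Psi t ^+ 2 * total_mass (f t),
      (Linfty_vec_norm (grad (psi t)) ^+ 2 = (Psi t ^+ 2)%:E)%E &
      forall a b, ((\int[m2]_p `|quad a b p.2 * g (t, p)|)%:E <=
        (cst_bound a b)%:E * (Linfty_vec_norm (grad (psi t)) ^+ 2 +
          (1 + ((2 + 2 * K) * (2 + 8 * N%:R))%:E * UU t)))%E]}.
Proof.
have h0 := ae_wL1 (sol_decay sol).
have h1 := ae_leb_ord (fun i => ae_wL1 (sol_decay_x sol i)).
have h2 := ae_leb_ord (fun i => ae_wL1 (sol_decay_v sol i)).
have h3 := ae_leb_ord (fun i => ae_wL1 (sol_decay_vv sol i)).
have h := ae_lebI (ae_lebI h0 h1) (ae_lebI (ae_lebI h2 h3) (ae_lebI ae_field ae_equation)).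
apply: ae_lebS h => t [[{}h0 {}h1] [[{}h2 {}h3] [hf he]]] tT.
have {h0} [w0 s0] := h0 tT.
have w1 i := (h1 i tT).1; have s1 i := (h1 i tT).2.
have w2 i := (h2 i tT).1; have s2 i := (h2 i tT).2.
have w3 i := (h3 i tT).1; have s3 i := (h3 i tT).2.
have {hf} [mP [Pm hPm] PPsi Psi0 PsiE] := hf tT.
have {}he : {ae m2, forall p, eps * g (t, p) + eps * dot p.2 (grad (fun y => f t y p.2) p.1)
  - dot (grad (psi t) p.1) (grad (f t p.1) p.2)
  = dvg (fun w => f t p.1 w *: w + grad (f t p.1) w
                  + (f t p.1 w * convol phi (rho (f t)) p.1) *: w
                  - f t p.1 w *: convolv phi (cur (f t)) p.1) p.2}.
  by apply: filterS he => p; apply.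
have tT' : t \in `[0, T[ by move: tT; rewrite !in_itv/= => /andP[/ltW -> ->].
have F_ge0 x v : 0 <= f t x v by exact: sol_ge0 sol _ _ _ tT'.
have C12 := sol_space sol tT.
have mgt : measurable_fun setT (fun p => g (t, p)).
  by have := mg; move=> /(@measurable_fun_pair2 _ _ _ _ _ _ _ t).
have bal := balance eps_gt0 F_ge0 C12 w0 w1 w2 w3 mphi phi0 phiK mP hPm mgt he.
split => //.
- by move=> a b; exact: (L1_quad_dt eps_gt0 F_ge0 C12 w0 w1 w2 w3 mphi phi0 phiK mP hPm mgt he).
- exists (work (f t) (grad (psi t))) => //.
  exact: (work_le F_ge0 w0 mP hPm PPsi).
move=> a b.
have hb := quad_dt_bound eps_gt0 F_ge0 C12 w0 w1 w2 w3 mphi phi0 phiK mP hPm PPsi mgt he a b Psi0.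
set S := (\int[m2]_p (weight p * `|f t p.1 p.2|)) ^+ 2 + \sum_(i < N)
  ((\int[m2]_p (weight p * `|f t p.1 p.2|)) ^+ 2 +
   (\int[m2]_p (weight p * `|pd i ((f t)^~ p.2) p.1|)) ^+ 2 +
   (\int[m2]_p (weight p * `|pd i (f t p.1) p.2|)) ^+ 2 +
   (\int[m2]_p (weight p * `|pd i (pd i (f t p.1)) p.2|)) ^+ 2).
have UE : UU t = S%:E.
  by rewrite /UU s0; under eq_bigr do rewrite s1 s2 s3 -!EFinD; rewrite sumEFin -EFinD.
rewrite PsiE UE -!EFinM.
rewrite lee_fin.
rewrite (le_trans hb)// /cst_bound.
set C := N%:R * _ ; have C0 : 0 <= C.
  by rewrite mulr_ge0// mulr_ge0 ?addr_ge0// invr_ge0 ltW.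
have K0 : 0 <= K by rewrite invr_ge0 powR_ge0.
have hS : phase_size (f t) ^+ 2 <= (2 + 8 * N%:R) * S.
  by rewrite (phase_sizeE w0 w1 w2 w3); exact: sqr_sum4_le.
have hP := sqr_ge0 (Psi t); have S0 : 0 <= S.
  by rewrite addr_ge0 ?sqr_ge0// sumr_ge0// => i _; rewrite !addr_ge0 ?sqr_ge0.
have h4 : (2 + 2 * K) * phase_size (f t) ^+ 2 <= (2 + 2 * K) * ((2 + 8 * N%:R) * S).
  by rewrite ler_wpM2l// addr_ge0// mulr_ge0.
have h5 : 0 <= (2 + 2 * K) * phase_size (f t) ^+ 2.
  by rewrite mulr_ge0 ?sqr_ge0// addr_ge0// mulr_ge0.
rewrite mulrA in h4; rewrite ler_pM ?addr_ge0 ?lerDl// -addrA lerD2l; lra.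
Qed.

Let Q a b (s : R) (p : V * V) : R := quad a b p.2 * g (s, p).

Let mQ a b : measurable_fun setT (fun q : RX => Q a b q.1 q.2).
Proof.
apply: measurable_funM; last first.
  by rewrite (_ : (fun q => _) = g)//; apply/funext => -[].
have h : measurable_fun setT (fun p : V * V => quad a b p.2) by exact: measurable_quad.
exact: (measurableT_comp h measurable_snd).
Qed.

(** This finiteness is what permits Fubini's theorem for the weighted time derivative on ]0, T[
    times phase space. The comparison goes through the lower integral of the squared force norm. *)
Let int_quad_dt a b : (\int[mu]_(t in `]0%R, T[) \int[m2]_p `|Q a b t p|%:E < +oo)%E.
Proof.
have C1 : 0 < cst_bound a b.
  by rewrite ltr_wpDl// mulr_ge0// mulr_ge0// addr_ge0// invr_ge0 ltW.
have mk : measurable_fun setT (fun t => \int[m2]_p `|Q a b t p|%:E)%E.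
  apply: (@measurable_eint2 _ _ _ _ _ m2 (fun q : RX => `|Q a b q.1 q.2|%:E)).
  by apply/measurable_EFinP; exact: measurableT_comp.
have mI : measurable (`]0, T[%classic : set R) by exact: measurable_itv.
set L := ((2 + 2 * K) * (2 + 8 * N%:R)).
have L0 : 0 <= L.
  rewrite mulr_ge0// addr_ge0// mulr_ge0//.
  by rewrite invr_ge0 powR_ge0.
pose u t := (1 + L%:E * UU t)%E.
have [mUU UU0 UUoo] := UU_int.
have u0 t : (0 <= u t)%E by rewrite adde_ge0// mule_ge0.
have mu_ : measurable_fun setT u.
  by apply: emeasurable_funD => //; exact: emeasurable_funM.
have uoo : (\int[mu]_(t in `]0%R, T[) u t < +oo)%E.
  rewrite ge0_integralD//; last 2 first.
  - by move=> t _; rewrite mule_ge0.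
  - by apply: measurable_funTS; exact: emeasurable_funM.
  rewrite integral_cst// ge0_integralZl_EFin//; last exact: measurable_funTS.
  rewrite lte_add_pinfty//; first apply: lte_mul_pinfty => //; last exact: lte_mul_pinfty.
  have : (mu `]0%R, T[%classic < +oo)%E by rewrite lebesgue_measure_itv /= lte_fin T_gt0 sube0 ltry.
  by [].
have v0 t : (0 <= Linfty_vec_norm (grad (psi t)) ^+ 2)%E by rewrite expe_ge0// Lnorm_ge0.
have vle : (\int[mu]_(t in `]0%R, T[) (Linfty_vec_norm (grad (psi t)) ^+ 2) <= (F0 ^+ 2)%:E)%E.
  by apply: (@L2norm_le _ T _ (fun t => Lnorm_ge0 _ _ _)) => //; exact: ltW.
have k0 t : (0 <= \int[m2]_p `|Q a b t p|%:E)%E by apply: integral_ge0 => p _; rewrite lee_fin.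
have main : (\int[mu]_(t in `]0%R, T[) ((cst_bound a b)^-1%:E * \int[m2]_p `|Q a b t p|%:E) < +oo)%E.
  have := @ae_le_lower_integralD _ _ _ mu `]0, T[%classic
    (fun t => ((cst_bound a b)^-1%:E * \int[m2]_p `|Q a b t p|%:E)%E) u
    (fun t => Linfty_vec_norm (grad (psi t)) ^+ 2)%E.
  move=> /(_ mI) h; apply: (le_lt_trans (h _ _ _ _ _ _ _)) => //.
  - by apply: measurable_funTS; exact: emeasurable_funM.
  - exact: measurable_funTS.
  - by move=> t _; rewrite mule_ge0// lee_fin invr_ge0 ltW.
  - apply: ae_lebS ae_fixed_time => t ht /=; rewrite in_itv/= => tT.
    have [|_ IQ _ _ hb] := ht; first by rewrite in_itv.
    have {}hb := hb a b.
    have <- : ((\int[m2]_p `|Q a b t p|)%:E = \int[m2]_p `|Q a b t p|%:E)%E.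
      exact: EFin_Rint (integrable_norm (IQ a b)).
    by rewrite lee_pdivrMl.
  - by rewrite lte_add_pinfty// (le_lt_trans vle)// ltry.
move: main; rewrite ge0_integralZl_EFin//; last 2 first.
- exact: measurable_funTS.
- by rewrite invr_ge0 ltW.
by rewrite lte_pdivrMl// => /lt_le_trans; apply; rewrite leey.
Qed.

Let Qc a b tau : RX -> R := cutoff tau (Q a b).

Let mQc a b tau : measurable_fun setT (Qc a b tau).
Proof. by apply: measurable_cutoff; apply: measurable_funTS; exact: mQ. Qed.

Let QcE a b tau (s : R) p : s \in `]0, tau[ -> Qc a b tau (s, p) = Q a b s p.
Proof. by rewrite in_itv/= /Qc /cutoff /= => ->. Qed.

Let Qc0 a b tau (s : R) p : ~ s \in `]0, tau[ -> Qc a b tau (s, p) = 0.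
Proof. by rewrite in_itv/= /Qc /cutoff /= => /negP/negPf ->. Qed.

Let L1_Qc a b tau : tau <= T -> L1 (mu \x m2)%E (Qc a b tau).
Proof.
move=> tauT.
have : L1 (mu \x m2)%E (Qc a b T).
  apply/integrable12ltyP; first exact/measurable_EFinP.
  apply: le_lt_trans (int_quad_dt a b); rewrite [leRHS]integral_mkcond le_eqVlt.
  apply/orP; left; apply/eqP; apply: eq_integral => s _ /=; rewrite patchE.
  case: ifPn; rewrite ?inE /=; first by move=> sT; apply: eq_integral => p _; rewrite QcE.
  move=> sT; transitivity (\int[m2]_p (0 : \bar R))%E; last exact: integral0.
  by apply: eq_integral => p _; rewrite Qc0 ?normr0//; apply/negP; move: sT; rewrite notin_setE => /negP.
move=> /integrable_norm; apply: le_L1 => // q.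
rewrite /= /Qc /cutoff; case: ifPn => [/andP[q0 qt]|_]; last by rewrite normr0 normr_ge0.
by rewrite q0 (lt_le_trans qt tauT).
Qed.

(** The fundamental theorem of calculus in time at a fixed point of phase space; the derivative
    agrees with its measurable version at almost every time. *)
Let Rint_Qc1 a b tau p : tau \in `]0, T[ ->
  quad a b p.2 * f tau p.1 p.2 - quad a b p.2 * f 0 p.1 p.2 = \int[mu]_s Qc a b tau (s, p).
Proof.
move=> tauT; have tau0 : tau \in `[0, T[ by move: tauT; rewrite !in_itv/= => /andP[/ltW -> ->].
have [_ id ->] := f_AC p tau0.
have id' : mu.-integrable `]0, tau[ (fun s => (derive1 (fun r => f r p.1 p.2) s)%:E).
  by apply: integrableS id => //; exact: subset_itv_oo_cc.
rewrite mulrDr addrAC subrr add0r -Rintegral_itv_obnd_cbnd; last first.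
  by apply: integrableS id => //; exact: subset_itv_oc_cc.
rewrite -Rintegral_itv_bndo_bndc// -RintegralZl// Rintegral_mkcond.
apply: ae_eq_Rintegral.
- apply/measurable_EFinP; rewrite -restrict_EFin.
  have idq : mu.-integrable `]0, tau[
      (EFin \o (fun s => quad a b p.2 * derive1 (fun r => f r p.1 p.2) s)).
    by apply: (integrableZl _ _ id'); exact: measurable_itv.
  suff /integrableP[] : mu.-integrable setT
      ((EFin \o (fun s => quad a b p.2 * derive1 (fun r => f r p.1 p.2) s)) \_ `]0, tau[) by [].
  by apply: (iffLR (integrable_mkcond _ _) idq); exact: measurable_itv.
- by have := mQc a b tau; move=> /(@measurable_fun_pair1 _ _ _ _ _ _ _ p).
- apply: ae_lebS (@ae_time_derivative _ _ _ T ft f_AC p) => s hs; rewrite patchE.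
  case: ifPn; rewrite ?inE /= => st; last first.
    by rewrite Qc0//; apply/negP; move: st; rewrite notin_setE => /negP.
  have sT : s \in `]0, T[.
    move: st tauT; rewrite !in_itv/= => /andP[-> h1] /andP[_ h2]; exact: lt_trans h1 h2.
  by rewrite QcE//; congr (_ * _); exact: hs sT.
Qed.

Let mf0 : measurable_fun setT (fun p : V * V => f 0 p.1 p.2).
Proof.
(* With [n.+2] every u n lies strictly below T, also for n = 0. *)
pose u (n : nat) : R := T / n.+2%:R.
have u0 n : 0 < u n by rewrite divr_gt0.
have uT n : u n \in `]0, T[ by rewrite in_itv/= u0 ltr_pdivrMr// ltr_pMr// ltr1n.
have ucvg : u n @[n --> \oo] --> (0 : R).
  rewrite -(mulr0 T); apply: cvgM; first exact: cvg_cst.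
  by have := @cvg_harmonic R; rewrite -(cvg_shiftS (@harmonic R)).
apply: (measurable_fun_cvg (h := fun n (p : V * V) => f (u n) p.1 p.2)).
- by move=> n; exact: (decaying_measurable (sol_decay sol) (uT n)).
- by move=> p _; exact: (@continuous_at0 _ _ _ T ft f_AC p u T_gt0 u0 ucvg).
Qed.

Let f_init (p : V * V) : f 0 p.1 p.2 = f0 p.1 p.2.
Proof. exact: sol_init sol _ _. Qed.

Let I_mass : L1 m2 (fun p => f 0 p.1 p.2).
Proof.
apply: L1_abs_lty mf0 _; under eq_integral do rewrite f_init.
by rewrite (le_lt_trans f0_mass)// ltry.
Qed.

Let I_energy : L1 m2 (fun p => dot p.2 p.2 * f 0 p.1 p.2).
Proof.
apply: L1_abs_lty; first by apply: measurable_funM => //; apply: measurable_dot => i; exact: measurable_coord2.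
under eq_integral do rewrite f_init -sqr_enorm.
by rewrite (le_lt_trans f0_energy)// ltry.
Qed.

Let L1_init a b : L1 m2 (fun p => quad a b p.2 * f 0 p.1 p.2).
Proof.
have := L1D (L1Z a I_mass) (L1Z b I_energy); apply: eq_integrable => // p _ /=.
by rewrite /quad mulrDl mulrA.
Qed.

Let init_mass : \int[m2]_p (quad 1 0 p.2 * f 0 p.1 p.2) <= M0.
Proof.
rewrite -lee_fin; apply: le_trans f0_mass.
rewrite EFin_Rint// le_eqVlt; apply/orP; left; apply/eqP; apply: eq_integral => p _.
by rewrite f_init /quad mul0r addr0 mul1r ger0_norm.
Qed.

Let init_energy : \int[m2]_p (quad 0 1 p.2 * f 0 p.1 p.2) <= E0.
Proof.
rewrite -lee_fin; apply: le_trans f0_energy; rewrite EFin_Rint// le_eqVlt.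
apply/orP; left; apply/eqP; apply: eq_integral => p _.
by rewrite f_init /quad add0r mul1r sqr_enorm ger0_norm// mulr_ge0// dot_ge0.
Qed.

Let B a b (s : R) : R := \int[m2]_p Q a b s p.

Let RintQc a b tau (s : R) : \int[m2]_p Qc a b tau (s, p) = (B a b \_ `]0, tau[) s.
Proof.
rewrite patchE; case: ifPn; rewrite ?inE /= => st.
  by apply: eq_Rintegral => p _; rewrite QcE.
transitivity (\int[m2]_p (0 : R)); last exact: Rint_0.
by apply: eq_Rintegral => p _; rewrite Qc0//; apply/negP; move: st; rewrite notin_setE => /negP.
Qed.

Let RintB a b tau :
  \int[mu]_(s in `]0, tau[) B a b s = \int[mu]_s \int[m2]_p Qc a b tau (s, p).
Proof. by rewrite Rintegral_mkcond; apply: eq_Rintegral => s _; rewrite RintQc. Qed.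

Let int_B a b : mu.-integrable `]0, T[ (EFin \o B a b).
Proof.
apply: (iffRL (integrable_mkcond _ _)); first exact: measurable_itv.
have := L1_Rint2 (L1_Qc a b (lexx T)); apply: eq_integrable => // s _ /=.
by rewrite RintQc restrict_EFin.
Qed.

Let Rint_at a b tau : tau \in `]0, T[ -> \int[m2]_p (quad a b p.2 * f tau p.1 p.2) =
  \int[m2]_p (quad a b p.2 * f 0 p.1 p.2) + \int[mu]_(s in `]0, tau[) B a b s.
Proof.
move=> tauT; have tT : tau <= T by move: tauT; rewrite in_itv/= => /andP[_ /ltW].
rewrite RintB -(Rint12 (L1_Qc a b tT)) (Rint21 (L1_Qc a b tT)) -RintegralD//; last first.
  exact: L1_Rint1 (L1_Qc a b tT).
by apply: eq_Rintegral => p _; rewrite -Rint_Qc1// addrC subrK.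
Qed.

(** For [a = 1] and [b = 0] the balance says that the weighted time derivative has zero integral at
    almost every time. *)
Let mass_at tau : tau \in `]0, T[ -> total_mass (f tau) <= M0.
Proof.
move=> tauT; apply: le_trans init_mass.
have -> : total_mass (f tau) = \int[m2]_p (quad 1 0 p.2 * f tau p.1 p.2).
  by apply: eq_Rintegral => p _; rewrite /quad mul0r addr0 mul1r.
rewrite Rint_at// gerDl [X in X <= _](_ : _ = 0)//.
rewrite RintB -[RHS](Rint_0 mu); apply: ae_eq_Rintegral => //.
  exact: (@measurable_Rint2 _ _ _ _ _ m2 (Qc 1 0 tau)).
apply: ae_lebS ae_fixed_time => s hs; rewrite RintQc patchE; case: ifPn => //; rewrite inE /= => st.
have sT : s \in `]0, T[.
  move: st tauT; rewrite !in_itv/= => /andP[-> h1] /andP[_ h2]; exact: lt_trans h1 h2.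
have [_ _ [w h _] _ _] := hs sT; apply: (mulfI (lt0r_neq0 eps_gt0)).
by rewrite mulr0 /B /Q h mulr0 mul0r.
Qed.

(** The integral up to tau is the energy at tau, which is nonnegative, minus the initial energy, at
    most [E0]. *)
Let B_ge : - E0 <= \int[mu]_(s in `]0, T[) B 0 1 s.
Proof.
apply: (Rintegral_ge_itvoo T_gt0 (int_B 0 1)) => tau tauT.
have h := Rint_at 0 1 tauT; have h2 := init_energy.
have : 0 <= \int[m2]_p (quad 0 1 p.2 * f tau p.1 p.2).
  apply: Rintegral_ge0 => p _; rewrite mulr_ge0//.
    by rewrite /quad add0r mul1r dot_ge0.
  by apply: (sol_ge0 sol); move: tauT; rewrite !in_itv/= => /andP[/ltW -> ->].
lra.
Qed.

(** In the balance -2 [total_energy] - 2w is at most Psi^2 times the mass by [work_le], the energy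
    left over being discarded with its negative sign. *)
Let ae_balance : {ae mu, forall t, t \in `]0, T[ ->
  [/\ wL1 (fun p : V * V => f t p.1 p.2), dissipation_at t = dissipation (f t) phi,
      0 <= dissipation_at t,
      (Linfty_vec_norm (grad (psi t)) ^+ 2 = (Psi t ^+ 2)%:E)%E &
      dissipation_at t + eps * B 0 1 t <= 2 * N%:R * M0 + M0 * Psi t ^+ 2]}.
Proof.
apply: ae_lebS ae_fixed_time => t ht tT.
have {ht} [w0 _ [w hw wle] PsiE _] := ht tT.
have tT' : t \in `[0, T[ by move: tT; rewrite !in_itv/= => /andP[/ltW -> ->].
have F_ge0 x v : 0 <= f t x v by exact: sol_ge0 sol _ _ _ tT'.
have dE : dissipation_at t = dissipation (f t) phi by rewrite /dissipation_at fcE.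
have D0 : 0 <= dissipation (f t) phi by exact: (dissipation_ge0 F_ge0 w0 mphi phi0 phiK).
split; [exact: w0|exact: dE|by rewrite dE|exact: PsiE|].
have E_ge0 : 0 <= total_energy (f t).
  by apply: Rintegral_ge0 => p _; exact: mulr_ge0 (dot_ge0 _) (F_ge0 _ _).
have hM := mass_at tT; have hB : eps * B 0 1 t = _ := hw 0 1.
have h1 := ler_wpM2l (ler0n R N) hM.
have h2 := ler_wpM2l (sqr_ge0 (Psi t)) hM.
have h3 := ler_norm (- w); rewrite normrN in h3.
rewrite hB dE; lra.
Qed.

Lemma ae_state : {ae mu, forall t, t \in `]0, T[ ->
  [/\ wL1 (fun p : V * V => f t p.1 p.2), total_mass (f t) <= M0 &
      dissipation_at t = dissipation (f t) phi]}.
Proof.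
by apply: ae_lebS ae_balance => t ht tT; have [h1 h2 _ _ _] := ht tT; split;
  [exact: h1|exact: mass_at|exact: h2].
Qed.

Lemma measurable_dissipation_at : measurable_fun setT dissipation_at.
Proof. exact: m_diss. Qed.

Lemma integral_dissipation_le : (\int[mu]_(t in `]0%R, T[) `|dissipation_at t|%:E <=
  (M0 * F0 ^+ 2 + 2 * N%:R * M0 * T + eps * E0)%:E)%E.
Proof.
apply: (@integral_le_of_balance _ T eps M0 E0 F0 (2 * N%:R) dissipation_at (B 0 1)
  (fun t => Linfty_vec_norm (grad (psi t)) ^+ 2)%E) => //.
- exact: (@measurable_Rint2 _ _ _ _ _ m2 (fun q : RX => Q 0 1 q.1 q.2)).
- by move=> t; rewrite expe_ge0// Lnorm_ge0.
- by apply: (@L2norm_le _ T _ (fun t => Lnorm_ge0 _ _ _)) => //; exact: ltW.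
apply: ae_lebS ae_balance => t ht tT; have [_ _ D0 -> hb] := ht tT; split; first exact: D0.
by rewrite -EFinM -EFinD lee_fin [leRHS]addrC.
Qed.

End energy_estimate.

(** * Lower limits *)

Section lower_limits.
Context {R : realType}.
Local Open Scope ereal_scope.

(** Points chosen along a mere subsequence, here the eps_k with bounded dissipation, thus suffice to
    bound the continuous lower limit. *)
Lemma limf_einf_le_frequently (h : R -> \bar R) (c : \bar R) :
  (forall A, (0%R : R)^'+ A -> exists2 x, A x & h x <= c) ->
  limf_einf h (0%R : R)^'+ <= c.
Proof.
move=> hc; rewrite limf_einfE; apply: ge_ereal_sup => _ [A FA <-].
have [x Ax hx] := hc A FA; apply: le_trans hx; apply: ereal_inf_lbound; by exists x.
Qed.

Lemma limf_einf_ge0 (h : R -> \bar R) : (forall x, 0 <= h x) ->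
  0 <= limf_einf h (0%R : R)^'+.
Proof.
move=> h0; rewrite limf_einfE.
apply: (@le_trans _ _ (ereal_inf [set h x | x in setT])); last first.
  by apply: ereal_sup_ubound; exists setT => //; exact: filterT.
by apply: le_ereal_inf_tmp => _ [x _ <-].
Qed.

Lemma limn_einf_frequently (u : (\bar R)^nat) (c : \bar R) : limn_einf u < c ->
  forall n, exists2 k, (n <= k)%N & u k < c.
Proof.
move=> uc n; have /ereal_inf_lt[_ [k /= nk <-] ukc] : einfs u n < c.
  apply: le_lt_trans uc; rewrite limn_einf_lim (cvg_lim _ (@cvg_einfs_sup _ u))//.
  by apply: ereal_sup_ubound; exists n.
by exists k.
Qed.

Lemma limn_einf_le (u : (\bar R)^nat) (c : \bar R) : (forall n, u n <= c) ->
  limn_einf u <= c.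
Proof.
move=> uc; rewrite limn_einf_lim; apply: lime_le; first exact: is_cvg_einfs.
apply: nearW => n; apply: le_trans (uc n); apply: ereal_inf_lbound; by exists n => /=.
Qed.

Lemma ae_limn_einf_lty d (T : measurableType d) (mu : {measure set T -> \bar R})
    (D : set T) (f : (T -> \bar R)^nat) (c : R) :
  measurable D -> (forall n, measurable_fun D (f n)) ->
  (forall n x, D x -> 0 <= f n x) ->
  (forall n, \int[mu]_(x in D) f n x <= c%:E) ->
  {ae mu, forall x, D x -> limn_einf (f ^~ x) < +oo}.
Proof.
move=> mD mf f0 fc.
have l0 x : D x -> 0 <= limn_einf (f ^~ x).
  move=> Dx; rewrite limn_einf_lim; apply: lime_ge; first exact: is_cvg_einfs.
  by apply: nearW => n; apply: le_ereal_inf_tmp => _ [k /= _ <-]; exact: f0.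
have : mu.-integrable D (fun x => limn_einf (f ^~ x)).
  apply/integrableP; split.
    apply: measurableT_comp => //; apply: measurable_fun_limn_esup => n.
    exact: measurableT_comp.
  under eq_integral => x /[!inE] Dx do rewrite gee0_abs ?l0//.
  apply: le_lt_trans (fatou mu mD mf f0) _; apply: le_lt_trans (limn_einf_le fc) _.
  exact: ltry.
move=> /integrable_ae -/(_ mD); apply: filterS => x hx Dx.
by have := hx Dx; rewrite ge0_fin_numE ?l0.
Qed.

End lower_limits.

Lemma commutator_ge0 {R : realType} {N : nat} (F : 'rV[R]_N -> 'rV[R]_N -> R) r :
  (0 <= commutator F r)%E.
Proof. by apply: integral_ge0 => p _; rewrite lee_fin enorm_ge0. Qed.

Lemma powR_sqr_small {R : realType} (lambda c e : R) : 0 < lambda -> 0 < c -> 0 < e ->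
  \forall r \near (0 : R)^'+, (c * r ^+ 2) `^ lambda <= e.
Proof.
(* The threshold [rho] solves (c rho^2)^lambda = e. *)
move=> l0 c0 e0; pose rho := Num.sqrt (e `^ lambda^-1 / c).
have rho0 : 0 < rho by rewrite sqrtr_gt0 divr_gt0// powR_gt0.
near=> r; have r0 : 0 < r by near: r; exact: nbhs_right_gt.
have rr : r <= rho by near: r; exact: nbhs_right_le.
have -> : e = (e `^ lambda^-1) `^ lambda by rewrite -powRrM mulVf ?gt_eqF// powRr1// ltW.
apply: ge0_ler_powR; [exact: ltW|by rewrite nnegrE mulr_ge0 ?sqr_ge0// ltW|by rewrite nnegrE powR_ge0|].
rewrite mulrC -ler_pdivlMr//; have -> : e `^ lambda^-1 / c = rho ^+ 2.
  by rewrite sqr_sqrtr// divr_ge0 ?powR_ge0// ltW.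
by rewrite ler_pXn2r// ?nnegrE ltW.
Unshelve. all: by end_near. Qed.

(** The choice of [delta] keeps the mass term below [eta], the condition on [kappa] does the same
    for the dissipation term, and the bound is their mean. *)
Lemma mean_budget {R : realType} (M m eta L D kappa : R) (delta := eta / M ^+ 2) :
  0 < M -> 0 < eta -> 0 < L -> 0 <= m -> m <= M -> D <= L ->
  0 <= kappa -> kappa <= eta * delta / L ->
  (delta * m ^+ 2 + kappa / delta * D) / 2 <= eta.
Proof.
move=> M0 eta0 L0 m0 mM DL k0 hk.
have delta0 : 0 < delta by rewrite divr_gt0// exprn_gt0.
have h1 : delta * m ^+ 2 <= eta.
  have -> : eta = delta * M ^+ 2 by rewrite /delta divfK// gt_eqF// exprn_gt0.
  by rewrite (ler_pM2l delta0) ler_pXn2r ?nnegrE// ltW.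
have h2 : kappa / delta * D <= eta.
  have -> : eta = eta * delta / L / delta * L by field; rewrite !gt_eqF.
  apply: (@le_trans _ _ (kappa / delta * L)).
    by rewrite ler_wpM2l// divr_ge0// ltW.
  by rewrite ler_wpM2r ?(ltW L0)// ler_wpM2r// invr_ge0 ltW.
by rewrite ler_pdivrMr// mulrDr mulr1 lerD.
Qed.

Theorem lemma3p10 (R : realType) (N : nat) (T lambda M0 E0 F0 : R)
    (f0 : R -> 'rV[R]_N -> 'rV[R]_N -> R)
    (rho0 : {charge set 'rV[R]_N -> \bar R})
    (psi_ : R -> R -> 'rV[R]_N -> R) (psi : R -> 'rV[R]_N -> R)
    (f : R -> R -> 'rV[R]_N -> 'rV[R]_N -> R)
    (T_gt0 : 0 < T) (lambda_gt0 : 0 < lambda) (lambda_lt : lambda < N%:R / 2)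
    (M0_gt0 : 0 < M0) (E0_gt0 : 0 < E0) (F0_gt0 : 0 < F0)
    (hH1 : H1 M0 E0 f0 rho0) (hH2 : H2 T F0 psi_ psi)
    (hf : forall eps : R, 0 < eps ->
       strong_solution T lambda eps (psi_ eps) (f0 eps) (f eps)) :
  {ae (@lebesgue_measure R), forall t, t \in `[0, T[ ->
    limf_einf (fun r : R =>
      limf_einf (fun eps : R => commutator (f eps t) r) 0^'+) 0^'+ = 0%E}.
Proof.
pose e (k : nat) : R := k.+1%:R^-1.
have e0 k : 0 < e k by rewrite invr_gt0.
have e1 k : e k <= 1 by rewrite invf_le1// ler1n.
(* The energy estimate with eps E0 replaced by E0, since eps_k <= 1; the constant is uniform in
   k. *)
pose c : R := M0 * F0 ^+ 2 + 2 * N%:R * M0 * T + E0.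
pose D k t : \bar R := `|dissipation_at T lambda (e k) (f (e k)) t|%:E.
have mD k : measurable_fun `]0, T[ (D k).
  apply/measurable_EFinP/measurable_funTS; apply: measurableT_comp => //.
  have h := measurable_dissipation_at (hf _ (e0 k)).
  exact: h.
have Dc k : (\int[@lebesgue_measure R]_(t in `]0%R, T[) D k t <= c%:E)%E.
  have [h0 _ hm he] := hH1.1 _ (e0 k); have [hp _ _ _] := hH2; have [hW hC hF] := hp _ (e0 k).
  apply: le_trans (integral_dissipation_le T_gt0 lambda_gt0 (e0 k) M0_gt0 F0_gt0 (hf _ (e0 k))
    h0 hm he hW hC hF) _.
  by rewrite lee_fin lerD2l ler_piMl// ltW.
have D0 k t : `]0, T[%classic t -> (0 <= D k t)%E by rewrite lee_fin.
have hD : {ae @lebesgue_measure R, forall t, `]0, T[%classic t ->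
    (limn_einf (D ^~ t) < +oo)%E}.
  by apply: (ae_limn_einf_lty (mu := @lebesgue_measure R) _ mD D0 Dc); exact: measurable_itv.
have hst : {ae @lebesgue_measure R, forall t, forall k, t \in `]0, T[ ->
  [/\ wL1 (fun p : 'rV[R]_N * 'rV[R]_N => f (e k) t p.1 p.2), total_mass (f (e k) t) <= M0 &
    dissipation_at T lambda (e k) (f (e k)) t = dissipation (f (e k) t) (phi_ lambda (e k))]}.
  apply: ae_foralln => k.
  have [h0 _ hm he] := hH1.1 _ (e0 k); have [hp _ _ _] := hH2; have [hW hC hF] := hp _ (e0 k).
  exact: (ae_state T_gt0 lambda_gt0 (e0 k) F0_gt0 (hf _ (e0 k)) h0 hm he hW hC hF).
(* The claim includes t = 0 but the estimates hold on ]0, T[; a single time is negligible. *)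
have ht0 : {ae @lebesgue_measure R, forall t, t != 0}.
  exists [set 0]; split => //; first exact: lebesgue_measure_set1.
  by move=> t /= /negP; rewrite negbK => /eqP.
apply: ae_lebS (ae_lebI ht0 (ae_lebI hD hst)) => t [t0 [{}hD {}hst]] tT.
have tT' : t \in `]0, T[.
  by move: tT; rewrite !in_itv/= => /andP[t1 ->]; rewrite lt_neqAle eq_sym t0 t1.
have {}hD : (limn_einf (D ^~ t) < +oo)%E by apply: hD.
have {}hst k := hst k tT'.
apply/eqP; rewrite eq_le; apply/andP; split; last first.
  by apply: limf_einf_ge0 => r; apply: limf_einf_ge0 => eps; exact: commutator_ge0.
(* [L] is a divisor below, so it is taken positive as well as strictly above the lower limit. *)
have [L L0 hL] : exists2 L : R, 0 < L & (limn_einf (D ^~ t) < L%:E)%E.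
  move: hD; case: (limn_einf _) => [l _|//|_]; last by exists 1; rewrite ?ltNyr.
  by exists (Num.max 1 (l + 1)); rewrite ?lte_fin lt_max ?ltr01 ?ltrDl ?ltr01 ?orbT.
apply/lee_addgt0Pr => eta eta0; rewrite add0e.
pose delta := eta / M0 ^+ 2.
have delta0 : 0 < delta by rewrite divr_gt0// exprn_gt0.
(* [L] and [delta] are fixed at this point, so r can be picked in A with the kernel factor below eta
   delta / L before any eps is chosen. *)
apply: limf_einf_le_frequently => A FA.
have := @powR_sqr_small R lambda (1 + c_ lambda) (eta * delta / L) lambda_gt0.
move=> /(_ (addr_gt0 ltr01 (c_gt0 lambda_gt0)) (divr_gt0 (mulr_gt0 eta0 delta0) L0)) hr.
have [r [[Ar hr'] r0]] := filter_ex (filterI (filterI FA hr) (nbhs_right_gt (0 : R))).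
exists r => //; apply: limf_einf_le_frequently => A' FA'.
have [n hn] : exists n, forall k, (n <= k)%N -> A' (e k) /\ e k <= r.
  have /nbhs_ballP[d /= d0 hd] := FA'.
  have dr0 : 0 < Num.min d r by rewrite lt_min d0.
  have [n _ hn] := near_infty_natSinv_lt (PosNum dr0); exists n => k nk.
  have /= := hn k nk; rewrite lt_min => /andP[kd /ltW kr]; split => //.
  by apply: hd => //=; rewrite /ball /= sub0r normrN gtr0_norm.
(* Beyond n every eps_k lies in A' and is at most r; among these indices one has dissipation below
   [L]. *)
have [k nk Dk] := limn_einf_frequently hL n.
have [A'k kr] := hn k nk; exists (e k) => //.
have [w0 hM dE] := hst k.
have F_ge0 x v : 0 <= f (e k) t x v by exact: (sol_ge0 (hf _ (e0 k))).
apply: le_trans (commutator_le F_ge0 w0 (measurable_phi lambda (e k)) (phi_ge0 lambda (e k))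
  (phi_le lambda_gt0 (e0 k)) delta0 (powR_ge0 ((1 + c_ lambda) * r ^+ 2) lambda)
  (fun r' => phi_near lambda_gt0 (e0 k) kr)) _.
rewrite lee_fin -/(total_mass (f (e k) t)) -dE.
have Dk' : dissipation_at T lambda (e k) (f (e k)) t <= L.
  by apply: le_trans (ler_norm _) _; rewrite -lee_fin ltW.
have m0 : 0 <= total_mass (f (e k) t) by apply: Rintegral_ge0 => p _; exact: F_ge0.
exact: (mean_budget M0_gt0 eta0 L0 m0 hM Dk' (powR_ge0 _ _) hr').
Qed.
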